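(* Let $\Sigma=(A,B,C,D;\mathcal X,\mathcal U,\mathcal Y)$ be a minimal system, and assume that its transfer function coincides with a Schur class function in a neighborhood of zero. Then the set $\mathrm{RE}_\Sigma^\circ$ is nonempty and this set contains a minimal element with respect to the usual partial ordering $\prec$ of (possibly unbounded) nonnegative selfadjoint operators.
   Context: A system $\Sigma=(A,B,C,D;\mathcal X,\mathcal U,\mathcal Y)$ is the discrete time-invariant linear system $x_{n+1}=Ax_n+Bu_n$, $y_n=Cx_n+Du_n$ $(n\ge 0)$, where $A:\mathcal X\to\mathcal X$, $B:\mathcal U\to\mathcal X$, $C:\mathcal X\to\mathcal Y$, $D:\mathcal U\to\mathcal Y$ are bounded linear operators between separable (complex) Hilbert spaces. Its transfer function is $\theta_\Sigma(\lambda)=D+\lambda C(I-\lambda A)^{-1}B$, defined for those $\lambda\in\mathbb C$ for which $I-\lambda A$ is boundedly invertible. Put $\operatorname{Im}(A|B)=\operatorname{span}\{\operatorname{Im}A^nB\mid n\ge 0\}$ (linear span, not closed), $\operatorname{Im}(A^*|C^* )=\operatorname{span}\{\operatorname{Im}(A^* )^nC^*\mid n\ge0\}$ and $\operatorname{Ker}(C|A)=\bigcap_{n\ge0}\operatorname{Ker}CA^n$. $\Sigma$ is minimal if $\operatorname{Im}(A|B)$ is dense in $\mathcal X$ and $\operatorname{Ker}(C|A)=\{0\}$. The Schur class $\mathcal S(\mathcal U,\mathcal Y)$ consists of the functions $\theta$ analytic on the open unit disc $\mathbb D$ with values bounded operators $\mathcal U\to\mathcal Y$ with $\|\theta(z)\|\le1$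 for all $z\in\mathbb D$. For a bounded selfadjoint operator $T$ on a Hilbert space $\mathcal H$, put $\mathcal H_1=\overline{T\mathcal H}$, $\mathcal H_2=\operatorname{Ker}T=\mathcal H\ominus\mathcal H_1$, $T_1=T|_{\mathcal H_1}$ (injective on $\mathcal H_1$). The Moore--Penrose pseudo-inverse $T^{[-1]}$ is the (possibly unbounded) selfadjoint operator with domain $\operatorname{Im}T_1\oplus\mathcal H_2$ acting as $T_1^{-1}$ on $\operatorname{Im}T_1$ and as $0$ on $\mathcal H_2$. $\mathcal D(\cdot)$ denotes the domain of an operator. $\mathrm{RE}_\Sigma$ is the set of all (possibly unbounded) selfadjoint operators $H$ in $\mathcal X$ such that: (1) $\langle Hx,x\rangle>0$ for each $0\ne x\in\mathcal D(H)$; (2) $A\mathcal D(H^{1/2})\subset\mathcal D(H^{1/2})$ and $B\mathcal U\subset\mathcal D(H^{1/2})$ (so $H^{1/2}B:\mathcal U\to\mathcal X$ is bounded); (3) the operator $\delta_\Sigma(H)=I_{\mathcal U}-D^*D-(H^{1/2}B)^*H^{1/2}B$ is bounded and nonnegative, and $\big(D^*C+(H^{1/2}B)^*H^{1/2}A\big)\mathcal D(H^{1/2})\subset\delta_\Sigma(H)^{1/2}\mathcal U$; (4) for each $x\in\mathcal D(H^{1/2})$, $$\|H^{1/2}x\|^2-\|H^{1/2}Ax\|^2-\|Cx\|^2=\big\|\big(\delta_\Sigma(H)^{1/2}\big)^{[-1]}\big(D^*C+(H^{1/2}B)^*H^{1/2}A\big)x\big\|^2 .$$ For $H\in\mathrm{RE}_\Sigma$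 one has $\operatorname{Im}(A|B)\subset\mathcal D(H^{1/2})$ and $\operatorname{Im}(A^*|C^* )\subset\mathcal D(H^{-1/2})$. $\mathrm{RE}_\Sigma^\circ$ is the set of all $H\in\mathrm{RE}_\Sigma$ such that (a) both $H^{1/2}\operatorname{Im}(A|B)$ and $H^{-1/2}\operatorname{Im}(A^*|C^* )$ are dense in $\mathcal X$, and (b) $\operatorname{Im}(A|B)$ is a core for $H^{1/2}$, i.e. $\{(u,H^{1/2}u)\mid u\in\operatorname{Im}(A|B)\}$ is dense in the graph of $H^{1/2}$ with respect to the graph norm. For nonnegative selfadjoint operators $H_1,H_2$ in $\mathcal X$, $H_1\prec H_2$ means that $\mathcal D(H_2^{1/2})\subset\mathcal D(H_1^{1/2})$ and $\|H_1^{1/2}x\|\le\|H_2^{1/2}x\|$ for all $x\in\mathcal D(H_2^{1/2})$. *)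

(* Defs.v *)
From HB Require Import structures.
From mathcomp Require Import all_boot all_order all_algebra sesquilinear.
From mathcomp Require Import complex.
From mathcomp Require Import all_classical all_reals all_analysis.

Set Implicit Arguments.
Unset Strict Implicit.
Unset Printing Implicit Defensive.

Import Order.TTheory GRing.Theory Num.Theory.
Import numFieldNormedType.Exports.

Local Open Scope classical_set_scope.
Local Open Scope ring_scope.

(* Norms and inner products take values in R[i], whose order is partial:
   0 < e means that e is real and positive. *)

HB.mixin Record CompleteNormedModule_isHilbert (R : realType) H
    & CompleteNormedModule R[i] H := {
  (* linear in the first argument, conjugate-linear in the second *)
  inner : {dot H for (@Num.conj R[i])} ;
  inner_norm : forall x : H, inner x x = `|x| ^+ 2
}.

#[short(type="hilbertType")]
HB.structure Definition Hilbert (R : realType) :=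
  {H of CompleteNormedModule R[i] H & CompleteNormedModule_isHilbert R H}.

Definition separable (T : topologicalType) : Prop :=
  exists2 S : set T, countable S & dense S.

Section Operators.
Variable R : realType.
Implicit Types U V W : hilbertType R.

Definition bounded_op U V (f : U -> V) : Prop :=
  exists M : R[i], forall x, `|f x| <= M * `|x|.

(* A possibly unbounded operator from U to V is represented by its graph, a
   subset of U * V. Hence two operators are equal exactly when they have the
   same domain and the same values. *)

Definition graph U V (f : U -> V) : set (U * V) := [set p | p.2 = f p.1].

Definition dom U V (T : set (U * V)) : set U := [set x | exists y, T (x, y)].

Definition ran U V (T : set (U * V)) : set V := [set y | exists x, T (x, y)].

Definition ker U V (T : set (U * V)) : set U := [set x | T (x, 0)].

(* meaningful only for x in dom T *)
Definition app U V (T : set (U * V)) (x : U) : V := xget 0 [set y | T (x, y)].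

Definition op_comp U V W (T : set (V * W)) (S : set (U * V)) : set (U * W) :=
  [set p | exists2 y, S (p.1, y) & T (y, p.2)].

(* the graph of T^-1, for injective T *)
Definition op_inv U V (T : set (U * V)) : set (V * U) :=
  [set p | T (p.2, p.1)].

(* The graph of T^*: a linear subspace for every T, and single-valued when
   dom T is dense. *)
Definition op_adj U V (T : set (U * V)) : set (V * U) :=
  [set p | forall x y, T (x, y) -> inner y p.1 = inner x p.2].

(* f^* for a bounded linear f; it is then defined everywhere *)
Definition adj U V (f : U -> V) : V -> U := app (op_adj (graph f)).

(* Linearity and single-valuedness of T follow from those of T^*. *)
Definition selfadjoint U (T : set (U * U)) : Prop :=
  dense (dom T) /\ op_adj T = T.

Definition nonneg U (T : set (U * U)) : Prop :=
  forall x, dom T x -> 0 <= inner (app T x) x.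

(* H^{1/2}: the nonnegative selfadjoint square root of a nonnegative
   selfadjoint operator H *)
Definition is_sqrt U (H S : set (U * U)) : Prop :=
  [/\ selfadjoint S, nonneg S & op_comp S S = H].

Definition op_sqrt U (H : set (U * U)) : set (U * U) :=
  xget set0 [set S | is_sqrt H S].

(* Moore-Penrose pseudo-inverse T^{[-1]} of a bounded selfadjoint T: it maps
   T x + k to x, for x in the closure of ran T and k in ker T. *)
Definition pinv U (T : set (U * U)) : set (U * U) :=
  [set p | exists y k,
     [/\ closure (ran T) p.2, T (p.2, y), ker T k & p.1 = y + k]].

Definition is_core U (W : set U) (T : set (U * U)) : Prop :=
  W `<=` dom T /\
  forall x, dom T x -> forall e : R[i], 0 < e ->
    exists2 u, W u & `|x - u| ^+ 2 + `|app T x - app T u| ^+ 2 < e ^+ 2.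

Definition prec U (H1 H2 : set (U * U)) : Prop :=
  dom (op_sqrt H2) `<=` dom (op_sqrt H1) /\
  forall x, dom (op_sqrt H2) x ->
    `|app (op_sqrt H1) x| <= `|app (op_sqrt H2) x|.

Definition lin_span U (W : set U) : set U :=
  [set x | exists n (c : 'I_n -> R[i]) (v : 'I_n -> U),
     (forall i, W (v i)) /\ x = \sum_i c i *: v i].

End Operators.

Record system (R : realType) (X U Y : hilbertType R) := System {
  sysA : {linear X -> X};
  sysB : {linear U -> X};
  sysC : {linear X -> Y};
  sysD : {linear U -> Y};
  sysA_bounded : bounded_op sysA;
  sysB_bounded : bounded_op sysB;
  sysC_bounded : bounded_op sysC;
  sysD_bounded : bounded_op sysD
}.

Section Systems.
Variables (R : realType) (X U Y : hilbertType R) (Sigma : system X U Y).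

Local Notation A := (sysA Sigma).
Local Notation B := (sysB Sigma).
Local Notation C := (sysC Sigma).
Local Notation D := (sysD Sigma).

(* Im(A|B) *)
Definition reach : set X :=
  lin_span (\bigcup_n range (fun u : U => iter n A (B u))).

(* Im(A^* | C^* ) *)
Definition coreach : set X :=
  lin_span (\bigcup_n range (fun y : Y => iter n (adj A) (adj C y))).

(* Ker(C|A) *)
Definition unobs : set X := \bigcap_n [set x | C (iter n A x) = 0].

Definition minimal_system : Prop := dense reach /\ unobs = [set 0].

Definition pencil (l : R[i]) (x : X) : X := x - l *: A x.

Definition transfer_dom : set R[i] :=
  [set l | exists2 g : X -> X,
     cancel (pencil l) g /\ cancel g (pencil l) & bounded_op g].

Definition transfer (l : R[i]) (u : U) : Y :=
  D u + l *: C (app (op_inv (graph (pencil l))) (B u)).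

(* th is extended arbitrarily outside the open unit disc. Analyticity is
   complex differentiability with respect to the operator norm. *)
Definition schur_class (th : R[i] -> {linear U -> Y}) : Prop :=
  forall z : R[i], `|z| < 1 ->
    (forall u, `|th z u| <= `|u|) /\
    exists2 L : {linear U -> Y}, bounded_op L &
      forall e : R[i], 0 < e -> exists2 d : R[i], 0 < d &
        forall h : R[i], `|h| < d ->
          forall u, `|th (z + h) u - th z u - h *: L u| <= e * `|h| * `|u|.

Definition transfer_coincides_near0 (th : R[i] -> {linear U -> Y}) : Prop :=
  exists2 r : R[i], 0 < r &
    forall l, `|l| < r -> transfer_dom l /\ forall u, transfer l u = th l u.

Section RiccatiEquality.
Variable H : set (X * X).

Local Notation S := (op_sqrt H).

Definition sqrtB (u : U) : X := app S (B u).

Definition delta (u : U) : U := u - adj D (D u) - adj sqrtB (sqrtB u).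

Definition delta_sqrt : set (U * U) := op_sqrt (graph delta).

Definition cross (x : X) : U := adj D (C x) + adj sqrtB (app S (A x)).

Definition RE : Prop :=
  selfadjoint H /\
  [/\ forall x, dom H x -> x != 0 -> 0 < inner (app H x) x,
      (forall x, dom S x -> dom S (A x)) /\ (forall u, dom S (B u)),
      [/\ bounded_op delta,
          forall u, 0 <= inner (delta u) u
        & forall x, dom S x -> ran delta_sqrt (cross x)]
    & forall x, dom S x ->
        `|app S x| ^+ 2 - `|app S (A x)| ^+ 2 - `|C x| ^+ 2
          = `|app (pinv delta_sqrt) (cross x)| ^+ 2].

Definition RE_circ : Prop :=
  [/\ RE,
      dense (app S @` reach),
      dense (app (op_inv S) @` coreach)
    & is_core reach S].

End RiccatiEquality.

End Systems.

(* Main.v *)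
Require Import Defs.
From HB Require Import structures.
From mathcomp Require Import all_boot all_order all_algebra sesquilinear.
From mathcomp Require Import complex ring lra.
From mathcomp Require Import all_classical all_reals all_analysis.
Import Order.TTheory GRing.Theory Num.Theory.
Import numFieldNormedType.Exports.
Local Open Scope classical_set_scope.
Local Open Scope ring_scope.

Set Implicit Arguments.
Unset Strict Implicit.
Unset Printing Implicit Defensive.

(** The minimal element is the operator of the available storage
    [sup_u sum_k (|y_k|^2 - |u_k|^2)], the supremum over finite input sequences
    started in the state [x]. Since the transfer function is a Schur function, the
    input-output map from the state 0 is a contraction, so that the storage is
    finite on [Im(A|B)]. As a supremum of continuous functions it is lower
    semicontinuous, and it satisfies the parallelogram law; its restriction to
    the closure of [Im(A|B)] in the graph norm is therefore the form of a
    selfadjoint operator [H]. The dynamic programming principle for the storage is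
    the Riccati equality for [H], every other solution dominates the storage by
    dissipativity, and minimality of the system carries over to the norm
    [|H^{1/2} x|] because the storage of a limit of states with vanishing free
    output is at most that of the zero state.

    Contractivity of the input-output map needs Cauchy's theorem for functions that
    are merely complex differentiable. It is proved for left Riemann sums: on
    squares of the logarithmic plane these are exactly additive under bisection
    and vanish on affine functions, so Goursat's argument shows that the means over
    the [2^n]-th roots of unity on different circles have the same limit. *)

(** * Real-valued norms and inner products *)

(** No spectral theorem or unbounded functional calculus is used. Since [op_sqrt] merely chooses
    some square root, every root [S] of [H] has to be controlled: its graph form has the same
    resolvent [G = (1 + H)^-1] as the storage form, and a complete form is determined by its
    resolvent. That a root exists at all is reduced to roots of the bounded positive contractions
    [G] and [1 - G]. The storage is a supremum of real quadratic functions, so only real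
    polarization is available. Forms and functionals are therefore real-linear throughout, and
    complex identities are recovered by testing with ['i]. Cutting the storage down to the
    graph-norm closure of [Im(A|B)] makes [Im(A|B)] a core. It also gives minimality: the core
    condition on a competitor places the domain of its square root inside that closure.
    Contractivity of the input-output map requires no power series of the transfer function: it is
    enough that its values on an input polynomial with [N] coefficients agree with the output
    polynomial up to order [N] at 0. *)

Section RealNorm.
Variable R : realType.

(** Values in the totally ordered field [R] allow suprema, case analysis on the order, and [lra] or
    [nra]. *)
Definition rnorm (V : normedZmodType R[i]) (x : V) : R := complex.Re `|x|.

Lemma rnormE (V : normedZmodType R[i]) (x : V) : `|x| = (rnorm x)%:C%C.
Proof. by rewrite /rnorm RRe_real // normr_real. Qed.

Section NormedZmod.
Variable V : normedZmodType R[i].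
Implicit Types x y : V.

Lemma rnorm_ge0 x : 0 <= rnorm x.
Proof. by rewrite -lecR -rnormE normr_ge0. Qed.

Lemma rnorm_lt x (r : R) : (`|x| < r%:C%C) = (rnorm x < r).
Proof. by rewrite rnormE ltcR. Qed.

Lemma rnorm0 : rnorm (0 : V) = 0.
Proof. by rewrite /rnorm normr0. Qed.

Lemma rnorm_eq0 x : rnorm x = 0 -> x = 0.
Proof. by move=> x0; apply/normr0_eq0; rewrite rnormE x0. Qed.

Lemma rnormN x : rnorm (- x) = rnorm x.
Proof. by rewrite /rnorm normrN. Qed.

Lemma rnormB x y : rnorm (x - y) = rnorm (y - x).
Proof. by rewrite -rnormN opprB. Qed.

Lemma rnormD x y : rnorm (x + y) <= rnorm x + rnorm y.
Proof. by rewrite -lecR rmorphD /= -!rnormE ler_normD. Qed.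

Lemma rnorm_sum (I : Type) (r : seq I) (P : pred I) (F : I -> V) :
  rnorm (\sum_(i <- r | P i) F i) <= \sum_(i <- r | P i) rnorm (F i).
Proof.
elim/big_ind2: _ => [|x a y b xa yb|//]; first by rewrite rnorm0.
by apply: le_trans (rnormD _ _) _; exact: lerD.
Qed.

End NormedZmod.

Lemma rnormZ (V : normedModType R[i]) (c : R[i]) (x : V) :
  rnorm (c *: x) = rnorm c * rnorm x.
Proof. by apply: complexI; rewrite -rnormE normrZ !rnormE rmorphM. Qed.

Lemma rnormM (c d : R[i]) : rnorm (c * d) = rnorm c * rnorm d.
Proof. by apply: complexI; rewrite -rnormE normrM !rnormE rmorphM. Qed.

Lemma rnormX (c : R[i]) n : rnorm (c ^+ n) = rnorm c ^+ n.
Proof. by apply: complexI; rewrite -rnormE normrX !rnormE rmorphXn. Qed.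

Lemma rnormC (t : R) : rnorm t%:C%C = `|t|.
Proof. by rewrite /rnorm normc_def /= expr0n /= addr0 sqrtr_sqr. Qed.

Lemma rnorm1 : rnorm (1 : R[i]) = 1.
Proof. by rewrite /rnorm normr1. Qed.

Lemma rnorm_i : rnorm ('i%C : R[i]) = 1.
Proof. by rewrite /rnorm normc_def /= expr0n /= add0r expr1n sqrtr1. Qed.

Lemma rnorm_sqr (c : R[i]) : rnorm c ^+ 2 = complex.Re c ^+ 2 + complex.Im c ^+ 2.
Proof. by apply: complexI; rewrite rmorphXn /= -rnormE -add_Re2_Im2. Qed.

Lemma Re_le_rnorm (c : R[i]) : `|complex.Re c| <= rnorm c.
Proof. by rewrite -lecR -rnormE normc_ge_Re. Qed.

Lemma Re_mulr_real (c : R[i]) (t : R) :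
  complex.Re (c * t%:C%C) = complex.Re c * t.
Proof. by case: c => a b; simpc. Qed.

Lemma Re_mull_real (c : R[i]) (t : R) :
  complex.Re (t%:C%C * c) = t * complex.Re c.
Proof. by rewrite mulrC Re_mulr_real mulrC. Qed.

Lemma Re_sum (I : Type) (r : seq I) (P : pred I) (F : I -> R[i]) :
  complex.Re (\sum_(i <- r | P i) F i) = \sum_(i <- r | P i) complex.Re (F i).
Proof. by elim/big_rec2: _ => // i a b _ <-; case: (F i) b => ? ? []. Qed.

Lemma gt0_real (e : R[i]) : 0 < e -> exists2 r : R, 0 < r & e = r%:C%C.
Proof.
move=> e0; exists (complex.Re e); last by rewrite RRe_real // gtr0_real.
by rewrite -ltcR RRe_real // gtr0_real.
Qed.

Section Balls.
Variable V : normedModType R[i].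
Implicit Types (x y : V) (W : set V).

Lemma denseP W :
  dense W <-> forall x (e : R), 0 < e -> exists2 w, W w & rnorm (x - w) < e.
Proof.
split=> [dW x e e0|dW O [x Ox] oO].
  have e0' : 0 < e%:C%C :> R[i] by rewrite ltcR.
  have [y [/= bxy Wy]] : (ball x e%:C%C)° `&` W !=set0.
    apply: dW; first by exists x; apply: nbhsx_ballx.
    exact: open_interior.
  exists y => //; rewrite -rnorm_lt.
  by have := interior_subset bxy; rewrite -ball_normE.
have /nbhs_ballP[e /= /gt0_real[r r0 ->] be] := open_nbhs_nbhs (conj oO Ox).
have [w Ww xw] := dW x r r0.
by exists w; split=> //; apply: be; rewrite -ball_normE /= rnorm_lt.
Qed.

Lemma closureP W x :
  closure W x <-> forall e : R, 0 < e -> exists2 w, W w & rnorm (x - w) < e.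
Proof.
split=> [cW e e0|dW B /nbhs_ballP[e /= /gt0_real[r r0 ->] be]].
  have e0' : 0 < e%:C%C :> R[i] by rewrite ltcR.
  have [y [Wy bxy]] := cW _ (nbhsx_ballx x _ e0').
  by exists y => //; rewrite -rnorm_lt; move: bxy; rewrite -ball_normE.
have [w Ww xw] := dW r r0.
by exists w; split=> //; apply: be; rewrite -ball_normE /= rnorm_lt.
Qed.

End Balls.

Lemma rnorm_complete (V : completeNormedModType R[i]) (x : nat -> V) :
  (forall e : R, 0 < e -> exists N, forall m n, (N <= m)%N -> (N <= n)%N ->
     rnorm (x m - x n) < e) ->
  exists l, forall e : R, 0 < e -> exists N, forall n, (N <= n)%N ->
     rnorm (l - x n) < e.
Proof.
move=> cx.
have /cauchy_cvgP : cauchy (x @ \oo).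
  apply/cauchyP => e /gt0_real[r r0 ->].
  have [N NP] := cx r r0.
  exists (x N); exists N => // n /= Nn.
  by rewrite -ball_normE /= rnorm_lt NP.
move=> /cvgrPdist_lt cvx; exists (lim (x @ \oo)) => e e0.
have e0' : 0 < e%:C%C :> R[i] by rewrite ltcR.
have [N _ NP] := cvx _ e0'.
by exists N => n Nn; rewrite -rnorm_lt; apply: NP.
Qed.

Lemma bounded_opP (U V : hilbertType R) (f : U -> V) :
  bounded_op f <-> exists2 M : R, 0 <= M & forall x, rnorm (f x) <= M * rnorm x.
Proof.
split=> [[M fM]|[M M0 fM]]; last first.
  by exists M%:C%C => x; rewrite !rnormE -rmorphM lecR.
exists `|complex.Re M| => // x.
have := fM x; rewrite !rnormE lecE => /andP[_]; rewrite Re_mulr_real /=.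
by move=> /le_trans; apply; rewrite ler_wpM2r ?rnorm_ge0 ?ler_norm.
Qed.

End RealNorm.

Section RealInner.
Variables (R : realType) (H : hilbertType R).
Implicit Types x y z : H.

Definition rdot x y : R := complex.Re (inner x y).

Lemma inner_conj x y : inner x y = (inner y x)^*%C.
Proof. by rewrite hermC expr0 mul1r. Qed.

Lemma rdotC x y : rdot x y = rdot y x.
Proof. by rewrite /rdot inner_conj; case: (inner y x). Qed.

Lemma rdotDl x y z : rdot (x + y) z = rdot x z + rdot y z.
Proof. by rewrite /rdot linearDl raddfD. Qed.

Lemma rdotDr x y z : rdot x (y + z) = rdot x y + rdot x z.
Proof. by rewrite !(rdotC x) rdotDl. Qed.

Lemma rdotNl x y : rdot (- x) y = - rdot x y.
Proof. by rewrite /rdot linearNl raddfN. Qed.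

Lemma rdotNr x y : rdot x (- y) = - rdot x y.
Proof. by rewrite !(rdotC x) rdotNl. Qed.

Lemma rdotBl x y z : rdot (x - y) z = rdot x z - rdot y z.
Proof. by rewrite rdotDl rdotNl. Qed.

Lemma rdotBr x y z : rdot x (y - z) = rdot x y - rdot x z.
Proof. by rewrite rdotDr rdotNr. Qed.

Lemma rdot0l x : rdot 0 x = 0.
Proof. by rewrite /rdot linear0l. Qed.

Lemma rdot0r x : rdot x 0 = 0.
Proof. by rewrite rdotC rdot0l. Qed.

Lemma innerDl x y z : inner (x + y) z = inner x z + inner y z.
Proof. by rewrite linearDl. Qed.

Lemma innerBl x y z : inner (x - y) z = inner x z - inner y z.
Proof. by rewrite linearBl. Qed.

Lemma innerBr x y z : inner x (y - z) = inner x y - inner x z.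
Proof. by rewrite linearBr. Qed.

Lemma inner0l x : inner 0 x = 0.
Proof. by rewrite linear0l. Qed.

Lemma innerDr x y z : inner x (y + z) = inner x y + inner x z.
Proof. by rewrite linearDr. Qed.

Lemma inner0r x : inner x 0 = 0.
Proof. by rewrite linear0r. Qed.

Lemma innerZl (c : R[i]) x y : inner (c *: x) y = c * inner x y.
Proof. by rewrite linearZl_LR. Qed.

Lemma innerZr (c : R[i]) x y : inner x (c *: y) = c^*%C * inner x y.
Proof. by rewrite linearZr_LR. Qed.

Lemma rdotZl (t : R) x y : rdot (t%:C%C *: x) y = t * rdot x y.
Proof. by rewrite /rdot innerZl Re_mull_real. Qed.

Lemma rdotZr (t : R) x y : rdot x (t%:C%C *: y) = t * rdot x y.
Proof. by rewrite rdotC rdotZl rdotC. Qed.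

Lemma rdot_il x y : rdot ('i%C *: x) y = - complex.Im (inner x y).
Proof. by rewrite /rdot innerZl mulrC ReiNIm. Qed.

Lemma rdot_ilr x y : rdot ('i%C *: x) y = - rdot x ('i%C *: y).
Proof.
rewrite rdot_il rdotC rdot_il opprK inner_conj.
by case: (inner _ _) => a b /=; rewrite opprK.
Qed.

Lemma rdotxx x : rdot x x = rnorm x ^+ 2.
Proof.
by rewrite /rdot inner_norm rnormE -rmorphXn.
Qed.

Lemma rdotxx_ge0 x : 0 <= rdot x x.
Proof. by rewrite rdotxx exprn_ge0 ?rnorm_ge0. Qed.

Lemma inner_xx x : inner x x = (rnorm x ^+ 2)%:C%C.
Proof. by rewrite inner_norm rnormE -rmorphXn. Qed.

Lemma rnormD_sqr x y :
  rnorm (x + y) ^+ 2 = rnorm x ^+ 2 + 2 * rdot x y + rnorm y ^+ 2.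
Proof. by rewrite -!rdotxx rdotDl !rdotDr (rdotC y x); ring. Qed.

Lemma rnormB_sqr x y :
  rnorm (x - y) ^+ 2 = rnorm x ^+ 2 - 2 * rdot x y + rnorm y ^+ 2.
Proof. by rewrite -!rdotxx rdotBl !rdotBr (rdotC y x); ring. Qed.

Lemma parallelogram x y :
  rnorm (x + y) ^+ 2 + rnorm (x - y) ^+ 2 = 2 * rnorm x ^+ 2 + 2 * rnorm y ^+ 2.
Proof. by rewrite rnormD_sqr rnormB_sqr; ring. Qed.

Lemma rdot_le x y : rdot x y <= rnorm x * rnorm y.
Proof.
have [->|y0] := eqVneq y 0; first by rewrite rdot0r mulr_ge0 ?rnorm_ge0.
have ny : 0 < rnorm y.
  by rewrite lt_def rnorm_ge0 andbT; apply: contra_neq y0 => /rnorm_eq0.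
(* The square of this vector is [2 |x| |y| (|x| |y| - rdot x y)]. *)
have := rdotxx_ge0 ((rnorm y)%:C%C *: x - (rnorm x)%:C%C *: y).
rewrite rdotBl !rdotBr !rdotZl !rdotZr !rdotxx (rdotC y x) => h.
have [//|lt] := leP (rdot x y) (rnorm x * rnorm y).
have x0 : 0 < rnorm x.
  rewrite lt_def rnorm_ge0 andbT; apply: contraTN lt => /eqP xz.
  by rewrite (rnorm_eq0 xz) rdot0l rnorm0 mul0r ltxx.
have : 0 < rnorm x * rnorm y * (rdot x y - rnorm x * rnorm y).
  by rewrite !mulr_gt0 // subr_gt0.
nra.
Qed.

Lemma rdot_abs_le x y : `|rdot x y| <= rnorm x * rnorm y.
Proof.
rewrite ler_norml rdot_le andbT -[rdot x y]opprK -rdotNl lerN2.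
by rewrite -(rnormN x) rdot_le.
Qed.

Lemma rdot_sqr_le x y : rdot x y ^+ 2 <= rnorm x ^+ 2 * rnorm y ^+ 2.
Proof.
rewrite -exprMn -(real_normK (num_real (rdot x y))) lerXn2r ?rdot_abs_le //.
by rewrite nnegrE mulr_ge0 ?rnorm_ge0.
Qed.

Lemma rnorm_inner_le x y : rnorm (inner x y) <= rnorm x * rnorm y.
Proof.
have [->|n0] := eqVneq (rnorm (inner x y)) 0.
  by rewrite mulr_ge0 ?rnorm_ge0.
set c := inner x y in n0 *.
(* Multiplying [x] by the conjugate of [c] makes the inner product the real number [|c|^2]. *)
have := rdot_le (c^*%C *: x) y.
rewrite /rdot innerZl -/c [_ * c]mulrC -sqr_normc rnormE -rmorphXn /= rnormZ.
have -> : rnorm c^*%C = rnorm c by rewrite /rnorm normcJ.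
by rewrite -mulrA expr2 ler_pM2l // lt_def n0 rnorm_ge0.
Qed.

Lemma rdot_eqP x y : (forall z, rdot x z = rdot y z) -> x = y.
Proof.
move=> h; apply/eqP; rewrite -subr_eq0; apply/eqP/rnorm_eq0/eqP.
by rewrite -sqrf_eq0 -rdotxx rdotBl h subrr.
Qed.

Lemma rdot_suml (I : Type) (r : seq I) (P : pred I) (F : I -> H) y :
  rdot (\sum_(i <- r | P i) F i) y = \sum_(i <- r | P i) rdot (F i) y.
Proof.
by elim/big_rec2: _ => [|i a b _ <-]; rewrite ?rdot0l ?rdotDl.
Qed.

Lemma rdot_dense_eq (W : set H) x y :
  dense W -> (forall w, W w -> rdot x w = rdot y w) -> x = y.
Proof.
move=> /denseP dW h; apply/eqP; rewrite -subr_eq0; apply/eqP.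
set d := x - y; apply/rnorm_eq0/eqP; rewrite eq_le rnorm_ge0 andbT.
apply/ler_addgt0Pr => e e0; rewrite add0r.
have [w Ww dw] := dW d _ e0.
have : rdot d w = 0 by rewrite /d rdotBl h // subrr.
have := rdot_le d (d - w); rewrite rdotBr rdotxx => le -w0.
have := rnorm_ge0 d; have := rnorm_ge0 (d - w); nra.
Qed.

End RealInner.

(** The imaginary part of an inner product is, up to sign, the real part after multiplication by
    ['i]. This is the passage from real to complex identities. *)
Lemma inner_eq (R : realType) (H K : hilbertType R) (x y : H) (z w : K) :
  rdot x y = rdot z w ->
  rdot ('i%C *: x) y = rdot ('i%C *: z) w -> inner x y = inner z w.
Proof.
move=> re; rewrite !rdot_il => /oppr_inj im.
apply/eqP; rewrite eq_complex; apply/andP; split; apply/eqP; [exact: re | exact: im].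
Qed.

(** * Quadratic forms *)

Lemma discriminant_le (R : realType) (p r d : R) : 0 <= p -> 0 <= d ->
  (forall t, 0 <= p + 2 * t * r + t ^+ 2 * d) -> r ^+ 2 <= p * d.
Proof.
move=> p0 d0 q; move: d0; rewrite le_eqVlt => /predU1P[d0|dp].
  have [->|n0] := eqVneq r 0; first by rewrite expr0n /= -d0 mulr0.
  (* With [d = 0] the polynomial is affine in [t], and here it takes the value [- p - 2]. *)
  have := q (- (p + 1) / r).
  by rewrite -d0 mulr0 addr0 -mulrA divfK //; nra.
have := q (- r / d) => h.
suff : r ^+ 2 / d <= p by rewrite ler_pdivrMr.
rewrite -subr_ge0.
have -> // : p - r ^+ 2 / d = p + 2 * (- r / d) * r + (- r / d) ^+ 2 * d.
by field; rewrite gt_eqF.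
Qed.

Section Forms.
Variables (R : realType) (V : lmodType R[i]).
Implicit Types (D : set V) (x y h : V).

Record lin_subspace D : Prop := Subspace {
  subspace0 : D 0;
  subspaceD : forall x y, D x -> D y -> D (x + y);
  subspaceZ : forall (c : R[i]) x, D x -> D (c *: x) }.

Lemma subspaceN D x : lin_subspace D -> D x -> D (- x).
Proof. by move=> sD Dx; rewrite -scaleN1r; apply: subspaceZ. Qed.

Lemma subspaceB D x y : lin_subspace D -> D x -> D y -> D (x - y).
Proof. by move=> sD Dx Dy; apply: subspaceD => //; apply: subspaceN. Qed.

Lemma subspace_sum D (I : Type) (r : seq I) (P : pred I) (F : I -> V) :
  lin_subspace D -> (forall i, D (F i)) -> D (\sum_(i <- r | P i) F i).
Proof.
by move=> sD DF; apply: big_ind; [exact: subspace0|exact: subspaceD|].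
Qed.

(** Linearity over the reals, and only on [D], covers real parts of inner products as well as the
    polarization of the storage, which is meaningful only where the storage is finite. *)
Record real_form D (a : V -> V -> R) : Prop := RealForm {
  rformC : forall x y, D x -> D y -> a x y = a y x;
  rformD : forall x y z, D x -> D y -> D z -> a (x + y) z = a x z + a y z;
  rformZ : forall (t : R) x y, D x -> D y -> a (t%:C%C *: x) y = t * a x y;
  rform_ge0 : forall x, D x -> 0 <= a x x }.

Record real_functional D (f : V -> R) : Prop := RealFunctional {
  functionalD : forall x y, D x -> D y -> f (x + y) = f x + f y;
  functionalZ : forall (t : R) x, D x -> f (t%:C%C *: x) = t * f x }.

Variables (D : set V) (a : V -> V -> R).
Hypotheses (sD : lin_subspace D) (fa : real_form D a).

Lemma rformDr x y z : D x -> D y -> D z -> a x (y + z) = a x y + a x z.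
Proof.
move=> Dx Dy Dz; have Dyz := subspaceD sD Dy Dz.
by rewrite (rformC fa) // (rformD fa) // !(rformC fa _ Dx).
Qed.

Lemma rformZr t x y : D x -> D y -> a x (t%:C%C *: y) = t * a x y.
Proof.
move=> Dx Dy; have Dty := subspaceZ sD t%:C%C Dy.
by rewrite (rformC fa) // (rformZ fa) // (rformC fa Dy Dx).
Qed.

Lemma scaleRN1 x : (-1)%:C%C *: x = - x.
Proof. by rewrite rmorphN1 scaleN1r. Qed.

Lemma rformBl x y z : D x -> D y -> D z -> a (x - y) z = a x z - a y z.
Proof.
move=> Dx Dy Dz; rewrite (rformD fa) //; last exact: subspaceN.
by rewrite -(scaleRN1 y) (rformZ fa) // mulN1r.
Qed.

Lemma rformBr x y z : D x -> D y -> D z -> a x (y - z) = a x y - a x z.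
Proof.
move=> Dx Dy Dz; rewrite rformDr //; last exact: subspaceN.
by rewrite -(scaleRN1 z) rformZr // mulN1r.
Qed.

Lemma form_sqrD x y : D x -> D y ->
  a (x + y) (x + y) = a x x + 2 * a x y + a y y.
Proof.
move=> Dx Dy; have Dxy := subspaceD sD Dx Dy.
by rewrite (rformD fa) // !rformDr // (rformC fa Dy Dx); ring.
Qed.

Lemma formB_le x y : D x -> D y ->
  a (x - y) (x - y) <= 2 * a x x + 2 * a y y.
Proof.
move=> Dx Dy; have := rform_ge0 fa (subspaceD sD Dx Dy).
rewrite form_sqrD // rformBl ?rformBr //; last exact: subspaceB.
rewrite (rformC fa Dy Dx).
lra.
Qed.

Lemma form_cauchy_schwarz x y : D x -> D y -> a x y ^+ 2 <= a x x * a y y.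
Proof.
move=> Dx Dy; apply: discriminant_le => [||t]; try exact: rform_ge0 fa _ _.
have Dty := subspaceZ sD t%:C%C Dy.
have := rform_ge0 fa (subspaceD sD Dx Dty); rewrite form_sqrD //.
by rewrite (rformZ fa) // !rformZr // mulrA; nra.
Qed.

(* [x] is an approximate minimizer of [a x x - 2 f x]; no completeness is needed. *)
Lemma approx_riesz (f : V -> R) (k : R) : real_functional D f ->
  (forall h, D h -> f h ^+ 2 <= k * a h h) ->
  forall e, 0 < e ->
  exists2 x, D x & forall h, D h -> (a x h - f h) ^+ 2 <= e * a h h.
Proof.
move=> [fD fZ] fk e e0; pose F x := a x x - 2 * f x.
have Flb x : D x -> - `|k| <= F x.
  move=> Dx; have a0 := rform_ge0 fa Dx; have := fk x Dx; rewrite /F.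
  have : k * a x x <= `|k| * a x x by rewrite ler_wpM2r ?ler_norm.
  have : 0 <= `|k| by [].
  move: (a x x) (f x) `|k| a0 => A f' K A0 K0 kK fK.
  have [//|lt] := leP (- K) (A - 2 * f').
  have : 0 < (2 * f' - (A + K)) * (2 * f' + (A + K)) by apply: mulr_gt0; lra.
  have := sqr_ge0 (A - K); lra.
have hasinf : has_inf (F @` D).
  split; first by exists (F 0), 0 => //; exact: subspace0.
  by exists (- `|k|) => _ [x Dx <-]; exact: Flb.
have [_ [x Dx <-] Fx] := inf_adherent e0 hasinf.
exists x => // h Dh; set E := a x h - f h.
(* Moving from [x] to [x + t h] cannot lower the functional by [e]. The best choice of [t] then
   bounds [E ^+ 2]. *)
have step (t : R) : - e < 2 * t * E + t ^+ 2 * a h h.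
  have Dth := subspaceZ sD t%:C%C Dh; have Dxth := subspaceD sD Dx Dth.
  have : inf (F @` D) <= F (x + t%:C%C *: h).
    by apply: ge_inf; [case: hasinf|exists (x + t%:C%C *: h)].
  rewrite /F form_sqrD // (rformZ fa) // !rformZr // fD // fZ //.
  move: Fx; rewrite /F /E; nra.
have := rform_ge0 fa Dh; rewrite le_eqVlt => /predU1P[h0|hp].
  have [->|n0] := eqVneq E 0; first by rewrite expr0n /= -h0 mulr0.
  have := step (- e / (2 * E)).
  have -> : 2 * (- e / (2 * E)) * E = - e by field.
  by rewrite -h0 mulr0 addr0 ltxx.
have := step (- E / a h h).
have -> : 2 * (- E / a h h) * E + (- E / a h h) ^+ 2 * a h h =
   - (E ^+ 2 / a h h) by field; rewrite gt_eqF.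
by rewrite ltrN2 => /ltW; rewrite ler_pdivrMr.
Qed.

(** Both estimates are tested on the difference [x - x'] itself. Hence approximate representers with
    errors tending to 0 form a Cauchy sequence for [a]. *)
Lemma approx_riesz_close (f : V -> R) (e e' : R) x x' : 0 <= e -> 0 <= e' -> D x -> D x' ->
  (forall h, D h -> (a x h - f h) ^+ 2 <= e * a h h) ->
  (forall h, D h -> (a x' h - f h) ^+ 2 <= e' * a h h) ->
  a (x - x') (x - x') <= 2 * (e + e').
Proof.
move=> e0 e'0 Dx Dx' hx hx'; set d := x - x'; have Dd : D d := subspaceB sD Dx Dx'.
have := hx d Dd; have := hx' d Dd; have := rform_ge0 fa Dd.
have : a d d = a x d - a x' d by rewrite {1}/d rformBl.
move: (a d d) (a x d) (a x' d) (f d) => A p q r Apq.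
rewrite le_eqVlt => /predU1P[A0|A0] hq hp.
  by rewrite -A0 mulr_ge0 // addr_ge0.
have : A * A <= (2 * (e + e')) * A; last by rewrite ler_pM2r.
have : (p - q) ^+ 2 <= 2 * (p - r) ^+ 2 + 2 * (q - r) ^+ 2.
  by have := sqr_ge0 (p + q - 2 * r); lra.
have : A * A = (p - q) ^+ 2 by rewrite Apq expr2.
by lra.
Qed.

Definition form_cauchy (x : nat -> V) := forall e : R, 0 < e ->
  exists N, forall m n, (N <= m)%N -> (N <= n)%N ->
    a (x m - x n) (x m - x n) < e.

Lemma invn_small (e : R) : 0 < e ->
  exists N, forall n, (N <= n)%N -> n.+1%:R^-1 < e.
Proof.
move=> e0; exists (Num.bound e^-1) => n Nn.
rewrite -[e]invrK ltf_pV2 ?posrE ?invr_gt0 ?ltr0n //.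
apply: lt_trans (archi_boundP _) _; first by rewrite invr_ge0 ltW.
by rewrite ltr_nat ltnS.
Qed.

Lemma approx_riesz_seq (f : V -> R) (k : R) : real_functional D f ->
  (forall h, D h -> f h ^+ 2 <= k * a h h) ->
  exists x : nat -> V, [/\ forall n, D (x n), form_cauchy x &
   forall n h, D h -> (a (x n) h - f h) ^+ 2 <= n.+1%:R^-1 * a h h].
Proof.
move=> fl fk.
have ex (n : nat) : exists x, D x /\
    forall h, D h -> (a x h - f h) ^+ 2 <= n.+1%:R^-1 * a h h.
  have n0 : 0 < n.+1%:R^-1 :> R by rewrite invr_gt0 ltr0n.
  by have [x Dx xP] := approx_riesz fl fk n0; exists x.
have [x xP] := choice ex; exists x; split => [n|e e0|n h Dh].
- by case: (xP n).
- have [N NP] := @invn_small (e / 4) (divr_gt0 e0 (ltr0Sn _ 3)).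
  exists N => m n /NP me /NP ne; have [Dm mP] := xP m; have [Dn nP] := xP n.
  have i0 k0 : 0 <= k0.+1%:R^-1 :> R by rewrite invr_ge0 ler0n.
  have := approx_riesz_close (i0 m) (i0 n) Dm Dn mP nP.
  move: (m.+1%:R^-1) (n.+1%:R^-1) (a _ _) me ne => p q r; lra.
- by case: (xP n) => _; apply.
Qed.
End Forms.

(** * Limits of sequences and the Riesz representation theorem *)

Section Convergence.
Variable R : realType.

Lemma cvg0_le (u v : nat -> R) :
  (forall n, 0 <= u n <= v n) -> v n @[n --> \oo] --> (0 : R) ->
  u n @[n --> \oo] --> (0 : R).
Proof.
move=> uv v0; apply: (squeeze_cvgr _ (cvg_cst 0) v0).
by near=> n; exact: uv.
Unshelve. all: by end_near. Qed.

Lemma cvg0P (u : nat -> R) : (forall n, 0 <= u n) ->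
  u n @[n --> \oo] --> (0 : R) <->
  forall e, 0 < e -> exists N, forall n, (N <= n)%N -> u n < e.
Proof.
move=> u0; split=> [/cvgrPdist_lt cu e e0|cu].
  have [N _ NP] := cu e e0; exists N => n Nn.
  by have := NP n Nn; rewrite sub0r normrN ger0_norm.
apply/cvgrPdist_lt => e e0; have [N NP] := cu e e0.
by exists N => // n /= Nn; rewrite sub0r normrN ger0_norm // NP.
Qed.

Lemma cvg0_sqr (u : nat -> R) : u n ^+ 2 @[n --> \oo] --> (0 : R) ->
  (forall n, 0 <= u n) -> u n @[n --> \oo] --> (0 : R).
Proof.
move=> cu u0; apply/(cvg0P u0) => e e0.
have [|N NP] := (cvg0P _).1 cu _ (exprn_gt0 2 e0).
  by move=> n; rewrite exprn_ge0.
by exists N => n /NP; rewrite ltr_pXn2r // nnegrE ?u0 ?ltW.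
Qed.

Lemma cvg_eq_cst (u : nat -> R) (c l : R) : (forall n, u n = c) ->
  u n @[n --> \oo] --> l -> l = c.
Proof.
move=> uc ul; apply: (cvg_unique (@norm_hausdorff _ _) ul).
have -> : u = (fun=> c) by apply/funext.
exact: cvg_cst.
Qed.

Section Normed.
Variable V : normedModType R[i].
Implicit Types (x y : nat -> V) (l k : V).

Definition rcvg x l := rnorm (x n - l) @[n --> \oo] --> (0 : R).

Lemma rcvg_cst l : rcvg (fun=> l) l.
Proof. by rewrite /rcvg subrr rnorm0; exact: cvg_cst. Qed.

Lemma rcvgP x l : rcvg x l <->
  forall e, 0 < e -> exists N, forall n, (N <= n)%N -> rnorm (x n - l) < e.
Proof. by apply: cvg0P => n; exact: rnorm_ge0. Qed.

Lemma rcvgD x y l k : rcvg x l -> rcvg y k -> rcvg (fun n => x n + y n) (l + k).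
Proof.
move=> xl yk; apply: cvg0_le (_ : rnorm (x n - l) + rnorm (y n - k) @[n --> \oo] --> (0 : R)).
  by move=> n; rewrite rnorm_ge0 opprD addrACA rnormD.
by rewrite -(addr0 0); exact: cvgD.
Qed.

Lemma rcvgZ (c : R[i]) x l : rcvg x l -> rcvg (fun n => c *: x n) (c *: l).
Proof.
move=> xl; rewrite /rcvg; under eq_fun do rewrite -scalerBr rnormZ.
by rewrite -(mulr0 (rnorm c)); exact: cvgMr.
Qed.

Lemma rcvgN x l : rcvg x l -> rcvg (fun n => - x n) (- l).
Proof.
by move=> /(rcvgZ (-1)); rewrite scaleN1r; under eq_fun do rewrite scaleN1r.
Qed.

Lemma rcvgB x y l k : rcvg x l -> rcvg y k -> rcvg (fun n => x n - y n) (l - k).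
Proof. by move=> xl yk; apply: rcvgD => //; exact: rcvgN. Qed.

Lemma rcvg_unique x l k : rcvg x l -> rcvg x k -> l = k.
Proof.
move=> xl xk; have := rcvgB xl xk; rewrite /rcvg.
under eq_fun do rewrite subrr sub0r rnormN.
move=> /(cvg_eq_cst (fun=> erefl)) => h.
by apply/eqP; rewrite -subr_eq0; apply/eqP/rnorm_eq0.
Qed.

Lemma rcvg_rnorm x l : rcvg x l -> rnorm (x n) @[n --> \oo] --> rnorm l.
Proof.
move=> xl; apply/cvgrPdist_lt => e e0.
have [N NP] := (rcvgP _ _).1 xl e e0; exists N => // n /= Nn.
apply: le_lt_trans (NP n Nn); rewrite ler_norml; apply/andP; split.
- by have := rnormD (x n - l) l; rewrite subrK; lra.
- by have := rnormD (l - x n) (x n); rewrite subrK rnormB; lra.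
Qed.

Lemma rcvg_closure (W : set V) l : closure W l <->
  exists2 x, (forall n, W (x n)) & rcvg x l.
Proof.
split=> [/closureP cl|[x Wx /rcvgP xl]].
  have ex (n : nat) : exists u, W u /\ rnorm (l - u) < harmonic n.
    by have [x Wx lx] := cl _ (harmonic_gt0 n); exists x.
  have [x xP] := choice ex; exists x => [n|]; first by case: (xP n).
  apply: cvg0_le (@cvg_harmonic R) => n.
  by rewrite rnorm_ge0 rnormB ltW //; case: (xP n).
apply/closureP => e e0; have [N NP] := xl e e0.
by exists (x N) => //; rewrite rnormB NP.
Qed.

End Normed.

Lemma rcauchy_rcvg (V : completeNormedModType R[i]) (x : nat -> V) :
  (forall e : R, 0 < e -> exists N, forall m n, (N <= m)%N -> (N <= n)%N ->
     rnorm (x m - x n) < e) ->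
  exists l, rcvg x l.
Proof.
move=> /rnorm_complete[l xl]; exists l; apply/rcvgP => e /xl[N NP].
by exists N => n /NP; rewrite rnormB.
Qed.

Lemma rcvg_bounded (V W : normedModType R[i]) (f : V -> W) (M : R) (x : nat -> V) l :
  (forall u v, f (u - v) = f u - f v) ->
  (forall u, rnorm (f u) <= M * rnorm u) -> rcvg x l -> rcvg (f \o x) (f l).
Proof.
move=> fB fM xl; apply: cvg0_le (_ : M * rnorm (x n - l) @[n --> \oo] --> (0 : R)).
  by move=> n; rewrite rnorm_ge0 /= -fB fM.
by rewrite -(mulr0 M); exact: cvgMr.
Qed.

Section Hilbert.
Variable H : hilbertType R.
Implicit Types (x y : nat -> H) (l k : H).

Lemma rcvg_rdotl x l k : rcvg x l -> rdot (x n) k @[n --> \oo] --> rdot l k.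
Proof.
move=> xl; apply/cvgrPdist_lt => e e0.
have k0 : 0 < rnorm k + 1 by rewrite ltr_wpDl ?rnorm_ge0.
have [N NP] := (rcvgP _ _).1 xl _ (divr_gt0 e0 k0); exists N => // n /= Nn.
rewrite -rdotBl; apply: le_lt_trans (rdot_abs_le _ _) _.
have := NP n Nn; rewrite rnormB ltr_pdivlMr // => lt.
by apply: le_lt_trans lt; rewrite ler_wpM2l ?rnorm_ge0 // lerDl.
Qed.

Lemma rcvg_rdot x y l k : rcvg x l -> rcvg y k ->
  rdot (x n) (y n) @[n --> \oo] --> rdot l k.
Proof.
move=> xl yk; have e n : rdot (x n) (y n) =
    2^-1 * (rnorm (x n + y n) ^+ 2 - rnorm (x n) ^+ 2 - rnorm (y n) ^+ 2).
  by rewrite rnormD_sqr; field.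
under eq_fun do rewrite e.
have -> : rdot l k =
    2^-1 * (rnorm (l + k) ^+ 2 - rnorm l ^+ 2 - rnorm k ^+ 2).
  by rewrite rnormD_sqr; field.
have sq z c : rcvg z c -> rnorm (z n) ^+ 2 @[n --> \oo] --> rnorm c ^+ 2.
  by move=> /rcvg_rnorm zc; rewrite expr2; under eq_fun do rewrite expr2; exact: cvgM.
by apply: cvgMr; apply: cvgB; [apply: cvgB|]; apply: sq => //; exact: rcvgD.
Qed.

Lemma rdot_form (D : set H) : real_form D (@rdot R H).
Proof.
split=> *; [exact: rdotC|exact: rdotDl|exact: rdotZl|exact: rdotxx_ge0].
Qed.

(** Passage to the limit in the estimate of [approx_riesz_seq], whose error [n.+1%:R^-1] is
    [harmonic n]. *)
Lemma cvg_harmonic_sqr (u : nat -> R) (c k l : R) :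
  (forall n, (u n - c) ^+ 2 <= harmonic n * k) ->
  u n @[n --> \oo] --> l -> l = c.
Proof.
move=> uc ul; have h : (u n - c) ^+ 2 @[n --> \oo] --> (0 : R).
  apply: cvg0_le (_ : harmonic n * k @[n --> \oo] --> (0 : R)).
    by move=> n; rewrite sqr_ge0 uc.
  by rewrite -(mul0r k); apply: cvgMl; exact: cvg_harmonic.
have h' : (u n - c) ^+ 2 @[n --> \oo] --> (l - c) ^+ 2.
  rewrite expr2; under eq_fun do rewrite expr2.
  by apply: cvgM; apply: cvgB => //; exact: cvg_cst.
have e0 := cvg_unique (@norm_hausdorff _ _) h' h.
by apply/eqP; rewrite -subr_eq0 -sqrf_eq0 e0.
Qed.

(** Approximate representers exist in [D] without any completeness. They are Cauchy in norm, so only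
    their limit has to be sought in the closure of [D]. *)
Lemma riesz_closure (D : set H) (f : H -> R) (k : R) : lin_subspace D ->
  real_functional D f -> (forall h, D h -> f h ^+ 2 <= k * rnorm h ^+ 2) ->
  exists2 z, closure D z & forall h, D h -> rdot z h = f h.
Proof.
move=> sD fl fk; have fk' h : D h -> f h ^+ 2 <= k * rdot h h.
  by rewrite rdotxx; exact: fk.
have [x [Dx cx xP]] := approx_riesz_seq sD (rdot_form D) fl fk'.
have [z xz] : exists z, rcvg x z.
  apply: rcauchy_rcvg => e e0; have [N NP] := cx _ (exprn_gt0 2 e0).
  exists N => m n mN nN; have := NP m n mN nN; rewrite rdotxx.
  by rewrite ltr_pXn2r // nnegrE ?rnorm_ge0 ?ltW.
exists z; first by apply/rcvg_closure; exists x.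
move=> h Dh; apply: (cvg_harmonic_sqr (fun n => xP n h Dh)).
exact: rcvg_rdotl.
Qed.

Lemma subspaceT : lin_subspace [set: H].
Proof. by split. Qed.

Lemma riesz (f : H -> R) (k : R) : real_functional setT f ->
  (forall h, f h ^+ 2 <= k * rnorm h ^+ 2) -> exists z, forall h, rdot z h = f h.
Proof.
move=> fl fk; have [|z _ zP] := riesz_closure subspaceT fl (k := k) => [h _ //|].
by exists z => h; exact: zP.
Qed.

Lemma projection (D : set H) (x : H) : lin_subspace D ->
  exists2 z, closure D z & forall h, D h -> rdot z h = rdot x h.
Proof.
move=> sD; apply: (@riesz_closure D (rdot x) (rnorm x ^+ 2)) => //.
  by split=> *; [exact: rdotDr|exact: rdotZr].
by move=> h _; exact: rdot_sqr_le.
Qed.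

Lemma dense_orth (D : set H) : lin_subspace D ->
  (forall x : H, (forall h, D h -> rdot x h = 0) -> x = 0) -> dense D.
Proof.
move=> sD oD; apply/denseP => x e e0.
have [z /closureP cz zP] := projection x sD.
have <- : z = x; last exact: cz.
apply/eqP; rewrite -subr_eq0; apply/eqP/oD => h Dh.
by rewrite rdotBl zP // subrr.
Qed.

End Hilbert.
End Convergence.

(** * Adjoints and selfadjoint operators *)

Lemma cvg_sqr (R : realType) (u : nat -> R) (l : R) :
  u n @[n --> \oo] --> l -> u n ^+ 2 @[n --> \oo] --> l ^+ 2.
Proof. by move=> ul; rewrite expr2; exact: cvgM. Qed.

Section BoundedAdjoint.
Variables (R : realType) (U V : hilbertType R) (f : U -> V).
Hypotheses (fl : linear f) (fb : bounded_op f).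

Lemma lin0 : f 0 = 0.
Proof. by have := fl (-1) 0 0; rewrite scaler0 addr0 scaleN1r addNr. Qed.

Lemma linD x y : f (x + y) = f x + f y.
Proof. by rewrite -[x]scale1r fl !scale1r. Qed.

Lemma linZ c x : f (c *: x) = c *: f x.
Proof. by rewrite -[c *: x]addr0 fl lin0 addr0. Qed.

Lemma linB x y : f (x - y) = f x - f y.
Proof. by rewrite linD -scaleN1r linZ scaleN1r. Qed.

Lemma rcvg_lin x l : rcvg x l -> rcvg (f \o x) (f l).
Proof.
have [M M0 fM] := (bounded_opP f).1 fb.
by apply: (rcvg_bounded (M := M)) => //; exact: linB.
Qed.

Lemma ex_adjoint y : exists z, forall x, inner (f x) y = inner x z.
Proof.
have [M M0 fM] := (bounded_opP f).1 fb.
have fr : real_functional setT (fun x => rdot (f x) y).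
  by split=> *; rewrite ?linD ?linZ ?rdotDl ?rdotZl.
have [|z zP] := riesz fr (k := (M * rnorm y) ^+ 2).
  move=> x; apply: le_trans (rdot_sqr_le _ _) _.
  rewrite exprMn [X in _ <= X]mulrAC ler_wpM2r ?sqr_ge0 // -exprMn.
  by rewrite lerXn2r ?nnegrE ?mulr_ge0 ?rnorm_ge0.
exists z => x; apply: inner_eq; first by rewrite [RHS]rdotC zP.
by rewrite -linZ [RHS]rdotC zP.
Qed.

Lemma adj_inner x y : inner (f x) y = inner x (adj f y).
Proof.
rewrite /adj /app; case: xgetP => [z _|nz].
  by move=> /(_ x (f x)); exact.
by have [z zP] := ex_adjoint y; case: (nz z) => u v; rewrite /graph /= => ->.
Qed.

Lemma adj_rdot x y : rdot (f x) y = rdot x (adj f y).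
Proof. by rewrite /rdot adj_inner. Qed.

End BoundedAdjoint.

Section SelfAdjoint.
Variables (R : realType) (H : hilbertType R) (T : set (H * H)).
Hypothesis saT : selfadjoint T.

Lemma sa_sym x y u v : T (x, y) -> T (u, v) -> inner y u = inner x v.
Proof. by move=> Txy; rewrite -{1}saT.2; apply. Qed.

Lemma sa_rdot x y u v : T (x, y) -> T (u, v) -> rdot y u = rdot x v.
Proof. by move=> Txy Tuv; rewrite /rdot (sa_sym Txy Tuv). Qed.

Lemma sa_mem_inner u v : (forall x y, T (x, y) -> inner y u = inner x v) -> T (u, v).
Proof. by move=> h; rewrite -saT.2. Qed.

Lemma saD x y u v : T (x, y) -> T (u, v) -> T (x + u, y + v).
Proof.
move=> Txy Tuv; apply: sa_mem_inner => a b Tab.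
by rewrite !innerDr (sa_sym Tab Txy) (sa_sym Tab Tuv).
Qed.

Lemma saZ c x y : T (x, y) -> T (c *: x, c *: y).
Proof.
move=> Txy; apply: sa_mem_inner => a b Tab.
by rewrite !innerZr (sa_sym Tab Txy).
Qed.

Lemma sa0 : T (0, 0).
Proof. by apply: sa_mem_inner => a b _; rewrite !inner0r. Qed.

Lemma saN x y : T (x, y) -> T (- x, - y).
Proof. by rewrite -(scaleN1r x) -(scaleN1r y); exact: saZ. Qed.

Lemma saB x y u v : T (x, y) -> T (u, v) -> T (x - u, y - v).
Proof. by move=> Txy /saN; exact: saD. Qed.

(** Real parts suffice because the graph of [T] is stable under multiplication by ['i]. *)
Lemma sa_mem u v : (forall x y, T (x, y) -> rdot y u = rdot x v) -> T (u, v).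
Proof.
move=> h; apply: sa_mem_inner => x y Txy; apply: inner_eq; first exact: h.
by apply: h; exact: saZ.
Qed.

Lemma sa_fun x y z : T (x, y) -> T (x, z) -> y = z.
Proof.
move=> Txy Txz; apply: (rdot_dense_eq saT.1) => w [v Twv].
by rewrite (sa_rdot Txy Twv) (sa_rdot Txz Twv).
Qed.

Lemma sa_app x : dom T x -> T (x, app T x).
Proof. by move=> [y Txy]; rewrite /app; case: xgetP => // /(_ y). Qed.

Lemma sa_appE x y : T (x, y) -> app T x = y.
Proof. by move=> Txy; apply: (sa_fun _ Txy); apply: sa_app; exists y. Qed.

Lemma dom_subspace : lin_subspace (dom T).
Proof.
split=> [|x y [u Txu] [v Tyv]|c x [u Txu]].
- by exists 0; exact: sa0.
- by exists (u + v); exact: saD.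
- by exists (c *: u); exact: saZ.
Qed.

Lemma appD x y : dom T x -> dom T y -> app T (x + y) = app T x + app T y.
Proof. by move=> /sa_app Tx /sa_app Ty; apply/sa_appE/saD. Qed.

Lemma appB x y : dom T x -> dom T y -> app T (x - y) = app T x - app T y.
Proof. by move=> /sa_app Tx /sa_app Ty; apply/sa_appE/saB. Qed.

Lemma appZ c x : dom T x -> app T (c *: x) = c *: app T x.
Proof. by move=> /sa_app Tx; apply/sa_appE/saZ. Qed.

Lemma app_rdot x y : dom T x -> dom T y -> rdot (app T x) y = rdot x (app T y).
Proof. by move=> /sa_app Tx /sa_app Ty; exact: sa_rdot Tx Ty. Qed.

Lemma app_form : real_form (dom T) (fun x y => rdot (app T x) (app T y)).
Proof.
split=> [x y _ _|x y z Dx Dy Dz|t x y Dx Dy|x Dx].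
- exact: rdotC.
- by rewrite appD // rdotDl.
- by rewrite appZ // rdotZl.
- exact: rdotxx_ge0.
Qed.

Lemma sa_closed x y l k : (forall n, T (x n, y n)) -> rcvg x l -> rcvg y k -> T (l, k).
Proof.
move=> Txy xl yk; apply: sa_mem => u v Tuv.
have h1 : rdot (x n) v @[n --> \oo] --> rdot v l.
  by rewrite rdotC; exact: rcvg_rdotl.
apply: (cvg_unique (@norm_hausdorff _ _) h1).
have -> : (fun n => rdot (x n) v) = (fun n => rdot (y n) u).
  by apply/funext => n; rewrite -(sa_rdot (Txy n) Tuv).
by rewrite (rdotC u); exact: rcvg_rdotl.
Qed.

(* Douglas' factorization lemma for an unbounded [T] *)
Lemma sa_range (c : H) (k : R) : 0 <= k ->
  (forall x, dom T x -> rdot x c ^+ 2 <= k * rnorm (app T x) ^+ 2) ->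
  exists z, [/\ T (z, c), closure (ran T) z & rnorm z ^+ 2 <= k].
Proof.
(* In this form [rdot c] is a bounded functional. If [x n] represents it approximately, then
   [app T (x n)] converges to the required preimage [z] of [c]. *)
move=> k0 ck; pose a x y := rdot (app T x) (app T y).
have fl : real_functional (dom T) (rdot c).
  by split=> *; [exact: rdotDr|exact: rdotZr].
have fk h : dom T h -> rdot c h ^+ 2 <= k * a h h.
  by rewrite rdotC /a rdotxx; exact: ck.
have [x [Dx cx xP]] := approx_riesz_seq dom_subspace app_form fl fk.
have [z xz] : exists z, rcvg (fun n => app T (x n)) z.
  apply: rcauchy_rcvg => e e0; have [N NP] := cx _ (exprn_gt0 2 e0).
  exists N => m n mN nN; have := NP m n mN nN; rewrite appB // rdotxx.
  by rewrite ltr_pXn2r // nnegrE ?rnorm_ge0 ?ltW.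
have zP h : dom T h -> rdot z (app T h) = rdot c h.
  move=> Dh; apply: (cvg_harmonic_sqr (fun n => xP n h Dh)).
  exact: rcvg_rdotl.
have cz : closure (ran T) z.
  apply/rcvg_closure; exists (fun n => app T (x n)) => // n.
  by exists (x n); exact: sa_app.
exists z; split=> //.
  apply: sa_mem => u v Tuv; rewrite rdotC -(sa_appE Tuv) zP 1?rdotC //.
  by exists v.
have le n : rdot z (app T (x n)) ^+ 2 <= k * rnorm (app T (x n)) ^+ 2.
  by rewrite zP // -rdotxx; exact: fk.
have [z0|n0] := eqVneq (rnorm z) 0.
  by rewrite z0 expr0n.
have l1 : rdot z (app T (x n)) ^+ 2 @[n --> \oo] --> (rnorm z ^+ 2) ^+ 2.
  rewrite -rdotxx; apply: (cvg_sqr); exact: rcvg_rdot (rcvg_cst _) xz.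
have l2 : k * rnorm (app T (x n)) ^+ 2 @[n --> \oo] --> k * rnorm z ^+ 2.
  by apply: cvgMr; apply: cvg_sqr; exact: rcvg_rnorm.
have le2 : (rnorm z ^+ 2) ^+ 2 <= k * rnorm z ^+ 2.
  by apply: ler_cvg_to l1 l2 _; near=> n; exact: le.
move: le2; rewrite [X in X <= _]expr2 ler_pM2r // exprn_gt0 //.
by rewrite lt_def n0 rnorm_ge0.
Unshelve. all: by end_near. Qed.

End SelfAdjoint.

(** * Square roots of positive contractions *)

Section SquareRoot.
Variables (R : realType) (H : hilbertType R).
Implicit Types T L : H -> H.

Definition op_symmetric T := forall x y, inner (T x) y = inner x (T y).

Lemma symm_rdot T x y : op_symmetric T -> rdot (T x) y = rdot x (T y).
Proof. by move=> sT; rewrite /rdot sT. Qed.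

Lemma symm_linear T : op_symmetric T -> linear T.
Proof.
move=> sT c x y; apply: rdot_eqP => z.
by rewrite /rdot sT !innerDl !innerZl !sT.
Qed.

Lemma symm_opB T : op_symmetric T -> op_symmetric (fun x => x - T x).
Proof. by move=> sT x y; rewrite innerBl innerBr sT. Qed.

Definition positive_contraction T :=
  op_symmetric T /\ forall x, 0 <= rdot (T x) x <= rnorm x ^+ 2.

Lemma positive_contraction_opB T :
  positive_contraction T -> positive_contraction (fun x => x - T x).
Proof.
move=> [sT pT]; split=> [|x]; first exact: symm_opB.
by have := pT x; rewrite rdotBl rdotxx; lra.
Qed.

(** Cauchy-Schwarz for the form [<T u, v>] at [x] and [T x] bounds [|T x|^4] by
    [<T x, x> <T (T x), T x>], hence by [|x|^2 |T x|^2]. *)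
Lemma positive_contraction_le T x :
  positive_contraction T -> rnorm (T x) <= rnorm x.
Proof.
move=> [sT pT]; have lT := symm_linear sT.
have fa : real_form setT (fun u v => rdot (T u) v).
  split=> [u v _ _|u v w _ _ _|t u v _ _|u _].
  - by rewrite symm_rdot // rdotC.
  - by rewrite (linD lT) rdotDl.
  - by rewrite (linZ lT) rdotZl.
  - by case/andP: (pT u).
have := form_cauchy_schwarz (subspaceT H) fa (x := x) (y := T x) I I.
rewrite rdotxx; have /andP[a0 a1] := pT x; have /andP[b0 b1] := pT (T x).
move=> le4; have {}le4 : rnorm (T x) ^+ 2 * rnorm (T x) ^+ 2 <=
    rnorm x ^+ 2 * rnorm (T x) ^+ 2.
  by rewrite -expr2; apply: le_trans le4 _; apply: ler_pM.
have [->|n0] := eqVneq (rnorm (T x)) 0; first exact: rnorm_ge0.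
move: le4; rewrite ler_pM2r ?exprn_gt0 ?lt_def ?n0 ?rnorm_ge0 //.
by rewrite ler_pXn2r // nnegrE rnorm_ge0.
Qed.

Lemma inner_limit (x y : nat -> H) (l m h k : H) :
  (forall n, inner (x n) k = inner h (y n)) -> rcvg x l -> rcvg y m ->
  inner l k = inner h m.
Proof.
move=> xy xl ym; apply: inner_eq.
  have h1 : rdot (x n) k @[n --> \oo] --> rdot l k by exact: rcvg_rdotl.
  apply: (cvg_unique (@norm_hausdorff _ _) h1).
  have -> : (fun n => rdot (x n) k) = (fun n => rdot (y n) h).
    by apply/funext => n; rewrite /rdot xy -/(rdot _ _) rdotC.
  by rewrite (rdotC h); exact: rcvg_rdotl.
have h1 : rdot ('i%C *: x n) k @[n --> \oo] --> rdot ('i%C *: l) k.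
  by apply: rcvg_rdotl; exact: rcvgZ.
apply: (cvg_unique (@norm_hausdorff _ _) h1).
have -> : (fun n => rdot ('i%C *: x n) k) = (fun n => rdot (y n) ('i%C *: h)).
  by apply/funext => n; rewrite [RHS]rdotC /rdot !innerZl xy.
by rewrite (rdotC _ m); exact: rcvg_rdotl.
Qed.

(* Fixed-point iteration for [Y = (K + Y^2) / 2], whose solution gives
   [(1 - Y)^2 = 1 - K]; it is dominated by the scalar iteration for [K = 1]. *)
Fixpoint sqrt_iter (K : H -> H) (n : nat) (x : H) : H :=
  if n is m.+1 then (2^-1)%:C%C *: (K x + sqrt_iter K m (sqrt_iter K m x)) else 0.

Fixpoint sqrt_bound (n : nat) : R :=
  if n is m.+1 then 2^-1 * (1 + sqrt_bound m ^+ 2) else 0.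

Lemma sqrt_bound_itv n : 0 <= sqrt_bound n <= 1.
Proof. by elim: n => [|n IH] /=; [rewrite lexx ler01|nra]. Qed.

Lemma sqrt_bound_le n : sqrt_bound n <= sqrt_bound n.+1.
Proof. by have := sqrt_bound_itv n => /=; nra. Qed.

Lemma sqrt_bound_nd : nondecreasing_seq sqrt_bound.
Proof. by apply/nondecreasing_seqP => n; exact: sqrt_bound_le. Qed.

Lemma sqrt_bound_cauchy e : 0 < e -> exists N, forall m n,
  (N <= n <= m)%N -> sqrt_bound m - sqrt_bound n < e.
Proof.
move=> e0; have ub : has_ubound (range sqrt_bound).
  by exists 1 => _ [n _ <-]; case/andP: (sqrt_bound_itv n).
have ne : has_sup (range sqrt_bound) by split => //; exists (sqrt_bound 0), 0%N.
have [_ [N _ <-] NP] := sup_adherent e0 ne.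
exists N => m n /andP[Nn nm].
have : sqrt_bound m <= sup (range sqrt_bound) by apply: ub_le_sup => //; exists m.
by have := sqrt_bound_nd Nn; lra.
Qed.

Section Iteration.
Variable K : H -> H.
Hypothesis pK : positive_contraction K.
Let Y := sqrt_iter K.

Lemma symm_sqrt_iter n : op_symmetric (Y n).
Proof.
elim: n => [|n IH] x y /=; first by rewrite inner0l inner0r.
by rewrite innerZl innerZr innerDl innerDr pK.1 !IH conjc_real.
Qed.

Lemma sqrt_iter_ge0 n x : 0 <= rdot (Y n x) x.
Proof.
case: n => [|n] /=; first by rewrite rdot0l.
rewrite rdotZl mulr_ge0 ?invr_ge0 ?ler0n // rdotDl addr_ge0 //.
  by case/andP: (pK.2 x).
by rewrite (symm_rdot _ _ (symm_sqrt_iter n)) rdotxx_ge0.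
Qed.

Lemma rnorm_half (x : H) : rnorm ((2^-1)%:C%C *: x) = 2^-1 * rnorm x.
Proof. by rewrite rnormZ rnormC ger0_norm // invr_ge0. Qed.

Lemma sqrt_iter_le n x : rnorm (Y n x) <= sqrt_bound n * rnorm x.
Proof.
elim: n x => [|n IH] x /=; first by rewrite rnorm0 mul0r.
rewrite rnorm_half -mulrA ler_wpM2l ?invr_ge0 //.
apply: le_trans (rnormD _ _) _; rewrite mulrDl mul1r lerD //.
  exact: positive_contraction_le.
apply: le_trans (IH _) _; rewrite expr2 -mulrA ler_wpM2l //.
by case/andP: (sqrt_bound_itv n).
Qed.

Lemma sqrt_iter_step n x :
  rnorm (Y n.+1 x - Y n x) <= (sqrt_bound n.+1 - sqrt_bound n) * rnorm x.
Proof.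
elim: n x => [|n IH] x.
  by rewrite subr0 subr0; exact: (sqrt_iter_le 1).
have lY : linear (Y n.+1) by apply/symm_linear/symm_sqrt_iter.
(* The difference of the squares of [Y n.+1] and [Y n] is split around the mixed term
   [Y n.+1 (Y n x)]. Each piece is then bounded by its counterpart in the scalar iteration. *)
have -> : Y n.+2 x - Y n.+1 x = (2^-1)%:C%C *:
    (Y n.+1 (Y n.+1 x - Y n x) + (Y n.+1 (Y n x) - Y n (Y n x))).
  rewrite (linB lY) addrA subrK -[Y n.+2 x]/(_ *: (K x + Y n.+1 (Y n.+1 x))).
  rewrite -[X in _ - X = _]/(_ *: (K x + Y n (Y n x))) -scalerBr.
  by rewrite opprD addrACA subrr add0r.
rewrite rnorm_half.
have := rnormD (Y n.+1 (Y n.+1 x - Y n x)) (Y n.+1 (Y n x) - Y n (Y n x)).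
have := sqrt_iter_le n.+1 (Y n.+1 x - Y n x).
have := IH (Y n x); have := sqrt_iter_le n x; have := IH x.
have /andP[b0 b1] := sqrt_bound_itv n; have := sqrt_bound_le n.
have := rnorm_ge0 x.
rewrite -[sqrt_bound n.+2]/(2^-1 * (1 + sqrt_bound n.+1 ^+ 2)).
have : sqrt_bound n.+1 = 2^-1 * (1 + sqrt_bound n ^+ 2) by [].
move: (sqrt_bound n.+1) (sqrt_bound n) b0 b1 => b1 b0 b00 b01 eb r0 lb.
move=> i1 i2 i3 i4 i5.
have j3 : (b1 - b0) * rnorm (Y n x) <= (b1 - b0) * (b0 * rnorm x).
  by rewrite ler_wpM2l // subr_ge0.
have j4 : b1 * rnorm (Y n.+1 x - Y n x) <= b1 * ((b1 - b0) * rnorm x).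
  by rewrite ler_wpM2l //; lra.
have : rnorm (Y n.+1 (Y n.+1 x - Y n x) + (Y n.+1 (Y n x) - Y n (Y n x))) <=
  (b1 ^+ 2 - b0 ^+ 2) * rnorm x by lra.
rewrite {3}eb; lra.
Qed.

Lemma sqrt_iter_close m n x : (n <= m)%N ->
  rnorm (Y m x - Y n x) <= (sqrt_bound m - sqrt_bound n) * rnorm x.
Proof.
move=> /subnK <-; elim: (m - n)%N => [|k IH].
  by rewrite add0n !subrr rnorm0 mul0r.
have := sqrt_iter_step (k + n) x.
have := rnormD (Y (k.+1 + n) x - Y (k + n) x) (Y (k + n) x - Y n x).
rewrite addrA subrK addSn; lra.
Qed.

Lemma sqrt_iter_cvg x : exists l, rcvg (Y ^~ x) l.
Proof.
apply: rcauchy_rcvg => e e0; have r0 : 0 < rnorm x + 1.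
  by rewrite ltr_wpDl ?rnorm_ge0.
have [N NP] := sqrt_bound_cauchy (divr_gt0 e0 r0).
have close m n : (N <= n <= m)%N -> rnorm (Y m x - Y n x) < e.
  move=> Nnm; case/andP: (Nnm) => _ nm; apply: le_lt_trans (sqrt_iter_close x nm) _.
  have := NP m n Nnm; rewrite ltr_pdivlMr // => lt; apply: le_lt_trans lt.
  by rewrite ler_wpM2l ?lerDl // subr_ge0 sqrt_bound_nd.
exists N => m n Nm Nn; case: (leqP n m) => [nm|/ltnW mn].
  by rewrite close // Nn.
by rewrite rnormB close // Nm.
Qed.

Lemma sqrt_iter_comm L n x : linear L -> (forall x, L (K x) = K (L x)) ->
  L (Y n x) = Y n (L x).
Proof.
move=> lL LK; elim: n x => [|n IH] x /=; first by rewrite lin0.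
by rewrite (linZ lL) (linD lL) LK !IH.
Qed.

End Iteration.

(** The root is [1 - Z], with [Z] the limit of the iteration for [K = 1 - T]. The commutation clause
    passes to the limit from the iterates; it provides the commuting roots of [G] and [1 - G] in
    [resolvent_operator]. *)
Lemma positive_sqrt T : positive_contraction T ->
  exists P, [/\ positive_contraction P, forall x, P (P x) = T x &
    forall L, op_symmetric L -> (forall x, L (T x) = T (L x)) ->
      forall x, L (P x) = P (L x)].
Proof.
move=> pT; pose K x := x - T x.
have pK : positive_contraction K := positive_contraction_opB pT.
have [Z ZP] := choice (sqrt_iter_cvg pK).
have Z_le x : rnorm (Z x) <= rnorm x.
  apply: cvgr_to_le (rcvg_rnorm (ZP x)) _; near=> n.
  apply: le_trans (sqrt_iter_le pK n x) _.
  by rewrite ler_piMl ?rnorm_ge0 //; case/andP: (sqrt_bound_itv n).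
have sZ : op_symmetric Z.
  move=> x y; apply: inner_limit (ZP x) (ZP y) => n.
  by rewrite symm_sqrt_iter.
have lZ := symm_linear sZ.
have Z_ge0 x : 0 <= rdot (Z x) x.
  apply: cvgr_to_ge (rcvg_rdotl (k := x) (ZP x)) _; near=> n.
  exact: sqrt_iter_ge0.
have Z2 x : Z (Z x) = 2%:C%C *: Z x - K x.
  have h1 : rcvg (fun n => sqrt_iter K n (sqrt_iter K n x)) (Z (Z x)).
    apply: cvg0_le (_ : rnorm (sqrt_iter K n x - Z x) +
      rnorm (sqrt_iter K n (Z x) - Z (Z x)) @[n --> \oo] --> (0 : R)).
      move=> n; rewrite rnorm_ge0 /=.
      have lY : linear (sqrt_iter K n) by apply/symm_linear/symm_sqrt_iter.
      have -> : sqrt_iter K n (sqrt_iter K n x) - Z (Z x) =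
        sqrt_iter K n (sqrt_iter K n x - Z x) + (sqrt_iter K n (Z x) - Z (Z x)).
        by rewrite (linB lY) addrA subrK.
      apply: le_trans (rnormD _ _) _; rewrite lerD2r.
      apply: le_trans (sqrt_iter_le pK n _) _.
      by rewrite ler_piMl ?rnorm_ge0 //; case/andP: (sqrt_bound_itv n).
    by rewrite -(addr0 0); apply: cvgD; exact: ZP.
  apply: rcvg_unique h1 _.
  have -> : (fun n => sqrt_iter K n (sqrt_iter K n x)) =
      (fun n => 2%:C%C *: sqrt_iter K n.+1 x - K x).
    apply/funext => n /=; rewrite scalerA -rmorphM /= divff ?pnatr_eq0 //.
    by rewrite rmorph1 scale1r addrC addKr.
  apply: rcvgB; last exact: rcvg_cst.
  apply: rcvgZ; move: (ZP x).
  by rewrite /rcvg -(cvg_shiftS (fun n => rnorm (sqrt_iter K n x - Z x))).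
exists (fun x => x - Z x); split.
- split=> [|x]; first exact: symm_opB.
  have := rdot_le (Z x) x; have := Z_le x; have := rnorm_ge0 x.
  by have := Z_ge0 x; rewrite rdotBl rdotxx; nra.
- move=> x; rewrite (linB lZ) Z2 /K.
  by apply: rdot_eqP => h; rewrite !(rdotBl, rdotZl); lra.
- move=> L sL LT x; have lL := symm_linear sL.
  rewrite (linB lL); congr (_ - _); apply: rdot_eqP => h.
  rewrite symm_rdot //.
  have h1 := rcvg_rdotl (k := h) (ZP (L x)).
  apply: (cvg_unique (@norm_hausdorff _ _) _ h1).
  have -> : (fun n => rdot (sqrt_iter K n (L x)) h) =
     (fun n => rdot (sqrt_iter K n x) (L h)).
    apply/funext => n; rewrite -symm_rdot //; congr rdot.
    rewrite (@sqrt_iter_comm K L) // => y.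
    by rewrite /K (linB lL) LT.
  exact: rcvg_rdotl.
Unshelve. all: by end_near. Qed.

End SquareRoot.

(** * Operators associated with closed forms *)

Section JordanVonNeumann.
Variables (R : realType) (V : lmodType R[i]) (D : set V) (q : V -> R).
Hypothesis sD : lin_subspace D.
Hypothesis q_ge0 : forall x, D x -> 0 <= q x.
Hypothesis q_par : forall x y, D x -> D y ->
  q (x + y) + q (x - y) = 2 * q x + 2 * q y.
Hypothesis qZ : forall (t : R) x, D x -> q (t%:C%C *: x) = t ^+ 2 * q x.

Definition polar (x y : V) : R := (q (x + y) - q (x - y)) / 4.

Lemma quadN x : D x -> q (- x) = q x.
Proof. by move=> Dx; rewrite -scaleRN1 qZ // sqrrN expr1n mul1r. Qed.

Lemma quadB x y : D x -> D y -> q (x - y) = q (y - x).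
Proof. by move=> Dx Dy; rewrite -quadN ?opprB //; exact: subspaceB. Qed.

Lemma quad0 : q 0 = 0.
Proof.
have D0 := subspace0 sD.
by have := qZ 0 D0; rewrite scaler0 expr0n mul0r.
Qed.

Lemma polarxx x : D x -> polar x x = q x.
Proof.
move=> Dx; rewrite /polar subrr quad0.
have -> : x + x = 2%:C%C *: x by rewrite rmorphMn rmorph1 scaler_nat mulr2n.
by rewrite qZ //; field.
Qed.

Lemma polarC x y : D x -> D y -> polar x y = polar y x.
Proof. by move=> Dx Dy; rewrite /polar (addrC x) (quadB Dx Dy). Qed.

(** The parallelogram laws for the pairs [x + z, y + z] and [x - z, y - z] are subtracted; both have
    the difference [x - y], which cancels. *)
Lemma polar_half x y z : D x -> D y -> D z ->
  polar x z + polar y z = 2^-1 * polar (x + y) (z + z).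
Proof.
move=> Dx Dy Dz; rewrite /polar.
have := q_par (subspaceD sD Dx Dz) (subspaceD sD Dy Dz).
have := q_par (subspaceB sD Dx Dz) (subspaceB sD Dy Dz).
rewrite addrACA -opprD (_ : x - z - (y - z) = x - y); last first.
  by rewrite opprB addrA subrK.
rewrite addrACA (_ : x + z - (y + z) = x - y); last by rewrite opprD addrACA subrr addr0.
by move=> h1 h2; lra.
Qed.

Lemma polar0l y : D y -> polar 0 y = 0.
Proof. by move=> Dy; rewrite /polar add0r sub0r quadN // subrr mul0r. Qed.

Lemma polarDl x y z : D x -> D y -> D z ->
  polar (x + y) z = polar x z + polar y z.
Proof.
move=> Dx Dy Dz; rewrite polar_half //.
(* With second vector 0, [polar_half] reads [polar u z = 2^-1 * polar u (z + z)], here for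
   [u = x + y]. *)
have := polar_half (subspaceD sD Dx Dy) (subspace0 sD) Dz.
by rewrite addr0 polar0l // addr0.
Qed.

Lemma polar_abs_le x y : D x -> D y -> `|polar x y| <= (q x + q y) / 2.
Proof.
move=> Dx Dy; have := q_par Dx Dy.
have := q_ge0 (subspaceD sD Dx Dy); have := q_ge0 (subspaceB sD Dx Dy).
by rewrite /polar ler_norml => *; apply/andP; split; lra.
Qed.

(** The defect [g] is additive and vanishes on the integers, so reduction modulo 1 bounds it on the
    whole line. As [g (n t) = n g t], it must vanish. No continuity of the quadratic function is
    required in this way. *)
Lemma additive_bounded_linear (f : R -> R) (M : R) :
  {morph f : s t / s + t} -> (forall t, `|t| <= 1 -> `|f t| <= M) ->
  forall t, f t = t * f 1.
Proof.
move=> fD fM; pose g t := f t - t * f 1.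
have gD : {morph g : s t / s + t} by move=> s t; rewrite /g fD; ring.
have g1 : g 1 = 0 by rewrite /g mul1r subrr.
have gnat n t : g (n%:R * t) = n%:R * g t.
  elim: n => [|n IH]; last by rewrite -natr1 mulrDl mul1r gD IH; ring.
  by rewrite !mul0r; have := gD 0 0; rewrite addr0; lra.
have gN t : g (- t) = - g t.
  by have := gD t (- t); rewrite subrr -(mul0r 0) (gnat 0%N); lra.
have gint (m : int) : g m%:~R = 0.
  case: m => n; first by rewrite -[n%:~R]/(n%:R) -[n%:R]mulr1 gnat g1 mulr0.
  by rewrite NegzE mulrNz gN -[_%:~R]/(n.+1%:R) -[n.+1%:R]mulr1 gnat g1 mulr0 oppr0.
pose C := M + `|f 1|.
have gC t : `|g t| <= C.
  have -> : g t = g (t - (Num.floor t)%:~R).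
    by rewrite gD gN gint oppr0 addr0.
  set s := t - _; have s1 : `|s| <= 1.
    have := floor_le t; have := floorD1_gt t; rewrite intrD.
    by rewrite /s ler_norml => *; apply/andP; split; lra.
  apply: le_trans (ler_normB _ _) _; apply: lerD; first exact: fM.
  by rewrite normrM ler_piMl.
move=> t; suff : g t = 0 by rewrite /g => /eqP; rewrite subr_eq0 => /eqP.
apply/eqP; rewrite -normr_eq0 eq_le normr_ge0 andbT.
have C0 : 0 <= C by apply: le_trans (gC 0).
apply/ler_addgt0Pr => e e0; rewrite add0r.
pose n := Num.bound (C / e).
have : C / e < n%:R by apply: archi_boundP; rewrite divr_ge0 // ltW.
rewrite ltr_pdivrMr // => lt.
have n0 : 0 < n%:R :> R.
  by rewrite ltr0n lt0n; apply: contraTneq lt => ->; rewrite mul0r -leNgt.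
rewrite -(ler_pM2l n0); apply: le_trans (ltW lt).
by have := gC (n%:R * t); rewrite gnat normrM normr_nat.
Qed.

Lemma polarZl (t : R) x y : D x -> D y -> polar (t%:C%C *: x) y = t * polar x y.
Proof.
move=> Dx Dy; rewrite -[X in _ = t * polar X y]scale1r -[1](rmorph1 (real_complex R)).
apply: (@additive_bounded_linear (fun t => polar (t%:C%C *: x) y) ((q x + q y) / 2)).
  move=> s u; rewrite rmorphD scalerDl polarDl //; exact: subspaceZ.
move=> s s1; apply: le_trans (polar_abs_le (subspaceZ sD _ Dx) Dy) _.
rewrite ler_pM2r // lerD2r qZ // ler_piMl ?q_ge0 //.
by rewrite -real_normK ?num_real // expr_le1.
Qed.

Lemma polar_form : real_form D polar.
Proof.
split=> [||t x y Dx Dy|x Dx]; [exact: polarC|exact: polarDl|exact: polarZl|].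
by rewrite polarxx // q_ge0.
Qed.

End JordanVonNeumann.

(** * Closed forms and their resolvents *)

Section CompleteForms.
Variables (R : realType) (X : hilbertType R).
Implicit Types (D : set X) (a : X -> X -> R) (G : X -> X).

(* [a] is the graph inner product of a closed form with domain [D]. *)
Record complete_form D a : Prop := CompleteForm {
  cform_sub : lin_subspace D;
  cform_form : real_form D a;
  cform_i : forall x y, D x -> D y -> a ('i%C *: x) y = - a x ('i%C *: y);
  cform_ge : forall x, D x -> rnorm x ^+ 2 <= a x x;
  cform_complete : forall x : nat -> X, (forall n, D (x n)) -> form_cauchy a x ->
    exists2 l, D l & a (x n - l) (x n - l) @[n --> \oo] --> (0 : R) }.

(** The form [a] includes the inner product, so [G] is [(1 + H)^-1], where [H] is the operator of
    the form [a x y - rdot x y]. *)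
Definition resolvent D a G := forall v, D (G v) /\
  forall z, D z -> a (G v) z = rdot v z.

Section OneForm.
Variables (D : set X) (a : X -> X -> R).
Hypothesis ca : complete_form D a.
Let sD := cform_sub ca.
Let fa := cform_form ca.

Lemma cform_rcvg x l : (forall n, D (x n)) -> D l ->
  a (x n - l) (x n - l) @[n --> \oo] --> (0 : R) -> rcvg x l.
Proof.
move=> Dx Dl xl; apply: cvg0_sqr => [|n]; last exact: rnorm_ge0.
apply: cvg0_le xl => n; rewrite sqr_ge0 /=; apply: (cform_ge ca).
exact: subspaceB.
Qed.

Lemma cform_cvg x l h : (forall n, D (x n)) -> D l -> D h ->
  a (x n - l) (x n - l) @[n --> \oo] --> (0 : R) ->
  a (x n) h @[n --> \oo] --> a l h.
Proof.
move=> Dx Dl Dh xl; apply/cvgrPdist_lt => e e0.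
have h0 : 0 < a h h + 1 by rewrite ltr_wpDl ?(rform_ge0 fa).
have Dxl n : D (x n - l) by exact: subspaceB.
have [|N NP] := (cvg0P _).1 xl _ (divr_gt0 (exprn_gt0 2 e0) h0).
  by move=> n; exact: (rform_ge0 fa).
exists N => // n /= Nn; rewrite distrC -(rformBl sD fa) //.
suff : `|a (x n - l) h| ^+ 2 < e ^+ 2 by rewrite ltr_pXn2r // nnegrE ltW.
rewrite real_normK ?num_real //.
apply: le_lt_trans (form_cauchy_schwarz sD fa (Dxl n) Dh) _.
have := NP n Nn; rewrite ltr_pdivlMr // => lt; apply: le_lt_trans lt.
by rewrite ler_wpM2l ?lerDl // (rform_ge0 fa).
Qed.

Lemma cform_cvg_diag x l : (forall n, D (x n)) -> D l ->
  a (x n - l) (x n - l) @[n --> \oo] --> (0 : R) ->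
  a (x n) (x n) @[n --> \oo] --> a l l.
Proof.
move=> Dx Dl xl; have e n : a (x n) (x n) =
    a (x n - l) (x n - l) + 2 * a (x n) l - a l l.
  have Dxl : D (x n - l) by exact: subspaceB.
  have := form_sqrD sD fa Dxl Dl; rewrite subrK (rformBl sD fa (Dx n) Dl Dl) => ->.
  by ring.
have h : a (x n - l) (x n - l) + 2 * a (x n) l - a l l @[n --> \oo] -->
    0 + 2 * a l l - a l l.
  apply: cvgB; last exact: cvg_cst.
  by apply: cvgD; [exact: xl|apply: cvgMr; exact: (cform_cvg Dx Dl Dl xl)].
have -> : (fun n => a (x n) (x n)) =
    (fun n => a (x n - l) (x n - l) + 2 * a (x n) l - a l l) by exact/funext.
have el : 0 + 2 * a l l - a l l = a l l by ring.
by rewrite el in h.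
Qed.

Lemma cform_cauchy x l : (forall n, D (x n)) -> D l ->
  a (x n - l) (x n - l) @[n --> \oo] --> (0 : R) -> form_cauchy a x.
Proof.
move=> Dx Dl xl e e0; have Dxl n : D (x n - l) by exact: subspaceB.
have e4 : 0 < e / 4 by rewrite divr_gt0.
have [|N NP] := (cvg0P _).1 xl _ e4; first by move=> n; exact: (rform_ge0 fa).
exists N => m n /NP mN /NP nN; have := formB_le sD fa (Dxl m) (Dxl n).
by rewrite opprB addrA subrK; lra.
Qed.

Lemma ex_resolvent : exists G, resolvent D a G.
Proof.
suff ex v : exists u, D u /\ forall z, D z -> a u z = rdot v z.
  by have [G GP] := choice ex; exists G.
have fl : real_functional D (rdot v).
  by split=> *; [exact: rdotDr|exact: rdotZr].
have fk h : D h -> rdot v h ^+ 2 <= rnorm v ^+ 2 * a h h.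
  move=> Dh; apply: le_trans (rdot_sqr_le _ _) _.
  by rewrite ler_wpM2l ?sqr_ge0 // (cform_ge ca).
have [x [Dx cx xP]] := approx_riesz_seq sD fa fl fk.
have [l Dl xl] := cform_complete ca Dx cx.
exists l; split=> // z Dz; apply: (cvg_harmonic_sqr (fun n => xP n z Dz)).
exact: cform_cvg.
Qed.

Section Resolvent.
Variable G : X -> X.
Hypothesis rG : resolvent D a G.

Lemma resolventD v : D (G v). Proof. by case: (rG v). Qed.

Lemma resolventE v z : D z -> a (G v) z = rdot v z.
Proof. by case: (rG v) => _; apply. Qed.
Hint Resolve resolventD : core.

Lemma resolvent_symm : op_symmetric G.
Proof.
move=> v w; apply: inner_eq.
  by rewrite rdotC -!resolventE // (rformC fa).
have Di u : D ('i%C *: G u) by exact: subspaceZ.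
rewrite rdotC -(resolventE w (Di v)) (rformC fa _ (Di v)) // (cform_i ca) //.
by rewrite (resolventE v (Di w)) rdot_ilr.
Qed.

Lemma resolvent_contraction : positive_contraction G.
Proof.
split=> [|v]; first exact: resolvent_symm.
have e : a (G v) (G v) = rdot (G v) v by rewrite resolventE // rdotC.
have := cform_ge ca (resolventD v); rewrite e => le.
have := rdot_le (G v) v; have := rnorm_ge0 (G v); have := rnorm_ge0 v.
rewrite -e (rform_ge0 fa) // e /= => ? ? ?.
have [gv|lt] := leP (rnorm (G v)) (rnorm v); nra.
Qed.

(** The functional [rdot x] equals [a (G h) x] at [h], so it is bounded for the form
    [<G v, w> = a (G v) (G w)] on the whole space. Its approximate representers [v n] satisfy
    [G (v n) --> x] in the form norm. *)
Lemma resolvent_core x : D x -> exists v : nat -> X,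
  a (G (v n) - x) (G (v n) - x) @[n --> \oo] --> (0 : R).
Proof.
move=> Dx; have lG := symm_linear resolvent_symm.
pose g v w := rdot (G v) w.
have gE v w : g v w = a (G v) (G w) by rewrite resolventE // /g symm_rdot //; exact: resolvent_symm.
have fg : real_form setT g.
  split=> [v w _ _|v w u _ _ _|t v w _ _|v _].
  - by rewrite !gE (rformC fa).
  - by rewrite /g (linD lG) rdotDl.
  - by rewrite /g (linZ lG) rdotZl.
  - by rewrite gE (rform_ge0 fa).
have fl : real_functional setT (rdot x).
  by split=> *; [exact: rdotDr|exact: rdotZr].
have fk h : setT h -> rdot x h ^+ 2 <= a x x * g h h.
  move=> _; rewrite rdotC -resolventE // gE mulrC.
  exact: (form_cauchy_schwarz sD fa).
have [v [_ cv vP]] := approx_riesz_seq (subspaceT X) fg fl fk.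
have DG n : D (G (v n)) by [].
have [|l Dl vl] := cform_complete ca DG.
  move=> e /cv[N NP]; exists N => m n mN nN.
  by rewrite -(linB lG) -gE; exact: NP.
exists v; suff <- : l = x by [].
apply: rdot_eqP => h; rewrite rdotC -resolventE // (rformC fa) //.
apply: (cvg_harmonic_sqr (fun n => vP n h I)).
have -> : (fun n => g (v n) h) = (fun n => a (G (v n)) (G h)).
  by apply/funext => n; rewrite gE.
exact: cform_cvg.
Qed.

End Resolvent.
End OneForm.

(** On the range of [G] both forms take the value [<w, G w>] at [G w]. That range is dense in [D]
    for the form norm, and completeness of [a'] carries the limits over to [D']. *)
Lemma resolvent_unique D a D' a' G : complete_form D a -> complete_form D' a' ->
  resolvent D a G -> resolvent D' a' G -> forall x, D x -> D' x /\ a' x x = a x x.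
Proof.
move=> ca ca' rG rG' x Dx; have [v vx] := resolvent_core ca rG Dx.
have DG n : D (G (v n)) by case: (rG (v n)).
have DG' n : D' (G (v n)) by case: (rG' (v n)).
have lG := symm_linear (resolvent_symm ca rG).
have aa' w : a' (G w) (G w) = a (G w) (G w).
  by rewrite (resolventE rG w (resolventD rG w)) (resolventE rG' w (resolventD rG' w)).
have cv : form_cauchy a (fun n => G (v n)) by exact: (cform_cauchy ca DG Dx vx).
have [|l D'l vl] := cform_complete ca' DG'.
  move=> e /cv[N NP]; exists N => m n mN nN.
  by rewrite -(linB lG) aa' (linB lG); exact: NP.
have lx : l = x.
  exact: rcvg_unique (cform_rcvg ca' DG' D'l vl) (cform_rcvg ca DG Dx vx).
rewrite lx in D'l vl; split=> //.
apply: (cvg_unique (@norm_hausdorff _ _) (cform_cvg_diag ca' DG' D'l vl)).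
have -> : (fun n => a' (G (v n)) (G (v n))) = (fun n => a (G (v n)) (G (v n))).
  by apply/funext => n.
exact: (cform_cvg_diag ca DG Dx vx).
Qed.

End CompleteForms.

(** * From a resolvent to a selfadjoint operator and its square roots *)

Section FormOperator.
Variables (R : realType) (X : hilbertType R).

Lemma selfadjoint_complete_form (T : set (X * X)) : selfadjoint T ->
  complete_form (dom T) (fun x y => rdot x y + rdot (app T x) (app T y)).
Proof.
move=> saT; have sD := dom_subspace saT; split=> //.
- split=> [x y _ _|x y z Dx Dy Dz|t x y Dx Dy|x Dx].
  + by rewrite rdotC (rdotC (app T x)).
  + by rewrite appD // !rdotDl; ring.
  + by rewrite appZ // !rdotZl; ring.
  + by rewrite addr_ge0 ?rdotxx_ge0.
- by move=> x y Dx Dy; rewrite !appZ // !rdot_ilr opprD.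
- by move=> x Dx; rewrite rdotxx lerDl rdotxx_ge0.
move=> x Dx cx.
have small (Z : hilbertType R) (y : nat -> Z) :
    (forall m n, rnorm (y m - y n) ^+ 2 <= rdot (x m - x n) (x m - x n) +
       rdot (app T (x m - x n)) (app T (x m - x n))) -> exists l, rcvg y l.
  move=> yx; apply: rcauchy_rcvg => e e0.
  have [N NP] := cx _ (exprn_gt0 2 e0); exists N => m n mN nN.
  have := le_lt_trans (yx m n) (NP m n mN nN).
  by rewrite ltr_pXn2r // nnegrE ?rnorm_ge0 ?ltW.
have [l xl] : exists l, rcvg x l.
  by apply: small => m n; rewrite rdotxx lerDl rdotxx_ge0.
have [k yk] : exists k, rcvg (fun n => app T (x n)) k.
  by apply: small => m n; rewrite -appB // -[leLHS]rdotxx lerDr rdotxx_ge0.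
have Tlk : T (l, k) by apply: (sa_closed saT) xl yk => n; exact: sa_app.
have Dl : dom T l by exists k.
exists l => //; have e n : rdot (x n - l) (x n - l) +
    rdot (app T (x n - l)) (app T (x n - l)) =
    rnorm (x n - l) ^+ 2 + rnorm (app T (x n) - k) ^+ 2.
  by rewrite appB // (sa_appE saT Tlk) !rdotxx.
have h : rnorm (x n - l) ^+ 2 + rnorm (app T (x n) - k) ^+ 2 @[n --> \oo] -->
    (0 : R) ^+ 2 + 0 ^+ 2 by apply: cvgD; exact: cvg_sqr.
rewrite expr0n addr0 /= in h.
by have -> : (fun n => rdot (x n - l) (x n - l) +
    rdot (app T (x n - l)) (app T (x n - l))) =
  (fun n => rnorm (x n - l) ^+ 2 + rnorm (app T (x n) - k) ^+ 2) by apply/funext.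
Qed.

(** The set is the graph of [B A^-1], and [L], [M] act as Bezout coefficients. A pair [(u, v)] in
    the adjoint graph satisfies [B u = A v], and then [L u + M v] is a parameter for it. *)
Lemma selfadjoint_pair (A B L M : X -> X) :
  op_symmetric A -> op_symmetric B -> (forall x, A (B x) = B (A x)) ->
  linear L -> linear M ->
  (forall x, A (L x) = L (A x)) -> (forall x, B (L x) = L (B x)) ->
  (forall x, A (M x) = M (A x)) -> (forall x, B (M x) = M (B x)) ->
  (forall x, L (A x) + M (B x) = x) -> (forall x, A x = 0 -> x = 0) ->
  selfadjoint [set p | exists w, p = (A w, B w)].
Proof.
move=> sA sB AB lL lM AL BL AM BM LM A0; split.
  have -> : dom [set p | exists w, p = (A w, B w)] = range A.
    apply/seteqP; split=> [x [y [w [-> _]]]|_ [w _ <-]]; first by exists w.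
    by exists (B w), w.
  have lA := symm_linear sA.
  apply: dense_orth.
    split=> [|_ _ [u _ <-] [v _ <-]|c _ [u _ <-]].
    - by exists 0 => //; rewrite (lin0 lA).
    - by exists (u + v) => //; rewrite (linD lA).
    - by exists (c *: u) => //; rewrite (linZ lA).
  move=> x xA; apply: A0; apply: rdot_eqP => h.
  by rewrite symm_rdot // rdot0l xA //; exists h.
apply/seteqP; split=> [[u v] /= h|_ [w ->] _ _ [z [-> ->]] /=]; last first.
  by rewrite sB sA AB.
have BAuv : B u = A v.
  apply: rdot_eqP => z; rewrite !(rdotC _ z) -!symm_rdot // /rdot.
  by rewrite (h (A z) (B z)) //; exists z.
have lA := symm_linear sA; have lB := symm_linear sB.
exists (L u + M v).
by rewrite (linD lA) (linD lB) AL AM BL BM -BAuv LM BAuv LM.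
Qed.

Lemma symm_inner_real (Q : X -> X) u : op_symmetric Q ->
  inner (Q u) u = (rdot (Q u) u)%:C%C.
Proof.
move=> sQ; have := inner_conj (Q u) u; rewrite -sQ /rdot.
case: (inner _ _) => a b [] /eqP; rewrite -subr_eq0 opprK -mulr2n mulrn_eq0.
by move=> /eqP ->.
Qed.

(* With [P^2 = G] and [Q^2 = 1 - G], a square root of [G^-1 - 1] is
   [{(P w, Q w)}]. *)
Lemma resolvent_operator (G : X -> X) : positive_contraction G ->
  (forall x, G x = 0 -> x = 0) ->
  selfadjoint [set p | exists w, p = (G w, w - G w)] /\
  exists S, is_sqrt [set p | exists w, p = (G w, w - G w)] S.
Proof.
move=> pG G0; have sG := pG.1; have lG := symm_linear sG.
have pG' := positive_contraction_opB pG.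
have [P [pP PP _]] := positive_sqrt pG; have sP := pP.1; have lP := symm_linear sP.
have [Q [pQ QQ Qcomm]] := positive_sqrt pG'; have sQ := pQ.1.
have lQ := symm_linear sQ.
have PQ x : P (Q x) = Q (P x).
  by apply: Qcomm => // y; rewrite (linB lP) -!PP.
(* This fourth root of [G] gives nonnegativity: [<Q w, P w> = <Q (P1 w), P1 w>]. *)
have [P1 [pP1 PP1 P1comm]] := positive_sqrt pP.
have QP1 x : Q (P1 x) = P1 (Q x) by apply: P1comm.
have P0 x : P x = 0 -> x = 0.
  by move=> Px; apply: G0; rewrite -PP Px (lin0 lP).
have PPQQ x : P (P x) + Q (Q x) = x by rewrite PP QQ addrC subrK.
split.
  have lid : linear (@id X) by [].
  apply: (selfadjoint_pair sG pG'.1 _ lid lid) => // x.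
  - by rewrite (linB lG).
  - by rewrite addrC subrK.
exists [set p | exists w, p = (P w, Q w)]; split.
- exact: (selfadjoint_pair sP sQ PQ lP lQ).
- move=> _ [_ [w [-> _]]].
  have -> : app [set p | exists w, p = (P w, Q w)] (P w) = Q w.
    rewrite /app; case: xgetP => [y _ [w' [Pw ->]]|/(_ (Q w))[]]; last by exists w.
    congr Q; apply/eqP; rewrite -subr_eq0; apply/eqP/P0.
    by rewrite (linB lP) Pw subrr.
  rewrite -PP1 -pP1.1 -QP1 (symm_inner_real _ pQ.1) ler0c.
  by case/andP: (pQ.2 (P1 w)).
- apply/seteqP; split=> [[u v] [y [w [-> /= ->]] [w' [Qw /= ->]]]|_ [v ->]].
    (* Since [Q w = P w'], the maps [P] and [Q] send this vector to [w] and [w']. *)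
    exists (P w + Q w'); congr (_, _).
      by rewrite -PP; congr P; rewrite (linD lP) PQ -Qw PPQQ.
    by rewrite -QQ; congr Q; rewrite (linD lQ) -PQ Qw PPQQ.
  exists (Q (P v)); first by exists (P v); rewrite PP.
  by exists (Q v); rewrite PQ QQ.
Qed.

(* [H = G^-1 - 1], where [G] is the resolvent of [a]. *)
Lemma form_operator (D : set X) (a : X -> X -> R) : complete_form D a -> dense D ->
  exists H : set (X * X), [/\ selfadjoint H, exists S, is_sqrt H S &
    forall S, is_sqrt H S -> (forall x, dom S x <-> D x) /\
      forall x, D x -> rnorm (app S x) ^+ 2 = a x x - rnorm x ^+ 2].
Proof.
move=> ca dD; have [G rG] := ex_resolvent ca.
have G0 x : G x = 0 -> x = 0.
  move=> Gx; apply: (rdot_dense_eq dD) => w Dw.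
  rewrite -(resolventE rG x Dw) Gx rdot0l -(scale0r 0) -(rmorph0 (real_complex R)).
  by rewrite (rformZ (cform_form ca)) ?mul0r //; exact: subspace0 (cform_sub ca).
have [saH exS] := resolvent_operator (resolvent_contraction ca rG) G0.
exists [set p | exists w, p = (G w, w - G w)]; split=> // S [saS _ SS].
have cS := selfadjoint_complete_form saS.
(* An arbitrary root [S] of [H] has the resolvent [G], so its graph form coincides with [a]. *)
have rS : resolvent (dom S) (fun x y => rdot x y + rdot (app S x) (app S y)) G.
  move=> v; have : op_comp S S (G v, v - G v) by rewrite SS; exists v.
  move=> [y /= Sy Sv]; have DG : dom S (G v) by exists y.
  split=> // z Dz; rewrite (sa_appE saS Sy) (rdotC y) (app_rdot saS Dz); last by exists (v - G v).
  by rewrite (sa_appE saS Sv) (rdotC z) -rdotDl addrC subrK.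
split=> [x|x Dx]; first split.
- by case/(resolvent_unique cS ca rS rG).
- by case/(resolvent_unique ca cS rG rS).
have [_ <-] := resolvent_unique ca cS rG rS Dx.
by rewrite !rdotxx addrC addKr.
Qed.

End FormOperator.

(** * Goursat's theorem for Riemann sums *)

Section Derivative.
Variable K : numFieldType.
Implicit Types (f g : K -> K) (z L : K).

Definition has_derivative f z L := forall e, 0 < e -> exists2 d, 0 < d &
  forall h, `|h| < d -> `|f (z + h) - f z - L * h| <= e * `|h|.

Definition cdiff f z := exists L, has_derivative f z L.

Lemma difference_quotient f z L h : h != 0 ->
  (h^-1 *: (f (h *: 1 + z) - f z) - L) * h = f (z + h) - f z - L * h.
Proof.
move=> h0; rewrite mulrBl /GRing.scale /= mulr1 mulrAC mulVf // mul1r.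
by rewrite (addrC h).
Qed.

Lemma has_derivativeP f z L : has_derivative f z L <->
  h^-1 *: (f (h *: 1 + z) - f z) @[h --> 0^'] --> L.
Proof.
split=> [fL|/cvgrPdist_le fL e /fL].
  apply/cvgrPdist_le => e /fL[d d0 dP].
  rewrite near_withinE; apply/nbhs_ballP; exists d => // h.
  rewrite /ball /= sub0r normrN => hd h0.
  have hn : 0 < `|h| by rewrite normr_gt0.
  by rewrite distrC -(ler_pM2r hn) -normrM difference_quotient //; exact: dP.
rewrite near_withinE => /nbhs_ballP[d /= d0 dP]; exists d => // h hd.
have [->|h0] := eqVneq h 0.
  by rewrite addr0 subrr mulr0 subrr normr0 mulr0.
have /= := dP h; rewrite /ball /= sub0r normrN => /(_ hd h0).
have hn : 0 < `|h| by rewrite normr_gt0.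
by rewrite distrC -(ler_pM2r hn) -normrM difference_quotient.
Qed.

Lemma cdiffP f z : cdiff f z <-> derivable f z 1.
Proof.
by split=> [[L /has_derivativeP fL]|/cvg_ex[L /has_derivativeP]]; [apply/cvg_ex|]; exists L.
Qed.

Lemma is_derive_derivative f z L : is_derive z 1 f L -> has_derivative f z L.
Proof. by move=> [df <-]; apply/has_derivativeP. Qed.

Lemma cdiff_cst c z : cdiff (fun=> c) z.
Proof. by apply/cdiffP; exact: derivable_cst. Qed.

Lemma cdiff_id z : cdiff id z.
Proof. by apply/cdiffP; exact: derivable_id. Qed.

Lemma cdiffD f g z : cdiff f z -> cdiff g z -> cdiff (fun x => f x + g x) z.
Proof. by move=> /cdiffP df /cdiffP dg; apply/cdiffP; exact: derivableD. Qed.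

Lemma cdiffM f g z : cdiff f z -> cdiff g z -> cdiff (fun x => f x * g x) z.
Proof. by move=> /cdiffP df /cdiffP dg; apply/cdiffP; exact: derivableM. Qed.

Lemma cdiffV z : z != 0 -> cdiff (fun x => x^-1) z.
Proof. by move=> z0; apply/cdiffP; apply: derivableV. Qed.

Lemma cdiffX n f z : cdiff f z -> cdiff (fun x => f x ^+ n) z.
Proof.
move=> df; elim: n => [|n IH]; first exact: cdiff_cst.
under eq_fun do rewrite exprS; exact: cdiffM df IH.
Qed.

Lemma cdiff_sum (I : Type) (r : seq I) (P : pred I) (F : I -> K -> K) z :
  (forall i, P i -> cdiff (F i) z) -> cdiff (fun x => \sum_(i <- r | P i) F i x) z.
Proof.
move=> dF; elim: r => [|i r IH].
  by under eq_fun do rewrite big_nil; exact: cdiff_cst.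
have -> : (fun x => \sum_(j <- i :: r | P j) F j x) =
    if P i then fun x => F i x + \sum_(j <- r | P j) F j x
    else fun x => \sum_(j <- r | P j) F j x.
  by apply/funext => x; rewrite big_cons; case: ifP.
by case: ifP => // Pi; exact: cdiffD (dF i Pi) IH.
Qed.

End Derivative.

(** * Left Riemann sums on squares and bisection *)

Section LeftSums.
Variable R : realType.
Implicit Types (f : R -> R[i]) (g : R -> R -> R[i]).

(** With [2 ^ n] nodes, halving the interval and lowering [n] by one keeps the mesh and the
    nodes. *)
Definition left_sum f (s L : R) n : R[i] :=
  \sum_(k < 2 ^ n) (L / 2 ^+ n)%:C%C * f (s + k%:R * (L / 2 ^+ n)).

Lemma left_sumS f s L n :
  left_sum f s L n.+1 = left_sum f s (L / 2) n + left_sum f (s + L / 2) (L / 2) n.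
Proof.
have e : L / 2 ^+ n.+1 = L / 2 / 2 ^+ n by rewrite exprS invfM mulrA.
set d := L / 2 / 2 ^+ n in e *.
rewrite /left_sum e -/d -(big_mkord xpredT (fun k => d%:C%C * f (s + k%:R * d))).
rewrite expnS mul2n -addnn (big_cat_nat (n := 2 ^ n)) ?leq_addr //=; congr (_ + _).
  by rewrite big_mkord.
rewrite -{1}[(2 ^ n)%N]add0n big_addn addnK big_mkord; apply: eq_bigr => k _.
congr (_ * f _); rewrite -addrA; congr (s + _).
rewrite natrD natrX mulrDl addrC /d; congr (_ + _).
by field; rewrite expf_eq0 pnatr_eq0 andbF.
Qed.

Lemma left_sumB f h s L n :
  left_sum f s L n - left_sum h s L n = left_sum (fun x => f x - h x) s L n.
Proof. by rewrite -sumrB; apply: eq_bigr => k _; rewrite mulrBr. Qed.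

Lemma left_sum_cst c s L n : left_sum (fun=> c) s L n = L%:C%C * c.
Proof.
rewrite /left_sum sumr_const card_ord -[_ *+ _]mulr_natl mulrA.
rewrite -(rmorph_nat (real_complex R)) -rmorphM natrX.
by rewrite (mulrC (2 ^+ n)) divfK // expf_eq0 pnatr_eq0 andbF.
Qed.

Lemma left_sum_le f s L n (M : R) : 0 <= L ->
  (forall x, 0 <= x <= L -> rnorm (f (s + x)) <= M) ->
  rnorm (left_sum f s L n) <= L * M.
Proof.
move=> L0 fM; apply: le_trans (rnorm_sum _ _ _) _.
have p0 : 0 < 2 ^+ n :> R by rewrite exprn_gt0.
have d0 : 0 <= L / 2 ^+ n by rewrite divr_ge0 // ltW.
apply: le_trans (_ : \sum_(k < 2 ^ n) L / 2 ^+ n * M <= _).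
  apply: ler_sum => k _; rewrite rnormM rnormC ger0_norm // ler_wpM2l //.
  apply: fM; rewrite mulr_ge0 //= mulrA ler_pdivrMr // mulrC ler_wpM2l //.
  by rewrite -natrX ler_nat ltnW.
rewrite sumr_const card_ord -[_ *+ _]mulr_natl natrX mulrA.
by rewrite mulrC (mulrC (2 ^+ n)) divfK ?gt_eqF // mulrC.
Qed.

(* Left Riemann sum of [g] along the boundary of a square. It is exactly
   additive under bisection and vanishes on affine functions, so Goursat's
   argument applies to it for every fixed mesh. *)
Definition boundary_sum g (s t L : R) n : R[i] :=
  left_sum (g^~ t) s L n - left_sum (g^~ (t + L)) s L n
  + 'i%C * (left_sum (g (s + L)) t L n - left_sum (g s) t L n).

Lemma boundary_sumS g s t L n :
  boundary_sum g s t L n.+1 =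
    boundary_sum g s t (L / 2) n + boundary_sum g (s + L / 2) t (L / 2) n
    + (boundary_sum g s (t + L / 2) (L / 2) n
       + boundary_sum g (s + L / 2) (t + L / 2) (L / 2) n).
Proof.
rewrite /boundary_sum !left_sumS.
have half (u : R) : u + L / 2 + L / 2 = u + L by field.
by rewrite !half; ring.
Qed.

Lemma boundary_sumB g h s t L n :
  boundary_sum g s t L n - boundary_sum h s t L n =
  boundary_sum (fun x y => g x y - h x y) s t L n.
Proof. by rewrite /boundary_sum -!left_sumB; ring. Qed.

Lemma boundary_sum_affine (al be : R[i]) s t L n :
  boundary_sum (fun x y => al + be * (x +i* y)%C) s t L n = 0.
Proof.
rewrite /boundary_sum !left_sumB.
have -> : (fun x => al + be * (x +i* t)%C - (al + be * (x +i* (t + L))%C)) =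
    (fun=> - (be * 'i%C * L%:C%C)).
  apply/funext => x; rewrite [(x +i* (t + L))%C]complexE [(x +i* t)%C]complexE /=.
  by rewrite rmorphD /=; ring.
have -> : (fun y => al + be * ((s + L) +i* y)%C - (al + be * (s +i* y)%C)) =
    (fun=> be * L%:C%C).
  apply/funext => y; rewrite [((s + L) +i* y)%C]complexE [(s +i* y)%C]complexE /=.
  by rewrite rmorphD /=; ring.
by rewrite !left_sum_cst; ring.
Qed.

Lemma boundary_sum_le g s t L n (M : R) : 0 <= L ->
  (forall x y, 0 <= x <= L -> 0 <= y <= L -> rnorm (g (s + x) (t + y)) <= M) ->
  rnorm (boundary_sum g s t L n) <= 4 * (L * M).
Proof.
move=> L0 gM; have L00 : 0 <= (0 : R) <= L by rewrite lexx.
have LL : 0 <= L <= L by rewrite lexx andbT.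
have h1 : rnorm (left_sum (g^~ t) s L n) <= L * M.
  by apply: left_sum_le => // x xL; have := gM x 0 xL L00; rewrite addr0.
have h2 : rnorm (left_sum (g^~ (t + L)) s L n) <= L * M.
  by apply: left_sum_le => // x xL; exact: gM.
have h3 : rnorm (left_sum (g (s + L)) t L n) <= L * M.
  by apply: left_sum_le => // x xL; exact: gM.
have h4 : rnorm (left_sum (g s) t L n) <= L * M.
  by apply: left_sum_le => // x xL; have := gM 0 x L00 xL; rewrite addr0.
apply: le_trans (rnormD _ _) _; rewrite rnormM rnorm_i mul1r.
have tri (u v : R[i]) : rnorm (u - v) <= rnorm u + rnorm v.
  by rewrite -(rnormN v) rnormD.
apply: le_trans (lerD (tri _ _) (tri _ _)) _; lra.
Qed.

(** Complex differentiability in real coordinates: a single complex factor [be] governs both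
    directions. *)
Definition differentiable2 g (s t : R) := exists be : R[i], forall e, 0 < e ->
  exists2 d, 0 < d & forall x y, `|x - s| < d -> `|y - t| < d ->
    rnorm (g x y - g s t - be * ((x - s) +i* (y - t))%C) <= e * (`|x - s| + `|y - t|).

Section Goursat.
Variables (g : R -> R -> R[i]) (a b L : R).
Hypothesis L0 : 0 < L.
Hypothesis dg : forall s t, a <= s <= a + L -> b <= t <= b + L -> differentiable2 g s t.

(** The threshold [M] may depend on the square; a bisection takes the maximum over four
    subsquares. *)
Definition negligible (e : R) (k : nat) (z : R * R) := exists M, forall n, (M <= n)%N ->
  rnorm (boundary_sum g z.1 z.2 (L / 2 ^+ k) n) <= e * (L / 2 ^+ k) ^+ 2.

Definition child (k : nat) (z w : R * R) :=
  (w.1 = z.1 \/ w.1 = z.1 + L / 2 ^+ k.+1) /\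
  (w.2 = z.2 \/ w.2 = z.2 + L / 2 ^+ k.+1).

Lemma bisect e k z : ~ negligible e k z ->
  exists2 w, child k z w & ~ negligible e k.+1 w.
Proof.
move=> nz; apply: contrapT => nw; apply: nz.
have all w : child k z w -> negligible e k.+1 w.
  by move=> zw; apply: contrapT => nn; apply: nw; exists w.
set l := L / 2 ^+ k.+1; have ll : L / 2 ^+ k / 2 = l by rewrite -mulrA -invfM -exprSr.
have [M1 h1] : negligible e k.+1 z by apply: all; split; left.
have [M2 h2] : negligible e k.+1 (z.1 + l, z.2) by apply: all; split; [right|left].
have [M3 h3] : negligible e k.+1 (z.1, z.2 + l) by apply: all; split; [left|right].
have [M4 h4] : negligible e k.+1 (z.1 + l, z.2 + l) by apply: all; split; right.
exists (maxn (maxn M1 M2) (maxn M3 M4)).+1 => -[//|n]; rewrite ltnS !geq_max.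
move=> /andP[/andP[m1 m2] /andP[m3 m4]]; rewrite boundary_sumS ll.
have := h1 n m1; have := h2 n m2; have := h3 n m3; have := h4 n m4.
rewrite /= -/l => q4 q3 q2 q1.
apply: le_trans (rnormD _ _) _.
have := rnormD (boundary_sum g z.1 (z.2 + l) l n) (boundary_sum g (z.1 + l) (z.2 + l) l n).
have -> : L / 2 ^+ k = 2 * l by rewrite -ll; field.
rewrite exprMn => q5.
have := rnormD (boundary_sum g z.1 z.2 l n) (boundary_sum g (z.1 + l) z.2 l n).
lra.
Qed.

Lemma goursat (e : R) : 0 < e -> exists M, forall n, (M <= n)%N ->
  rnorm (boundary_sum g a b L n) <= e * L ^+ 2.
Proof.
move=> e0; suff : negligible e 0 (a, b) by rewrite /negligible expr0 divr1.
apply: contrapT => nab.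
have stepP (kz : nat * (R * R)) : exists w, ~ negligible e kz.1 kz.2 ->
    child kz.1 kz.2 w /\ ~ negligible e kz.1.+1 w.
  have [n|/bisect[w zw nw]] := pselect (negligible e kz.1 kz.2); first by exists (0, 0).
  by exists w.
have [step st] := choice stepP.
pose z := fix z k := if k is m.+1 then step (m, z m) else (a, b).
have nz k : ~ negligible e k (z k).
  by elim: k => [//|k IH]; case: (st (k, z k) IH).
have cz k : child k (z k) (z k.+1) by case: (st (k, z k) (nz k)).
pose l k := L / 2 ^+ k.
have l0 k : 0 < l k by rewrite divr_gt0 // exprn_gt0.
have ll k : l k = l k.+1 + l k.+1.
  by rewrite /l exprS invfM; field; rewrite expf_eq0 pnatr_eq0 andbF.
have nested (u : nat -> R) : (forall k, u k.+1 = u k \/ u k.+1 = u k + l k.+1) ->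
    exists x, forall k, u k <= x <= u k + l k.
  move=> uP; have up : nondecreasing_seq u.
    by apply/nondecreasing_seqP => k; case: (uP k) => -> //; rewrite lerDl ltW.
  have down m k : (m <= k)%N -> u k + l k <= u m + l m.
    move=> /subnK <-; elim: (k - m)%N => [|j IH]; first by rewrite add0n.
    apply: le_trans IH; rewrite addSn [l (j + m)%N]ll.
    have := l0 (j + m).+1; case: (uP (j + m)%N) => ->; lra.
  exists (sup (range u)) => k; apply/andP; split.
    apply: ub_le_sup; last by exists k.
    exists (u 0 + l 0) => _ [j _ <-].
    by apply: le_trans (down 0%N j (leq0n j)); rewrite lerDl ltW.
  apply: ge_sup; first by exists (u 0), 0%N.
  move=> _ [j _ <-]; case: (leqP j k) => [jk|/ltnW kj].
    by apply: le_trans (up _ _ jk) _; rewrite lerDl ltW.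
  by apply: le_trans (down _ _ kj); rewrite lerDl ltW.
have [x xP] := nested (fun k => (z k).1) (fun k => (cz k).1).
have [y yP] := nested (fun k => (z k).2) (fun k => (cz k).2).
have [||be beP] := @dg x y.
- by have := xP 0%N; rewrite /l expr0 divr1.
- by have := yP 0%N; rewrite /l expr0 divr1.
(* On a square of side [l] the error is at most [e / 8 * (l + l)], and four sides of length [l] give
   [e * l ^+ 2]. *)
have [d d0 dP] := beP (e / 8) (divr_gt0 e0 (ltr0Sn _ 7)).
have [k lk] : exists k, l k < d.
  have [N NP] := @invn_small R (d / L) (divr_gt0 d0 L0).
  exists N; have := NP N (leqnn N); rewrite ltr_pdivlMr // => lt.
  apply: le_lt_trans lt; rewrite /l mulrC ler_wpM2r ?(ltW L0) //.
  rewrite lef_pV2 ?posrE ?exprn_gt0 ?ltr0n // -natrX ler_nat.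
  exact: ltn_expl.
(* The affine part has boundary sum 0 on every mesh, so the estimate holds from threshold 0 on. *)
apply: (nz k); exists 0%N => n _; rewrite -/(l k).
pose al := g x y - be * (x +i* y)%C.
rewrite -[boundary_sum _ _ _ _ _]subr0 -(boundary_sum_affine al be (z k).1 (z k).2 (l k) n).
rewrite boundary_sumB.
have -> : e * l k ^+ 2 = 4 * (l k * (e / 8 * (l k + l k))) by field.
apply: boundary_sum_le; first exact: ltW.
move=> p q /andP[p0 p1] /andP[q0 q1].
have /andP[x0 x1] := xP k; have /andP[y0 y1] := yP k.
have hp : `|(z k).1 + p - x| <= l k by rewrite ler_norml; apply/andP; split; lra.
have hq : `|(z k).2 + q - y| <= l k by rewrite ler_norml; apply/andP; split; lra.
have := dP _ _ (le_lt_trans hp lk) (le_lt_trans hq lk).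
set w1 := (z k).1 + p in hp *; set w2 := (z k).2 + q in hq *.
have -> : g w1 w2 - g x y - be * ((w1 - x) +i* (w2 - y))%C =
    g w1 w2 - (al + be * (w1 +i* w2)%C).
  have -> : ((w1 - x) +i* (w2 - y))%C = (w1 +i* w2)%C - (x +i* y)%C by [].
  by rewrite /al; ring.
move/le_trans; apply; apply: ler_wpM2l; first by rewrite divr_ge0 // ltW.
exact: lerD.
Qed.

End Goursat.
End LeftSums.

(** * Means over circles *)

Section CircleMeans.
Variable R : realType.
Implicit Types (h : R[i] -> R[i]) (s t x y : R).

(** This is [exp (s + i t)]; circles around 0 become vertical segments in the logarithmic
    coordinates [s, t]. *)
Definition cexp s t : R[i] := ((expR s * cos t) +i* (expR s * sin t))%C.

Lemma cexpD s t x y : cexp (s + x) (t + y) = cexp s t * cexp x y.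
Proof.
rewrite /cexp expRD cosD sinD; apply/eqP; rewrite eq_complex /=.
by apply/andP; split; apply/eqP; ring.
Qed.

Lemma rnorm_cexp s t : rnorm (cexp s t) = expR s.
Proof.
apply/eqP; rewrite -(@eqrXn2 _ 2) ?rnorm_ge0 ?expR_ge0 // rnorm_sqr /=.
by rewrite !exprMn -mulrDr cos2Dsin2 mulr1.
Qed.

Lemma cexp_periodic s t : cexp s (t + pi *+ 2) = cexp s t.
Proof. by rewrite /cexp cosD2pi sinD2pi. Qed.

Lemma rnorm_complex_le x y : rnorm (x +i* y)%C <= `|x| + `|y|.
Proof.
have -> : (x +i* y)%C = x%:C%C + 'i%C * y%:C%C by rewrite [LHS]complexE.
by apply: le_trans (rnormD _ _) _; rewrite rnormM rnorm_i mul1r !rnormC.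
Qed.

Lemma cexp_near0 e : 0 < e -> exists2 d, 0 < d & forall x y, `|x| < d -> `|y| < d ->
  rnorm (cexp x y - 1 - (x +i* y)%C) <= e * (`|x| + `|y|).
Proof.
move=> e0.
have ex := is_derive_derivative (is_derive_expR (0 : R)).
have co := is_derive_derivative (is_derive_cos (0 : R)).
have si := is_derive_derivative (is_derive_sin (0 : R)).
(* The error terms below add up to at most [3 c |x| + 6 c |y|]. *)
have [c [c0 c1 ce]] : exists c, [/\ 0 < c, c <= 1 & c <= e / 8].
  by exists (Num.min 1 (e / 8)); rewrite lt_min ltr01 divr_gt0 // !ge_min !lexx orbT.
have [d1 d10 h1] := ex c c0; have [d2 d20 h2] := co c c0; have [d3 d30 h3] := si c c0.
exists (Num.min c (Num.min d1 (Num.min d2 d3))); first by rewrite !lt_min c0 d10 d20.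
move=> x y; rewrite !lt_min => /and4P[xc x1 _ _] /and4P[yc _ y2 y3].
have := h1 x x1; have := h2 y y2; have := h3 y y3.
rewrite !add0r expR0 cos0 sin0 oppr0 mul0r !subr0 !mul1r ?addr0 => sy cy exy.
have -> : cexp x y - 1 - (x +i* y)%C = ((expR x * cos y - 1 - x) +i* (expR x * sin y - y))%C.
  by apply/eqP; rewrite eq_complex /= subr0; apply/andP; split; apply/eqP; ring.
apply: le_trans (rnorm_complex_le _ _) _.
have -> : expR x * cos y - 1 - x = (expR x - 1 - x) + expR x * (cos y - 1) by ring.
have -> : expR x * sin y - y = expR x * (sin y - y) + (expR x - 1) * y by ring.
have e1 : `|expR x - 1| <= 2 * `|x|.
  have -> : expR x - 1 = (expR x - 1 - x) + x by ring.
  by apply: le_trans (ler_normD _ _) _; have := normr_ge0 x; nra.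
have e3 : `|expR x| <= 3.
  have -> : expR x = (expR x - 1) + 1 by ring.
  apply: le_trans (ler_normD _ _) _; rewrite normr1; lra.
have q1 : `|expR x * (cos y - 1)| <= 3 * (c * `|y|).
  by rewrite normrM; apply: ler_pM.
have q2 : `|expR x * (sin y - y)| <= 3 * (c * `|y|).
  by rewrite normrM; apply: ler_pM.
have q3 : `|(expR x - 1) * y| <= 2 * `|x| * c.
  by rewrite normrM; apply: ler_pM => //; exact: ltW.
apply: le_trans (lerD (ler_normD _ _) (ler_normD _ _)) _.
have : c * (`|x| + `|y|) <= e / 8 * (`|x| + `|y|).
  by apply: ler_wpM2r => //; rewrite addr_ge0.
have := normr_ge0 x; have := normr_ge0 y; nra.
Qed.

Lemma cdiff_rnorm h z : cdiff h z -> exists L : R[i], forall e, 0 < e ->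
  exists2 d, 0 < d & forall w, rnorm w < d ->
    rnorm (h (z + w) - h z - L * w) <= e * rnorm w.
Proof.
move=> [L hL]; exists L => e e0; have e0' : 0 < e%:C%C :> R[i] by rewrite ltcR.
have [_ /gt0_real[d d0 ->] dP] := hL _ e0'; exists d => // w wd.
by have := dP w; rewrite !rnormE -rmorphM lecR ltcR; apply.
Qed.

Lemma differentiable2_cexp h s t : cdiff h (cexp s t) ->
  differentiable2 (fun x y => h (cexp x y)) s t.
Proof.
move=> /cdiff_rnorm; set z := cexp s t => -[L hL]; exists (L * z) => e e0.
set a := rnorm z; set l := rnorm L.
have a0 : 0 <= a := rnorm_ge0 z; have l0 : 0 <= l := rnorm_ge0 L.
(* The tolerance [e1] is for the linearization of the exponential and [e2] for that of [h]; each
   contributes half of the final error. *)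
pose e1 := Num.min 1 (e / (2 * (l * a + 1))).
have la1 : 0 < l * a + 1 by rewrite ltr_wpDl ?mulr_ge0.
have a1 : 0 < a + 1 by rewrite ltr_wpDl.
have e10 : 0 < e1 by rewrite lt_min ltr01 divr_gt0 // mulr_gt0.
pose e2 := e / (4 * (a + 1)); have e20 : 0 < e2 by rewrite divr_gt0 // mulr_gt0.
have [d1 d10 h1] := cexp_near0 e10; have [d2 d20 h2] := hL e2 e20.
pose d3 := d2 / (4 * (a + 1)); have d30 : 0 < d3 by rewrite divr_gt0 // mulr_gt0.
exists (Num.min d1 d3); first by rewrite lt_min d10.
move=> x y; rewrite !lt_min => /andP[x1 x3] /andP[y1 y3].
have := h1 _ _ x1 y1; set de := ((x - s) +i* (y - t))%C; set n := `|x - s| + `|y - t|.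
set E := cexp (x - s) (y - t) - 1 => rho.
have n0 : 0 <= n by rewrite addr_ge0.
have e11 : e1 <= 1 by rewrite ge_min lexx.
have E2 : rnorm E <= 2 * n.
  have -> : E = (E - de) + de by rewrite subrK.
  apply: le_trans (rnormD _ _) _; have := rnorm_complex_le (x - s) (y - t).
  rewrite -/de -/n; nra.
have -> : cexp x y = z + z * E.
  by rewrite /E mulrBr mulr1 addrC subrK -cexpD !subrKC.
have zE : rnorm (z * E) <= a * (2 * n) by rewrite rnormM ler_wpM2l.
have nd : n < d2 / (4 * (a + 1)) + d2 / (4 * (a + 1)) by rewrite ltrD.
have zEd : rnorm (z * E) < d2.
  apply: le_lt_trans zE _.
  have : (2 * n) * (a + 1) < d2.
    rewrite -ltr_pdivlMr //; have -> : d2 / (a + 1) = 2 * (d2 / (4 * (a + 1)) + d2 / (4 * (a + 1))).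
      by field; rewrite gt_eqF.
    by rewrite ltr_pM2l.
  by apply: le_lt_trans; nra.
have -> : h (z + z * E) - h z - L * z * de =
    (h (z + z * E) - h z - L * (z * E)) + L * z * (E - de) by ring.
apply: le_trans (rnormD _ _) _; rewrite !rnormM -/l -/a.
have := h2 _ zEd => q1.
have q2 : l * a * rnorm (E - de) <= l * a * (e1 * n) by rewrite ler_wpM2l // mulr_ge0.
have q3 : l * a * e1 <= e / 2.
  have : e1 <= e / (2 * (l * a + 1)) by rewrite ge_min lexx orbT.
  rewrite ler_pdivlMr ?mulr_gt0 //; nra.
have q4 : e2 * rnorm (z * E) <= e2 * (a * (2 * n)) by rewrite ler_wpM2l // ltW.
have q5 : e2 * (4 * (a + 1)) = e by rewrite /e2 divfK // gt_eqF // mulr_gt0.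
have q6 : e2 * a * (2 * n) <= e / 2 * n.
  have : e2 * a * 2 <= e / 2 by lra.
  by nra.
nra.
Qed.

Definition circle_point s n k := cexp s (k%:R * (pi *+ 2 / 2 ^+ n)).

Definition cmean h s n : R[i] :=
  (2 ^+ n)^-1%:C%C * \sum_(k < 2 ^ n) h (circle_point s n k).

Lemma left_sum_cexp h s n :
  left_sum (fun t => h (cexp s t)) 0 (pi *+ 2) n = (pi *+ 2)%:C%C * cmean h s n.
Proof.
rewrite /left_sum -mulr_sumr rmorphM -mulrA; congr (_ * (_ * _)).
by apply: eq_bigr => k _; rewrite add0r.
Qed.

Section Holomorphic.
Variable h : R[i] -> R[i].
Hypothesis dh : forall z, 0 < rnorm z < 1 -> cdiff h z.

(** Goursat's estimate is applied to a square of side [2 pi]: its horizontal sides cancel by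
    periodicity and its vertical sides are two full circles. This is why radii change by the factor
    [expR (2 pi)]. *)
Lemma cmean_step s : s + pi *+ 2 < 0 ->
  rnorm (cmean h (s + pi *+ 2) n - cmean h s n) @[n --> \oo] --> (0 : R).
Proof.
move=> s0; have p0 : 0 < pi *+ 2 :> R by rewrite mulrn_wgt0 // pi_gt0.
apply/cvg0P => [n|e e0]; first exact: rnorm_ge0.
have e1 : 0 < e / 2 / (pi *+ 2) by rewrite !divr_gt0.
have [|M MP] := @goursat R (fun s t => h (cexp s t)) s 0 (pi *+ 2) p0 _ _ e1.
  move=> x y /andP[sx xs] _; apply/differentiable2_cexp/dh.
  by rewrite rnorm_cexp expR_gt0 expR_lt1; lra.
exists M => n /MP; rewrite /boundary_sum.
have -> : left_sum (fun x => h (cexp x 0)) s (pi *+ 2) n -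
    left_sum (fun x => h (cexp x (0 + pi *+ 2))) s (pi *+ 2) n = 0.
  rewrite left_sumB.
  have -> : (fun x => h (cexp x 0) - h (cexp x (0 + pi *+ 2))) = fun=> 0.
    by apply/funext => x; rewrite cexp_periodic subrr.
  by rewrite left_sum_cst mulr0.
rewrite add0r !left_sum_cexp -mulrBr !rnormM rnorm_i mul1r rnormC gtr0_norm //.
have -> : e / 2 / (pi *+ 2) * (pi *+ 2) ^+ 2 = pi *+ 2 * (e / 2).
  by move: (pi *+ 2) p0 => P P0; field; rewrite gt_eqF.
by rewrite ler_pM2l // => /le_lt_trans; apply; lra.
Qed.

(* The means over the circles of radii [expR s] and [expR (s - 2 k pi)] have the
   same limit, and the latter is small when [h] vanishes at 0. *)
Lemma circle_mean_cvg0 s : s < 0 ->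
  (forall e, 0 < e -> exists2 d, 0 < d & forall z, 0 < rnorm z < d -> rnorm (h z) <= e) ->
  rnorm (cmean h s n) @[n --> \oo] --> (0 : R).
Proof.
move=> s0 h0; have p0 : 0 < pi *+ 2 :> R by rewrite mulrn_wgt0 // pi_gt0.
have steps k : rnorm (cmean h s n - cmean h (s - (pi *+ 2) *+ k) n) @[n --> \oo] --> (0 : R).
  elim: k => [|k IH].
    by under eq_fun do rewrite mulr0n subr0 subrr rnorm0; exact: cvg_cst.
  have e : s - (pi *+ 2) *+ k.+1 + pi *+ 2 = s - (pi *+ 2) *+ k.
    by rewrite (mulrS (pi *+ 2)); move: (pi *+ 2 *+ k) => q; lra.
  have : s - (pi *+ 2) *+ k.+1 + pi *+ 2 < 0.
    by rewrite e subr_lt0; apply: lt_le_trans s0 _; rewrite mulrn_wge0 // ltW.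
  move=> /cmean_step; rewrite e => st.
  apply: cvg0_le (_ : rnorm (cmean h s n - cmean h (s - (pi *+ 2) *+ k) n) +
     rnorm (cmean h (s - (pi *+ 2) *+ k) n - cmean h (s - (pi *+ 2) *+ k.+1) n)
     @[n --> \oo] --> (0 : R)).
    move=> n; rewrite rnorm_ge0 /=; apply: le_trans (rnormD _ _).
    by rewrite addrA subrK.
  by rewrite -(addr0 0); exact: cvgD.
apply/cvg0P => [n|e e0]; first exact: rnorm_ge0.
have [d d0 dP] := h0 (e / 2) (divr_gt0 e0 (ltr0Sn _ 1)).
pose k := Num.bound ((s - ln d) / (pi *+ 2)).
have kP : s - (pi *+ 2) *+ k < ln d.
  have [lt|ge] := ltP (s - ln d) 0.
    have : 0 <= (pi *+ 2) *+ k :> R by rewrite mulrn_wge0 // ltW.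
    by lra.
  have := archi_boundP (divr_ge0 ge (ltW p0)); rewrite -/k ltr_pdivrMr //.
  by rewrite -[_ *+ k]mulr_natl; lra.
have small n : rnorm (cmean h (s - (pi *+ 2) *+ k) n) <= e / 2.
  rewrite rnormM rnormC ger0_norm ?invr_ge0 ?exprn_ge0 //.
  rewrite -ler_pdivlMl ?invr_gt0 ?exprn_gt0 // invrK.
  apply: le_trans (rnorm_sum _ _ _) _.
  apply: le_trans (_ : \sum_(i < 2 ^ n) e / 2 <= _).
    apply: ler_sum => i _; apply: dP; rewrite rnorm_cexp expR_gt0 /=.
    by rewrite -(lnK d0) ltr_expR.
  by rewrite sumr_const card_ord -[_ *+ _]mulr_natl natrX.
have [|M MP] := (cvg0P _).1 (steps k) (e / 2) (divr_gt0 e0 (ltr0Sn _ 1)).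
  by move=> n; exact: rnorm_ge0.
exists M => n /MP lt; have := small n.
have := rnormD (cmean h s n - cmean h (s - (pi *+ 2) *+ k) n) (cmean h (s - (pi *+ 2) *+ k) n).
by rewrite subrK; lra.
Qed.

End Holomorphic.
End CircleMeans.

(** * Transfer functions of Schur class *)

Section Parseval.
Variable R : realType.
Implicit Types (h : R[i] -> R[i]) (F : R[i] -> R) (s : R).

Definition rmean F s n : R := (2 ^+ n)^-1 * \sum_(k < 2 ^ n) F (circle_point s n k).

Lemma Re_cmean h s n : complex.Re (cmean h s n) = rmean (fun z => complex.Re (h z)) s n.
Proof. by rewrite /cmean Re_mull_real Re_sum. Qed.

Lemma rmeanD F F' s n : rmean (fun z => F z + F' z) s n = rmean F s n + rmean F' s n.
Proof. by rewrite /rmean big_split mulrDr. Qed.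

Lemma rmeanZ c F s n : rmean (fun z => c * F z) s n = c * rmean F s n.
Proof. by rewrite /rmean -mulr_sumr mulrCA. Qed.

Lemma rmean_cst c s n : rmean (fun=> c) s n = c.
Proof.
rewrite /rmean sumr_const card_ord -[c *+ _]mulr_natl natrX mulKf //.
Qed.

Lemma rmean_le F F' s n : (forall z, rnorm z = expR s -> F z <= F' z) ->
  rmean F s n <= rmean F' s n.
Proof.
move=> FF'; rewrite ler_wpM2l ?invr_ge0 ?exprn_ge0 //.
by apply: ler_sum => k _; apply: FF'; exact: rnorm_cexp.
Qed.

Lemma rmean_eq F F' s n : (forall z, rnorm z = expR s -> F z = F' z) ->
  rmean F s n = rmean F' s n.
Proof. by move=> FF'; apply/eqP; rewrite eq_le !rmean_le // => z /FF' ->. Qed.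

(** The point 0 is excluded because the functions of interest contain negative powers of [z]. *)
Definition linear_at0 h := exists c d : R, [/\ 0 <= c, 0 < d &
  forall z, 0 < rnorm z < d -> rnorm (h z) <= c * rnorm z].

Lemma linear_at0_sum (I : Type) (r : seq I) (P : pred I) (F : I -> R[i] -> R[i]) :
  (forall i, P i -> linear_at0 (F i)) ->
  linear_at0 (fun z => \sum_(i <- r | P i) F i z).
Proof.
move=> hF; elim: r => [|i r [c [d [c0 d0 hc]]]].
  by exists 0, 1; split=> // z _; rewrite big_nil rnorm0 mul0r.
have [Pi|nPi] := boolP (P i); last first.
  by exists c, d; split=> // z; rewrite big_cons (negbTE nPi); exact: hc.
have [c' [d' [c'0 d'0 hc']]] := hF i Pi.
exists (c' + c), (Num.min d' d); split; rewrite ?addr_ge0 ?lt_min ?d0 ?d'0 //.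
move=> z; rewrite lt_min => /and3P[z0 zd' zd]; rewrite big_cons Pi mulrDl.
by apply: le_trans (rnormD _ _) _; apply: lerD; [apply: hc'|apply: hc]; rewrite z0.
Qed.

Lemma linear_at0_monomial (c : R[i]) n : linear_at0 (fun z => c * z ^+ n.+1).
Proof.
exists (rnorm c), 1; split; rewrite ?rnorm_ge0 // => z /andP[z0 z1].
rewrite rnormM rnormX ler_wpM2l ?rnorm_ge0 // exprS ler_piMr ?rnorm_ge0 //.
by rewrite exprn_ile1 ?rnorm_ge0 // ltW.
Qed.

Lemma cmean_cvg0 h s : s < 0 -> (forall z, 0 < rnorm z < 1 -> cdiff h z) ->
  linear_at0 h -> complex.Re (cmean h s n) @[n --> \oo] --> (0 : R).
Proof.
move=> s0 dh [c [d [c0 d0 hc]]].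
have : rnorm (cmean h s n) @[n --> \oo] --> (0 : R).
  apply: circle_mean_cvg0 => // e e0; have c1 : 0 < c + 1 by rewrite ltr_wpDl.
  exists (Num.min d (e / (c + 1))); first by rewrite lt_min d0 divr_gt0.
  move=> z; rewrite lt_min => /and3P[z0 zd]; rewrite ltr_pdivlMr // => ze.
  apply: le_trans (hc z _) _; first by rewrite z0.
  by apply: le_trans (ltW ze); rewrite mulrC ler_wpM2l ?rnorm_ge0 // lerDl.
move=> h0; apply: norm_cvg0.
by apply: cvg0_le h0 => n; rewrite normr_ge0 Re_le_rnorm.
Qed.

Lemma circle_conj (z : R[i]) (r : R) n : rnorm z = r ->
  (z ^+ n)^*%C * z ^+ n = (r ^+ (2 * n))%:C%C.
Proof.
move=> <-; rewrite mulrC -sqr_normc normrX rnormE -exprM -rmorphXn mulnC //.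
Qed.

(** On the circle of radius [r] the product of [z^N] and the conjugate of [z^l] is
    [r^(2 l) z^(N - l)]. The cross terms of the new coefficient thus form a polynomial vanishing at
    0, whose means tend to 0. *)
Lemma parseval (V : hilbertType R) (u : nat -> V) N s : s < 0 ->
  rmean (fun z => rnorm (\sum_(k < N) z ^+ k *: u k) ^+ 2) s n @[n --> \oo] -->
  \sum_(k < N) expR s ^+ (2 * k) * rnorm (u k) ^+ 2.
Proof.
move=> s0; elim: N => [|N IH].
  rewrite big_ord0; have -> : rmean (fun z => rnorm (\sum_(k < 0) z ^+ k *: u k) ^+ 2) s = fun=> 0.
    apply/funext => n; rewrite -[RHS](rmean_cst 0 s n); apply: rmean_eq => z _.
    by rewrite big_ord0 rnorm0 expr0n.
  exact: cvg_cst.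
pose h (z : R[i]) := \sum_(l < N)
  (* The exponent is [N - l], written as a successor to exhibit a positive degree. *)
  ((expR s ^+ (2 * l))%:C%C * inner (u N) (u l)) * z ^+ (N - l.+1).+1.
have dh z : 0 < rnorm z < 1 -> cdiff h z.
  move=> _; apply: cdiff_sum => l _; apply: cdiffM; first exact: cdiff_cst.
  exact: cdiffX (cdiff_id z).
have h0 : linear_at0 h.
  by apply: linear_at0_sum => l _; exact: linear_at0_monomial.
have e n : rmean (fun z => rnorm (\sum_(k < N.+1) z ^+ k *: u k) ^+ 2) s n =
    rmean (fun z => rnorm (\sum_(k < N) z ^+ k *: u k) ^+ 2) s n +
    2 * complex.Re (cmean h s n) + expR s ^+ (2 * N) * rnorm (u N) ^+ 2.
  rewrite Re_cmean -rmeanZ -[X in _ + X](rmean_cst _ s n) -!rmeanD.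
  apply: rmean_eq => z zs; rewrite big_ord_recr /= rnormD_sqr rnormZ rnormX zs.
  rewrite exprMn -exprM mulnC; congr (_ + 2 * _ + _).
  rewrite rdot_suml /h Re_sum; apply: eq_bigr => l _.
  rewrite rdotC /rdot innerZl innerZr mulrA mulrAC mulrC -(circle_conj l zs).
  have zN : z ^+ N = z ^+ l * z ^+ (N - l).
    by rewrite -exprD subnKC // ltnW.
  by congr (complex.Re _); rewrite subnSK // zN; ring.
have lim : rmean (fun z => rnorm (\sum_(k < N) z ^+ k *: u k) ^+ 2) s n +
    2 * complex.Re (cmean h s n) + expR s ^+ (2 * N) * rnorm (u N) ^+ 2 @[n --> \oo] -->
    \sum_(k < N) expR s ^+ (2 * k) * rnorm (u k) ^+ 2 + 2 * 0 +
    expR s ^+ (2 * N) * rnorm (u N) ^+ 2.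
  apply: cvgD; last exact: cvg_cst.
  by apply: cvgD; [exact: IH|apply: cvgMr; exact: (cmean_cvg0 s0 dh h0)].
rewrite mulr0 addr0 in lim; rewrite big_ord_recr /=.
by under eq_fun do rewrite e.
Qed.

End Parseval.

(** * Contractivity of the input-output map *)

Section Toeplitz.
Variables (R : realType) (X U Y : hilbertType R) (Sigma : system X U Y).
Local Notation A := (sysA Sigma).
Local Notation B := (sysB Sigma).
Local Notation C := (sysC Sigma).
Local Notation D := (sysD Sigma).

Fixpoint trajectory (x : X) (u : nat -> U) n : X :=
  if n is m.+1 then A (trajectory x u m) + B (u m) else x.

Definition output x u n : Y := C (trajectory x u n) + D (u n).

Variable th : R[i] -> {linear U -> Y}.
Hypotheses (schur : schur_class th) (coinc : transfer_coincides_near0 Sigma th).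

Lemma cdiff_schur v y z : rnorm z < 1 -> cdiff (fun w => inner (th w v) y) z.
Proof.
move=> z1; have [|_ [L _ hL]] := schur (z := z); first by rewrite (rnorm_lt z 1).
exists (inner (L v) y) => _ /gt0_real[e e0 ->].
have m0 : 0 < rnorm v * rnorm y + 1 by rewrite ltr_wpDl ?mulr_ge0 ?rnorm_ge0.
have e0' : 0 < (e / (rnorm v * rnorm y + 1))%:C%C :> R[i] by rewrite ltcR divr_gt0.
have [d d0 dP] := hL _ e0'; exists d => // w /dP /(_ v).
rewrite !rnormE -!rmorphM !lecR => le.
have -> : inner (th (z + w) v) y - inner (th z v) y - inner (L v) y * w =
    inner (th (z + w) v - th z v - w *: L v) y.
  by rewrite !innerBl innerZl (mulrC w).
apply: le_trans (rnorm_inner_le _ _) _.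
apply: le_trans (ler_wpM2r (rnorm_ge0 y) le) _.
rewrite -!mulrA; have := rnorm_ge0 w; have := rnorm_ge0 v; have := rnorm_ge0 y.
set a := rnorm v in m0 *; set b := rnorm y in m0 *; set c := rnorm w => b0 a0 c0.
have -> : e * ((a * b + 1)^-1 * (c * (a * b))) = e * c * (a * b / (a * b + 1)) by ring.
rewrite ler_piMr ?mulr_ge0 ?(ltW e0) //.
by rewrite ler_pdivrMr // mul1r lerDl.
Qed.

(** The state recursion telescopes: [err], the difference between [z xi] and the polynomial of the
    states, solves [(1 - z A) err = z^N x_N], where [x_N] is the state at time [N]. *)
Lemma transfer_expansion (u : nat -> U) N : exists K d : R, [/\ 0 <= K, 0 < d &
  forall z, rnorm z < d -> rnorm (th z (\sum_(k < N) z ^+ k *: u k) -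
    \sum_(k < N) z ^+ k *: output 0 u k) <= K * rnorm z ^+ N].
Proof.
have [_ /gt0_real[rho rho0 ->] hth] := coinc.
have [MA MA0 hA] := (bounded_opP _).1 (sysA_bounded Sigma).
have [MC MC0 hC] := (bounded_opP _).1 (sysC_bounded Sigma).
have m0 : 0 < 2 * (MA + 1) by rewrite mulr_gt0 // ltr_wpDl.
(* Below the second radius [|z A err|] is at most half of [|err|], which produces the factor 2 in
   the constant. *)
exists (MC * (2 * rnorm (trajectory 0 u N))), (Num.min rho (2 * (MA + 1))^-1).
split; first by rewrite !mulr_ge0 ?rnorm_ge0.
  by rewrite lt_min rho0 invr_gt0.
move=> z; rewrite lt_min => /andP[zr zA].
have [|[g [gK Kg] _] thz] := hth z; first by rewrite rnorm_lt.
set v := \sum_(k < N) z ^+ k *: u k; set w := \sum_(k < N) _.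
rewrite -thz /transfer; set xi := app _ _.
have xiP : pencil Sigma z xi = B v.
  rewrite /xi /app; case: xgetP => [y _|/(_ (g (B v)))[]].
    by rewrite /op_inv /graph /= => ->.
  by rewrite /op_inv /graph /= Kg.
pose sx := \sum_(k < N) z ^+ k *: trajectory 0 u k.
pose err := z *: xi - sx.
have e1 : D v + z *: C xi - w = C err.
  have wE : w = C sx + D v.
    rewrite /w /sx /v !linear_sum -big_split; apply: eq_bigr => k _.
    by rewrite !linearZ /= -scalerDr.
  by rewrite /err linearB linearZ /= wE opprD (addrC (- C sx)) addrACA subrr add0r.
have e2 : err - z *: A err = z ^+ N *: trajectory 0 u N.
  have tele : z *: A sx + z *: B v = sx + z ^+ N *: trajectory 0 u N.
    rewrite /sx /v !linear_sum -big_split /=.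
    have -> : \sum_(k < N) z ^+ k *: trajectory 0 u k + z ^+ N *: trajectory 0 u N =
        \sum_(k < N.+1) z ^+ k *: trajectory 0 u k by rewrite big_ord_recr.
    rewrite big_ord_recl /= scaler0 add0r; apply: eq_bigr => k _.
    by rewrite !linearZ /= -scalerDr -scalerDr scalerA /bump leq0n add1n exprSr.
  have zx : z *: xi - z *: A (z *: xi) = z *: B v.
    by rewrite -xiP /pencil scalerBr (linZ (linearP A)).
  rewrite /err (linB (linearP A)) scalerBr.
  have -> : z *: xi - sx - (z *: A (z *: xi) - z *: A sx) =
      (z *: xi - z *: A (z *: xi)) + z *: A sx - sx.
    by apply: rdot_eqP => q; rewrite !(rdotBl, rdotDl); ring.
  by rewrite zx (addrC (z *: B v)) tele (addrC sx) addrK.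
rewrite e1; apply: le_trans (hC _) _; rewrite -mulrA ler_wpM2l //.
have := rnormD (err - z *: A err) (z *: A err); rewrite subrK e2 !rnormZ rnormX.
have : rnorm z * rnorm (A err) <= 2^-1 * rnorm err.
  apply: le_trans (_ : rnorm z * (MA * rnorm err) <= _).
    by rewrite ler_wpM2l ?rnorm_ge0.
  rewrite mulrA ler_wpM2r ?rnorm_ge0 //.
  have : rnorm z * (2 * (MA + 1)) <= 1 by rewrite -ler_pdivlMr // mul1r ltW.
  have := rnorm_ge0 z; lra.
lra.
Qed.

(** On the circle, [h] equals [<th u - b, b>], the conjugate of [z^j] being [r^(2 j) z^-j]. Its
    means tend to 0, so asymptotically the mean of [|b|^2] is that of [Re <th u, b>], which is at
    most half the mean of [|u|^2 + |b|^2]. *)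
Lemma toeplitz_contraction_circle (u : nat -> U) N s : s < 0 ->
  \sum_(k < N) expR s ^+ (2 * k) * rnorm (output 0 u k) ^+ 2 <=
  \sum_(k < N) expR s ^+ (2 * k) * rnorm (u k) ^+ 2.
Proof.
move=> s0; set b := output 0 u.
pose uz (z : R[i]) := \sum_(k < N) z ^+ k *: u k.
pose bz (z : R[i]) := \sum_(k < N) z ^+ k *: b k.
pose h (z : R[i]) := \sum_(j < N) ((expR s ^+ (2 * j))%:C%C * (z ^+ j)^-1) *
  inner (th z (uz z) - bz z) (b j).
have innerE z j : inner (th z (uz z) - bz z) (b j) =
    \sum_(k < N) z ^+ k * (inner (th z (u k)) (b j) - inner (b k) (b j)).
  rewrite innerBl /uz linear_sum /bz.
  have isum (F : 'I_N -> Y) : inner (\sum_(k < N) F k) (b j) = \sum_(k < N) inner (F k) (b j).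
    by elim/big_rec2: _ => [|i x y _ <-]; rewrite ?inner0l ?innerDl.
  rewrite !isum -sumrB; apply: eq_bigr => k _.
  by rewrite linearZ /= !innerZl mulrBr.
have dh z : 0 < rnorm z < 1 -> cdiff h z.
  move=> /andP[z0 z1]; apply: cdiff_sum => j _.
  have zn0 : z != 0 by apply: contraTneq z0 => ->; rewrite rnorm0 ltxx.
  apply: cdiffM.
    apply: cdiffM; first exact: cdiff_cst.
    have -> : (fun x : R[i] => (x ^+ j)^-1) = (fun x => x^-1 ^+ j).
      by apply/funext => x; rewrite exprVn.
    by apply: cdiffX; exact: cdiffV.
  have -> : (fun x => inner (th x (uz x) - bz x) (b j)) = (fun x => 
    \sum_(k < N) x ^+ k * (inner (th x (u k)) (b j) - inner (b k) (b j))).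
    by apply/funext => x.
  apply: cdiff_sum => k _; apply: cdiffM; first exact: cdiffX (cdiff_id z).
  by apply: cdiffD; [exact: cdiff_schur|exact: cdiff_cst].
(* The factor [z^-j] with [j < N] leaves at least one power of the zero of order [N]. *)
have h0 : linear_at0 h.
  have [K [d [K0 d0 hK]]] := transfer_expansion u N.
  apply: linear_at0_sum => j _.
  exists (expR s ^+ (2 * j) * (K * rnorm (b j))), (Num.min 1 d).
  split; rewrite ?mulr_ge0 ?exprn_ge0 ?expR_ge0 ?rnorm_ge0 ?lt_min ?ltr01 //.
  move=> z; rewrite lt_min => /and3P[z0 z1 zd].
  rewrite !rnormM rnormC ger0_norm ?exprn_ge0 ?expR_ge0 // -!mulrA.
  rewrite ler_wpM2l ?exprn_ge0 ?expR_ge0 //.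
  have -> : rnorm (z ^+ j)^-1 = (rnorm z ^+ j)^-1.
    by rewrite -rnormX; apply: complexI; rewrite -rnormE normfV rnormE fmorphV.
  rewrite -ler_pdivlMl ?invr_gt0 ?exprn_gt0 // invrK.
  apply: le_trans (rnorm_inner_le _ _) _.
  apply: le_trans (ler_wpM2r (rnorm_ge0 _) (hK z zd)) _.
  rewrite mulrAC -!mulrA (mulrCA (rnorm z ^+ j)) ler_wpM2l // (mulrC (rnorm (b j))).
  rewrite mulrCA [leLHS]mulrC ler_wpM2l ?rnorm_ge0 //.
  rewrite -exprSr ler_wiXn2l ?rnorm_ge0 ?(ltW z1) //.
have lim_u := @parseval R U u N s s0; have lim_b := @parseval R Y b N s s0.
have lim_h := cmean_cvg0 s0 dh h0.
have le n : rmean (fun z => rnorm (bz z) ^+ 2) s n <=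
    rmean (fun z => rnorm (uz z) ^+ 2) s n - 2 * complex.Re (cmean h s n).
  rewrite -mulNr Re_cmean -rmeanZ -rmeanD; apply: rmean_le => z zs.
  have z1 : rnorm z < 1 by rewrite zs expR_lt1.
  have z0 : z != 0.
    by apply: contraTneq (expR_gt0 s) => z0; rewrite -zs z0 rnorm0 ltxx.
  have -> : h z = inner (th z (uz z) - bz z) (bz z).
    rewrite /h /bz; set q := _ - \sum_(k < N) _.
    have isum (F : 'I_N -> Y) : inner q (\sum_(k < N) F k) = \sum_(k < N) inner q (F k).
      by elim/big_rec2: _ => [|i x y _ <-]; rewrite ?inner0r ?innerDr.
    rewrite isum; apply: eq_bigr => j _; rewrite innerZr -(circle_conj j zs).
    by rewrite mulfK // expf_neq0.
  rewrite -/(rdot _ _) rdotBl rdotxx.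
  have : rnorm (th z (uz z)) <= rnorm (uz z).
    by have [|le _] := schur (z := z); [rewrite rnorm_lt|rewrite -lecR -!rnormE].
  have := rdot_le (th z (uz z)) (bz z).
  have := rnorm_ge0 (th z (uz z)); have := rnorm_ge0 (bz z).
  set a := rnorm (bz z); set c := rnorm (th z _) => a0 c0 ac cu.
  have : 2 * (c * a) <= c ^+ 2 + a ^+ 2 by have := sqr_ge0 (c - a); lra.
  have : c ^+ 2 <= rnorm (uz z) ^+ 2 by rewrite lerXn2r ?nnegrE ?rnorm_ge0.
  lra.
have lim : rmean (fun z => rnorm (uz z) ^+ 2) s n - 2 * complex.Re (cmean h s n)
    @[n --> \oo] --> \sum_(k < N) expR s ^+ (2 * k) * rnorm (u k) ^+ 2 - 2 * 0.
  by apply: cvgB; [exact: lim_u|apply: cvgMr; exact: lim_h].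
rewrite mulr0 subr0 in lim.
by apply: (ler_cvg_to lim_b lim); near=> n; exact: le.
Unshelve. all: by end_near. Qed.

Lemma toeplitz_contraction (u : nat -> U) N :
  \sum_(k < N) rnorm (output 0 u k) ^+ 2 <= \sum_(k < N) rnorm (u k) ^+ 2.
Proof.
set b := \sum_(k < N) rnorm (output 0 u k) ^+ 2; set a := \sum_(k < N) _.
have b0 : 0 <= b by apply: sumr_ge0 => k _; rewrite exprn_ge0 ?rnorm_ge0.
have a0 : 0 <= a by apply: sumr_ge0 => k _; rewrite exprn_ge0 ?rnorm_ge0.
have le s : s < 0 -> expR (s * (2 * N)%:R) * b <= a.
  move=> s0; have := toeplitz_contraction_circle u N s0 => le.
  apply: le_trans (_ : _ <= \sum_(k < N) expR s ^+ (2 * k) * rnorm (output 0 u k) ^+ 2) _.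
    rewrite mulr_sumr; apply: ler_sum => k _; rewrite ler_wpM2r ?sqr_ge0 //.
    rewrite expRM_natr ler_wiXn2l ?expR_ge0 ?expR_le1 ?(ltW s0) //.
    by rewrite leq_mul2l ltnW.
  apply: le_trans le _; apply: ler_sum => k _; rewrite ler_piMl ?sqr_ge0 //.
  by rewrite exprn_ile1 ?expR_ge0 // expR_le1 ltW.
apply/ler_addgt0Pr => e e0.
have m0 : 0 < (2 * N)%:R * b + 1 by rewrite ltr_wpDl ?mulr_ge0.
(* All weights on the left are at least [expR (2 N s) >= 1 + 2 N s]; this [s] makes the loss
   [- 2 N s b] at most [e]. *)
have s0 : - (e / ((2 * N)%:R * b + 1)) < 0 by rewrite oppr_lt0 divr_gt0.
have := le _ s0; set s := - _ in s0 *.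
have := expR_ge1Dx (s * (2 * N)%:R) => ge le1.
have h1 : (1 + s * (2 * N)%:R) * b <= a.
  by apply: le_trans le1; rewrite ler_wpM2r.
have : - (s * (2 * N)%:R * b) <= e.
  rewrite /s !mulNr opprK -mulrA mulrAC ler_pdivrMr // ler_wpM2l ?(ltW e0) //.
  by rewrite lerDl.
lra.
Qed.

End Toeplitz.

(** * The available storage *)

Section LinSpan.
Variables (R : realType) (V : hilbertType R) (W : set V).

Lemma lin_span_gen x : W x -> lin_span W x.
Proof.
move=> Wx; exists 1%N, (fun=> 1), (fun=> x); split=> //.
by rewrite big_ord1 scale1r.
Qed.

Lemma lin_span_subspace : lin_subspace (lin_span W).
Proof.
split=> [|_ _ [n [c [v [Wv ->]]]] [m [d [w [Ww ->]]]]|a _ [n [c [v [Wv ->]]]]].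
- by exists 0%N, (fun=> 0), (fun=> 0); split=> [[]//|]; rewrite big_ord0.
- exists (n + m)%N, (fun i => match fintype.split i with inl j => c j | inr j => d j end),
    (fun i => match fintype.split i with inl j => v j | inr j => w j end).
  split=> [i|]; first by case: (fintype.split i).
  rewrite big_split_ord; congr (_ + _); apply: eq_bigr => i _.
    by rewrite -[lshift _ _]/(unsplit (inl i)) unsplitK.
  by rewrite -[rshift _ _]/(unsplit (inr i)) unsplitK.
- exists n, (fun i => a * c i), v; split=> //.
  by rewrite scaler_sumr; apply: eq_bigr => i _; rewrite scalerA.
Qed.

Lemma lin_span_min (D : set V) : lin_subspace D -> W `<=` D -> lin_span W `<=` D.
Proof.
move=> sD WD _ [n [c [v [Wv ->]]]]; apply: subspace_sum => // i.
by apply: subspaceZ => //; exact: WD.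
Qed.

End LinSpan.

Lemma linear_preim_subspace (R : realType) (V W : hilbertType R) (f : V -> W) (D : set W) :
  linear f -> lin_subspace D -> lin_subspace (f @^-1` D).
Proof.
move=> lf sD; split=> [|x y Dx Dy|c x Dx]; rewrite /preimage /=.
- by rewrite (lin0 lf); exact: subspace0.
- by rewrite (linD lf); exact: subspaceD.
- by rewrite (linZ lf); exact: subspaceZ.
Qed.

Section Storage.
Variables (R : realType) (X U Y : hilbertType R) (Sigma : system X U Y).
Local Notation A := (sysA Sigma).
Local Notation B := (sysB Sigma).
Local Notation C := (sysC Sigma).
Local Notation D := (sysD Sigma).
Local Notation traj := (trajectory Sigma).
Local Notation out := (output Sigma).
Implicit Types (x y : X) (u v w : nat -> U).

Lemma traj_linear c x y u v n :
  traj (c *: x + y) (fun k => c *: u k + v k) n = c *: traj x u n + traj y v n.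
Proof.
elim: n => //= n ->; rewrite !linearP scalerDr !addrA; congr (_ + _).
by rewrite addrAC.
Qed.

Lemma out_linear c x y u v n :
  out (c *: x + y) (fun k => c *: u k + v k) n = c *: out x u n + out y v n.
Proof.
by rewrite /output traj_linear !linearP scalerDr !addrA; congr (_ + _); rewrite addrAC.
Qed.

Lemma traj_eq x u v n : (forall k, (k < n)%N -> u k = v k) -> traj x u n = traj x v n.
Proof.
elim: n => //= n IH uv; rewrite uv // IH // => k kn; apply: uv.
exact: ltnW.
Qed.

Lemma out_eq x u v n : (forall k, (k <= n)%N -> u k = v k) -> out x u n = out x v n.
Proof.
move=> uv; rewrite /output uv // (@traj_eq x u v n) // => k kn.
by apply: uv; exact: ltnW.
Qed.

Lemma traj_shift x u n : traj x u n.+1 = traj (A x + B (u 0)) (u \o S) n.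
Proof. by elim: n => //= n <-. Qed.

Lemma out_shift x u n : out x u n.+1 = out (A x + B (u 0)) (u \o S) n.
Proof. by rewrite /output traj_shift. Qed.

Definition concat m u v k := if (k < m)%N then u k else v (k - m)%N.

Lemma traj_concat x m u v n : traj x (concat m u v) (m + n) = traj (traj x u m) v n.
Proof.
elim: n => [|n IH].
  by rewrite addn0 /=; apply: traj_eq => k km; rewrite /concat km.
by rewrite addnS /= IH /concat ltnNge leq_addr /= addKn.
Qed.

Lemma out_concat x m u v n : out x (concat m u v) (m + n) = out (traj x u m) v n.
Proof. by rewrite /output traj_concat /concat ltnNge leq_addr /= addKn. Qed.

Definition gain x u N : R := \sum_(k < N) (rnorm (out x u k) ^+ 2 - rnorm (u k) ^+ 2).

Lemma gain0 x u : gain x u 0 = 0.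
Proof. by rewrite /gain big_ord0. Qed.

Lemma gain_recr x u N : gain x u N.+1 =
  gain x u N + (rnorm (out x u N) ^+ 2 - rnorm (u N) ^+ 2).
Proof. by rewrite /gain big_ord_recr. Qed.

Lemma gain_recl x u N : gain x u N.+1 =
  rnorm (C x + D (u 0)) ^+ 2 - rnorm (u 0) ^+ 2 + gain (A x + B (u 0)) (u \o S) N.
Proof.
rewrite /gain big_ord_recl; congr (_ + _); apply: eq_bigr => k _.
by rewrite lift0 out_shift.
Qed.

Lemma gain_concat x m u v n :
  gain x (concat m u v) (m + n) = gain x u m + gain (traj x u m) v n.
Proof.
rewrite /gain big_split_ord; congr (_ + _); apply: eq_bigr => k _ /=.
  rewrite /concat ltn_ord (@out_eq x _ u) // => j jk.
  by rewrite (leq_ltn_trans jk).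
by rewrite out_concat /concat ltnNge leq_addr /= addKn.
Qed.

Lemma gain_zero_ge0 x N : 0 <= gain x (fun=> 0) N.
Proof.
by apply: sumr_ge0 => k _; rewrite rnorm0 expr0n subr0 exprn_ge0 ?rnorm_ge0.
Qed.

(** Zero inputs cost nothing, so near-optimal inputs of two states can be given a common length. *)
Lemma gain_pad x u N M : (N <= M)%N -> gain x u N <= gain x (concat N u (fun=> 0)) M.
Proof. by move=> /subnKC <-; rewrite gain_concat lerDl gain_zero_ge0. Qed.

Lemma gain_parallelogram x y u v N :
  gain (x + y) (fun k => u k + v k) N + gain (x - y) (fun k => u k - v k) N =
  2 * gain x u N + 2 * gain y v N.
Proof.
rewrite /gain !mulr_sumr -!big_split /=; apply: eq_bigr => k _.
have := out_linear 1 x y u v k; have := out_linear (-1) y x v u k.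
rewrite !scale1r !scaleN1r.
have -> : (fun k => 1 *: u k + v k) = (fun k => u k + v k).
  by apply/funext => j; rewrite scale1r.
have -> : (fun k => -1 *: v k + u k) = (fun k => u k - v k).
  by apply/funext => j; rewrite scaleN1r addrC.
rewrite (addrC (- y)) (addrC (- out y v k)) => -> ->.
have := parallelogram (out x u k) (out y v k); have := parallelogram (u k) (v k).
lra.
Qed.

Lemma gainZ c x u N : gain (c *: x) (fun k => c *: u k) N = rnorm c ^+ 2 * gain x u N.
Proof.
rewrite /gain mulr_sumr; apply: eq_bigr => k _.
have := out_linear c x 0 u (fun=> 0) k; rewrite addr0.
have -> : (fun k => c *: u k + 0) = (fun k => c *: u k).
  by apply/funext => j; rewrite addr0.
have -> : out 0 (fun=> 0) k = 0.
  rewrite /output linear0 addr0; have -> : traj 0 (fun=> 0) k = 0; last exact: linear0.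
  by elim: (nat_of_ord k) => //= n ->; rewrite !linear0 addr0.
by rewrite addr0 => ->; rewrite !rnormZ !exprMn; ring.
Qed.

Lemma gain_rcvg (x : nat -> X) l u N : rcvg x l ->
  gain (x n) u N @[n --> \oo] --> gain l u N.
Proof.
move=> xl; have tr k : rcvg (fun n => traj (x n) u k) (traj l u k).
  elim: k => //= k IH; apply: rcvgD; last exact: rcvg_cst.
  exact: (rcvg_lin (linearP A) (sysA_bounded Sigma) IH).
rewrite /gain; elim: N => [|N IH].
  by rewrite big_ord0; under eq_fun do rewrite big_ord0; exact: cvg_cst.
rewrite big_ord_recr /=; under eq_fun do rewrite big_ord_recr /=.
apply: cvgD => //; apply: cvgB; last exact: cvg_cst.
apply/cvg_sqr/rcvg_rnorm; apply: rcvgD; last exact: rcvg_cst.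
exact: (rcvg_lin (linearP C) (sysC_bounded Sigma) (tr N)).
Qed.

Definition finite_storage : set X := [set x | exists M, forall u N, gain x u N <= M].

Definition gains x : set R := [set gain x p.1 p.2 | p in [set: (nat -> U) * nat]].

Definition storage x : R := sup (gains x).

Lemma gains_has_sup x : finite_storage x -> has_sup (gains x).
Proof.
move=> [M xM]; split; last by exists M => _ [[u N] _ <-]; exact: xM.
by exists (gain x (fun=> 0) 0), (fun=> 0, 0%N).
Qed.

Lemma gain_le x u N : finite_storage x -> gain x u N <= storage x.
Proof.
move=> /gains_has_sup[_ ub]; apply: ub_le_sup => //.
by exists (u, N).
Qed.

Lemma storage_le x M : (forall u N, gain x u N <= M) -> storage x <= M.
Proof.
move=> xM; apply: ge_sup; first by exists (gain x (fun=> 0) 0), (fun=> 0, 0%N).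
by move=> _ [[u N] _ <-]; exact: xM.
Qed.

Lemma storage_adherent x e : finite_storage x -> 0 < e ->
  exists u N, storage x - e < gain x u N.
Proof.
move=> /gains_has_sup sx e0.
by have [_ [[u N] _ <-]] := sup_adherent e0 sx; exists u, N.
Qed.

Lemma storage_ge0 x : finite_storage x -> 0 <= storage x.
Proof. by move=> /(gain_le (fun=> 0) 0); rewrite gain0. Qed.

Lemma storage_lsc (x : nat -> X) l M : rcvg x l ->
  (forall n, finite_storage (x n) /\ storage (x n) <= M) ->
  finite_storage l /\ storage l <= M.
Proof.
move=> xl xM; have lM u N : gain l u N <= M.
  have h := @gain_rcvg x l u N xl; apply: (cvgr_to_le h); near=> n.
  by have [fx] := xM n; apply: le_trans; exact: gain_le.
by split; [exists M|exact: storage_le].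
Unshelve. all: by end_near. Qed.

Lemma storage_dissipation x (u : U) : finite_storage x ->
  finite_storage (A x + B u) /\
  storage (A x + B u) + rnorm (C x + D u) ^+ 2 - rnorm u ^+ 2 <= storage x.
Proof.
move=> fx; have le v N : gain (A x + B u) v N <=
    storage x - rnorm (C x + D u) ^+ 2 + rnorm u ^+ 2.
  have := gain_le (fun k => if k is j.+1 then v j else u) N.+1 fx.
  by rewrite gain_recl /=; lra.
split; first by eexists; exact: le.
by have := storage_le le; lra.
Qed.

Lemma storage_bellman x e : finite_storage x -> 0 < e ->
  exists u : U, storage x <= storage (A x + B u) + rnorm (C x + D u) ^+ 2 - rnorm u ^+ 2 + e.
Proof.
move=> fx e0; have [u [[|N] xu]] := storage_adherent fx e0.
  (* A near-optimal input of length 0 means [storage x < e], and the zero input then suffices. *)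
  exists 0; rewrite gain0 in xu; rewrite rnorm0 expr0n subr0.
  have [/storage_ge0 f _] := storage_dissipation 0 fx.
  by have := sqr_ge0 (rnorm (C x + D 0)); lra.
exists (u 0%N); have [f _] := storage_dissipation (u 0%N) fx.
by have := gain_le (u \o S) N f; rewrite gain_recl in xu; lra.
Qed.

Hypothesis contractive : forall u N,
  \sum_(k < N) rnorm (out 0 u k) ^+ 2 <= \sum_(k < N) rnorm (u k) ^+ 2.

Lemma gain_from0 u N : gain 0 u N <= 0.
Proof. by rewrite /gain sumrB subr_le0 contractive. Qed.

(** Steering from 0 to the state and then applying [v] is one input from 0, whose total gain is
    nonpositive. *)
Lemma finite_storage_reachable u M : finite_storage (traj 0 u M).
Proof.
exists (- gain 0 u M) => v N.
by have := gain_from0 (concat M u v) (M + N); rewrite gain_concat; lra.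
Qed.

Lemma storage0 : storage 0 = 0.
Proof.
have f0 : finite_storage 0 := finite_storage_reachable (fun=> 0) 0.
by apply/eqP; rewrite eq_le storage_ge0 // storage_le // => u N; exact: gain_from0.
Qed.

Lemma storageZ_le c x : finite_storage x -> c != 0 ->
  forall u N, gain (c *: x) u N <= rnorm c ^+ 2 * storage x.
Proof.
move=> fx c0 u N; have := gainZ c x (fun k => c^-1 *: u k) N.
have -> : (fun k => c *: (c^-1 *: u k)) = u.
  by apply/funext => k; rewrite scalerA divff // scale1r.
by move=> ->; rewrite ler_wpM2l ?sqr_ge0 // gain_le.
Qed.

Lemma storageZ c x : finite_storage x ->
  finite_storage (c *: x) /\ storage (c *: x) = rnorm c ^+ 2 * storage x.
Proof.
have [-> _|c0 fx] := eqVneq c 0.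
  rewrite scale0r storage0 rnorm0 expr0n mul0r; split=> //.
  exact: (finite_storage_reachable (fun=> 0) 0).
have fcx : finite_storage (c *: x) by eexists; exact: (storageZ_le fx c0).
split=> //; apply/eqP; rewrite eq_le (storage_le (storageZ_le fx c0)) /=.
have := storage_le (storageZ_le fcx (_ : c^-1 != 0)).
rewrite scalerA mulVf // scale1r invr_eq0 => /(_ c0) le.
have cc : rnorm c * rnorm c^-1 = 1 by rewrite -rnormM divff // rnorm1.
have n0 : rnorm c != 0 by apply: contra_neq c0 => /rnorm_eq0.
rewrite -ler_pdivlMl; last by rewrite exprn_gt0 // lt_def rnorm_ge0 n0.
apply: le_trans le _; rewrite ler_wpM2r ?storage_ge0 //.
have c1 : rnorm c^-1 = (rnorm c)^-1.
  by apply: (mulfI n0); rewrite cc divff.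
by rewrite c1 exprVn.
Qed.

Lemma finite_storageD x y : finite_storage x -> finite_storage y -> finite_storage (x + y).
Proof.
move=> fx fy; exists (2 * storage x + 2 * storage y) => u N.
(* The same half input at both states adds up to [u] at [x + y] and cancels at [x - y]. *)
pose v k := (2^-1)%:C%C *: u k.
have := gain_parallelogram x y v v N.
have h : 2^-1 + 2^-1 = 1 :> R by field.
have -> : (fun k => v k + v k) = u.
  by apply/funext => k; rewrite -scalerDl -rmorphD /= h rmorph1 scale1r.
have -> : (fun k => v k - v k) = (fun=> 0) by apply/funext => k; rewrite subrr.
by have := gain_zero_ge0 (x - y) N; have := gain_le v N fx; have := gain_le v N fy; lra.
Qed.

Lemma finite_storage_subspace : lin_subspace finite_storage.
Proof.
split=> [|x y|c x fx]; last by case: (storageZ c fx).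
- exact: (finite_storage_reachable (fun=> 0) 0).
- exact: finite_storageD.
Qed.

(** Near-optimal inputs at the two states give one inequality; the other is the same inequality for
    [x + y] and [x - y], by homogeneity. *)
Lemma storage_parallelogram x y : finite_storage x -> finite_storage y ->
  storage (x + y) + storage (x - y) = 2 * storage x + 2 * storage y.
Proof.
have ge a b : finite_storage a -> finite_storage b ->
    2 * storage a + 2 * storage b <= storage (a + b) + storage (a - b).
  move=> fa fb; apply/ler_addgt0Pr => e e0.
  have [u [N uN]] := storage_adherent fa (divr_gt0 e0 (ltr0Sn _ 3)).
  have [v [M vM]] := storage_adherent fb (divr_gt0 e0 (ltr0Sn _ 3)).
  have := gain_pad a u (leq_maxl N M); have := gain_pad b v (leq_maxr N M).
  set u' := concat N u _; set v' := concat M v _.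
  have := gain_parallelogram a b u' v' (maxn N M).
  have fab := finite_storageD fa fb.
  have fab' := subspaceB finite_storage_subspace fa fb.
  have := gain_le (fun k => u' k + v' k) (maxn N M) fab.
  have := gain_le (fun k => u' k - v' k) (maxn N M) fab'.
  lra.
move=> fx fy; apply/eqP; rewrite eq_le ge // andbT.
have := ge _ _ (finite_storageD fx fy) (subspaceB finite_storage_subspace fx fy).
have -> : x + y + (x - y) = 2%:C%C *: x.
  by rewrite addrACA subrr addr0 rmorphMn rmorph1 scaler_nat mulr2n.
have -> : x + y - (x - y) = 2%:C%C *: y.
  by rewrite opprB addrC addrA subrK rmorphMn rmorph1 scaler_nat mulr2n.
have [_ ->] := storageZ 2%:C%C fx; have [_ ->] := storageZ 2%:C%C fy.
rewrite rnormC ger0_norm //; lra.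
Qed.

Definition storage_dom : set X := [set x | finite_storage x /\
  forall e, 0 < e -> exists2 w, reach Sigma w & rnorm (x - w) ^+ 2 + storage (x - w) < e].

Definition storage_form x y : R := rdot x y + polar storage x y.

Lemma storageZR (t : R) x : finite_storage x -> storage (t%:C%C *: x) = t ^+ 2 * storage x.
Proof. by move=> /(storageZ t%:C%C)[_ ->]; rewrite rnormC real_normK ?num_real. Qed.

Lemma storage_formxx x : finite_storage x -> storage_form x x = rnorm x ^+ 2 + storage x.
Proof.
move=> fx; rewrite /storage_form rdotxx (polarxx finite_storage_subspace storageZR) //.
Qed.

Lemma storageD_le x y : finite_storage x -> finite_storage y ->
  rnorm (x + y) ^+ 2 + storage (x + y) <=
  2 * (rnorm x ^+ 2 + storage x) + 2 * (rnorm y ^+ 2 + storage y).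
Proof.
move=> fx fy; have := storage_parallelogram fx fy; have := parallelogram x y.
have := storage_ge0 (subspaceB finite_storage_subspace fx fy).
have := sqr_ge0 (rnorm (x - y)); lra.
Qed.

Lemma reach_subspace : lin_subspace (reach Sigma).
Proof. exact: lin_span_subspace. Qed.

Lemma reachB (u : U) : reach Sigma (B u).
Proof. by apply: lin_span_gen; exists 0%N => //; exists u. Qed.

Lemma reachA x : reach Sigma x -> reach Sigma (A x).
Proof.
apply: (lin_span_min (linear_preim_subspace (linearP A) reach_subspace)).
move=> _ [n _ [u _ <-]]; apply: lin_span_gen; exists n.+1 => //.
Qed.

Lemma reach_finite : reach Sigma `<=` finite_storage.
Proof.
apply: (lin_span_min finite_storage_subspace) => _ [n _ [u _ <-]].
have <- : traj 0 (fun k => if k is 0 then u else 0) n.+1 = iter n A (B u).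
  by elim: n => [|n IH] /=; [rewrite linear0 add0r|rewrite -IH linear0 addr0].
exact: finite_storage_reachable.
Qed.

Lemma reach_storage_dom : reach Sigma `<=` storage_dom.
Proof.
move=> x rx; split=> [|e e0]; first exact: reach_finite.
by exists x => //; rewrite subrr rnorm0 storage0 expr0n addr0.
Qed.

Lemma storage_dom_subspace : lin_subspace storage_dom.
Proof.
have fs := finite_storage_subspace; have rf := reach_finite.
split=> [|x y [fx hx] [fy hy]|c x [fx hx]].
- by apply: reach_storage_dom; exact: subspace0 reach_subspace.
- split=> [|e e0]; first exact: finite_storageD.
  have [w rw xw] := hx (e / 4) (divr_gt0 e0 (ltr0Sn _ 3)).
  have [v rv yv] := hy (e / 4) (divr_gt0 e0 (ltr0Sn _ 3)).
  exists (w + v); first exact: (subspaceD reach_subspace).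
  have := storageD_le (subspaceB fs fx (rf _ rw)) (subspaceB fs fy (rf _ rv)).
  by rewrite addrACA -opprD; lra.
- split=> [|e e0]; first by case: (storageZ c fx).
  have c0 : 0 < rnorm c ^+ 2 + 1 by rewrite ltr_wpDl ?sqr_ge0.
  have [w rw] := hx _ (divr_gt0 e0 c0); rewrite ltr_pdivlMr // => xw.
  exists (c *: w); first exact: (subspaceZ reach_subspace).
  have fxw := subspaceB fs fx (rf _ rw).
  rewrite -scalerBr rnormZ exprMn; have [_ ->] := storageZ c fxw.
  have := storage_ge0 fxw; have := sqr_ge0 (rnorm (x - w)); have := sqr_ge0 (rnorm c).
  by move: xw; set p := rnorm _ ^+ 2; set q := rnorm _ ^+ 2; nra.
Qed.

Lemma storage_complete_form : complete_form storage_dom storage_form.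
Proof.
have fs := finite_storage_subspace.
have pf := polar_form fs storage_ge0 storage_parallelogram storageZR.
have sub x : storage_dom x -> finite_storage x by case.
split.
- exact: storage_dom_subspace.
- split=> [x y /sub fx /sub fy|x y z /sub fx /sub fy /sub fz|t x y /sub fx /sub fy|x /sub fx].
  + by rewrite /storage_form rdotC (rformC pf).
  + by rewrite /storage_form rdotDl (rformD pf) //; ring.
  + by rewrite /storage_form rdotZl (rformZ pf) //; ring.
  + by rewrite addr_ge0 ?rdotxx_ge0 ?(rform_ge0 pf).
- move=> x y /sub fx /sub fy; rewrite /storage_form rdot_ilr /polar.
  have fi := subspaceZ fs 'i%C fy.
  have ii z : finite_storage z -> storage ('i%C *: z) = storage z.
    by move=> /(storageZ 'i%C)[_ ->]; rewrite rnorm_i expr1n mul1r.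
  (* This pulls ['i] out of both terms of the polarization, and the storage is invariant under
     it. *)
  have e (z : X) : z = 'i%C *: (- ('i%C *: z)).
    by rewrite scalerN scalerA -expr2 sqr_i scaleN1r opprK.
  rewrite [in 'i%C *: x + y](e y) [in 'i%C *: x - y](e y) -scalerDr -scalerBr opprK.
  by rewrite !ii //; [lra|exact: subspaceD|exact: subspaceB].
- by move=> x /sub fx; rewrite storage_formxx // lerDl storage_ge0.
move=> x Dx cx; have fx n : finite_storage (x n) by exact: sub.
have fxx m n : finite_storage (x m - x n) by exact: subspaceB.
have [l xl] : exists l, rcvg x l.
  apply: rcauchy_rcvg => e e0; have [N NP] := cx _ (exprn_gt0 2 e0).
  exists N => m n mN nN; rewrite -(@ltr_pXn2r _ 2) ?nnegrE ?rnorm_ge0 ?(ltW e0) //.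
  apply: le_lt_trans (NP m n mN nN); rewrite storage_formxx // lerDl.
  exact: storage_ge0.
(* The vector [x n - l] is the limit of [x n - x m] as [m] grows, so lower semicontinuity turns the
   Cauchy condition into a bound on its storage. *)
have close e : 0 < e -> exists N, forall n, (N <= n)%N ->
    finite_storage (x n - l) /\ storage (x n - l) <= e.
  move=> /cx[N NP]; exists N => n nN.
  apply: (@storage_lsc (fun m => x n - x (m + N)%N)) => [|m].
    apply: rcvgB; first exact: rcvg_cst.
    by move: xl; rewrite /rcvg -(cvg_shiftn N (fun m => rnorm (x m - l))).
  split=> //; have := NP n (m + N)%N nN (leq_addl _ _).
  rewrite storage_formxx //; have := sqr_ge0 (rnorm (x n - x (m + N)%N)); lra.
have fl : finite_storage l.
  have [N /(_ N (leqnn N))[f _]] := close 1 ltr01.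
  by have := subspaceB fs (fx N) f; rewrite opprB addrC subrK.
have fxl n : finite_storage (x n - l) by exact: subspaceB.
have lim : storage_form (x n - l) (x n - l) @[n --> \oo] --> (0 : R).
  have -> : (fun n => storage_form (x n - l) (x n - l)) =
      (fun n => rnorm (x n - l) ^+ 2 + storage (x n - l)).
    by apply/funext => n; rewrite storage_formxx.
  have lim : rnorm (x n - l) ^+ 2 + storage (x n - l) @[n --> \oo] --> (0 : R) ^+ 2 + 0.
    apply: cvgD; first exact: cvg_sqr.
    apply/cvg0P => [n|e e0]; first exact: storage_ge0.
    have [N NP] := close (e / 2) (divr_gt0 e0 (ltr0Sn _ 1)).
    by exists N => n /NP[_ le]; lra.
  by rewrite expr0n addr0 in lim.
exists l => //; split=> // e e0.
have [|N NP] := (cvg0P _).1 lim (e / 4) (divr_gt0 e0 (ltr0Sn _ 3)).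
  by move=> n; rewrite storage_formxx // addr_ge0 ?sqr_ge0 ?storage_ge0.
have := NP N (leqnn N); rewrite storage_formxx // => xNl.
have [_ /(_ (e / 4) (divr_gt0 e0 (ltr0Sn _ 3)))[w rw xw]] := Dx N.
exists w => //; have := storageD_le (subspaceN fs (fxl N)) (subspaceB fs (fx N) (reach_finite rw)).
rewrite opprB addrA subrK.
have -> : storage (l - x N) = storage (x N - l).
  by rewrite -opprB -scaleRN1 storageZR // sqrrN expr1n mul1r.
rewrite (rnormB l (x N)); lra.
Qed.

Lemma storage_dom_invariant x (u : U) : storage_dom x -> storage_dom (A x + B u).
Proof.
move=> [fx hx]; have fs := finite_storage_subspace.
split=> [|e e0]; first by case: (storage_dissipation u fx).
have [M M0 hA] := (bounded_opP _).1 (sysA_bounded Sigma).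
have m0 : 0 < M ^+ 2 + 1 by rewrite ltr_wpDl ?sqr_ge0.
have [w rw] := hx _ (divr_gt0 e0 m0); rewrite ltr_pdivlMr // => xw.
exists (A w + B u).
  by apply: (subspaceD reach_subspace); [exact: reachA|exact: reachB].
(* Dissipation with zero input bounds the storage of the new error by that of [x - w]. *)
have -> : A x + B u - (A w + B u) = A (x - w) + B 0.
  by rewrite opprD addrACA subrr linear0 -(linearB A).
have fxw := subspaceB fs fx (reach_finite rw).
have [_ ] := storage_dissipation 0 fxw; rewrite rnorm0 expr0n subr0.
have := sqr_ge0 (rnorm (C (x - w) + D 0)); have := storage_ge0 fxw.
rewrite (linear0 B) (linear0 D) !addr0.
have : rnorm (A (x - w)) ^+ 2 <= M ^+ 2 * rnorm (x - w) ^+ 2.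
  by rewrite -exprMn lerXn2r ?nnegrE ?mulr_ge0 ?rnorm_ge0.
have := sqr_ge0 (rnorm (x - w)); move: xw; set p := rnorm (x - w) ^+ 2.
set q := storage (x - w); have := sqr_ge0 M; nra.
Qed.

Lemma storage_definite x : unobs Sigma = [set 0] -> finite_storage x ->
  storage x = 0 -> x = 0.
Proof.
move=> ob fx x0; have : unobs Sigma x; last by rewrite ob.
move=> n _ /=; have := gain_le (fun=> 0) n.+1 fx.
have e k : out x (fun=> 0) k = C (iter k A x).
  rewrite /output linear0 addr0; congr (C _).
  by elim: k => //= k ->; rewrite linear0 addr0.
rewrite x0 gain_recr e rnorm0 expr0n subr0.
have := gain_zero_ge0 x n => ge le.
have : rnorm (C (iter n A x)) ^+ 2 = 0.
  by apply/eqP; rewrite eq_le sqr_ge0 andbT; lra.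
by move/eqP; rewrite sqrf_eq0 => /eqP /rnorm_eq0.
Qed.

End Storage.

(** * The Riccati equality *)

Section ClosedGraph.
Variables (R : realType) (U X : hilbertType R) (S : set (X * X)) (B : U -> X).
Hypotheses (saS : selfadjoint S) (lB : linear B) (bB : bounded_op B).
Hypothesis domB : forall u, dom S (B u).
Let T u := app S (B u).

Lemma comp_linear : linear T.
Proof.
move=> c u v; have Dcu : dom S (c *: B u).
  by apply: subspaceZ; [exact: dom_subspace|exact: domB].
by rewrite /T lB (appD saS) // (appZ saS).
Qed.

(** Lower semicontinuity: [|T u|] is a supremum of [|rdot (T u) v| / |v|] over [v] in the dense
    domain of [S], and [rdot (T u) v = rdot (B u) (S v)] is continuous in [u]. *)
Lemma comp_lsc u (c : R) : 0 <= c -> c < rnorm (T u) ->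
  exists2 d : R, 0 < d & forall u', rnorm (u' - u) < d -> c < rnorm (T u').
Proof.
move=> c0; set q := rnorm (T u) => cq.
have eta0 : 0 < (q - c) / 4 by rewrite divr_gt0 // subr_gt0.
have [v Dv Tv] := (denseP _).1 saS.1 (T u) _ eta0.
have v1 : rnorm v <= q + (q - c) / 4.
  have := rnormD (T u) (v - T u); rewrite addrC subrK (rnormB v) -/q; lra.
have v2 : q ^+ 2 - q * ((q - c) / 4) <= rdot (T u) v.
  have := rdot_le (T u) (T u - v); rewrite rdotBr rdotxx -/q.
  have : q * rnorm (T u - v) <= q * ((q - c) / 4).
    by rewrite ler_wpM2l ?rnorm_ge0 // ltW.
  lra.
have cv : c * rnorm v < rdot (T u) v by nra.
have [M M0 BM] := (bounded_opP _).1 bB.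
set k := M * rnorm (app S v); have k0 : 0 <= k by rewrite mulr_ge0 ?rnorm_ge0.
have k1 : 0 < k + 1 by rewrite ltr_wpDl.
exists ((rdot (T u) v - c * rnorm v) / (k + 1)); first by rewrite divr_gt0 // subr_gt0.
move=> u'; rewrite ltr_pdivlMr // => lt.
have e : rdot (T u') v = rdot (T u) v + rdot (B (u' - u)) (app S v).
  by rewrite /T !(app_rdot saS) // (linB lB) rdotBl; ring.
have le1 := rdot_abs_le (B (u' - u)) (app S v).
have le2 : rnorm (B (u' - u)) * rnorm (app S v) <= rnorm (u' - u) * k.
  by rewrite /k mulrA (mulrC _ M) ler_wpM2r ?rnorm_ge0.
have gt : c * rnorm v < rdot (T u') v.
  have := rnorm_ge0 (u' - u); move: le1; rewrite ler_norml e => /andP[ge _]; nra.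
have v0 : 0 < rnorm v.
  rewrite lt_def rnorm_ge0 andbT; apply: contraTneq gt => /rnorm_eq0 ->.
  by rewrite rdot0r rnorm0 mulr0 ltxx.
by rewrite -(ltr_pM2r v0); apply: lt_le_trans gt (rdot_le _ _).
Qed.

Lemma comp_large u (r c : R) : ~ bounded_op T -> 0 < r ->
  exists2 u', rnorm (u' - u) < r & c < rnorm (T u').
Proof.
move=> nb r0; have lT := comp_linear.
pose M := (2 * (`|c| + rnorm (T u)) + 1) / r.
have M0 : 0 <= M.
  by rewrite divr_ge0 ?(ltW r0) // addr_ge0 // mulr_ge0 // addr_ge0 ?rnorm_ge0.
have [h hM] : exists h, M * rnorm h < rnorm (T h).
  apply: contrapT => nh; apply: nb; apply/bounded_opP; exists M => // x.
  by rewrite leNgt; apply/negP => lt; apply: nh; exists x.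
have h0 : 0 < rnorm h.
  rewrite lt_def rnorm_ge0 andbT; apply: contraTneq hM => /rnorm_eq0 ->.
  by rewrite (lin0 lT) !rnorm0 mulr0 ltxx.
set t := r / (2 * rnorm h); have t0 : 0 < t by rewrite divr_gt0 // mulr_gt0.
have th : t * rnorm h = r / 2 by rewrite /t; field; rewrite gt_eqF.
exists (u + t%:C%C *: h).
  by rewrite addrC addKr rnormZ rnormC gtr0_norm // th; lra.
rewrite (linD lT) (linZ lT).
have := rnormD (T u + t%:C%C *: T h) (- T u); rewrite addrC addKr rnormN rnormZ rnormC gtr0_norm //.
have : M * (r / 2) < t * rnorm (T h) by rewrite -th mulrCA ltr_pM2l.
have -> : M * (r / 2) = `|c| + rnorm (T u) + 1 / 2 by rewrite /M; field; rewrite gt_eqF.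
have := ler_norm c; lra.
Qed.

(* Baire's argument: otherwise nested balls on which [T] is larger and larger
   would meet in a point. *)
Lemma comp_bounded : bounded_op T.
Proof.
apply: contrapT => nb.
have stepP (nb' : nat * (U * R)) : exists w : U * R, 0 < nb'.2.2 ->
   [/\ 0 < w.2, w.2 <= nb'.2.2 / 2, rnorm (w.1 - nb'.2.1) <= nb'.2.2 / 2 &
    forall x, rnorm (x - w.1) <= w.2 -> nb'.1%:R < rnorm (T x)].
  case: nb' => n [u r] /=; have [r0|] := ltP 0 r; last by exists (0, 0).
  have r2 : 0 < r / 2 by rewrite divr_gt0.
  have [v vu vn] := comp_large u n%:R nb r2.
  have [d d0 dP] := comp_lsc (ler0n _ n) vn.
  exists (v, Num.min (r / 2) (d / 2)) => _ /=; split.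
  - by rewrite lt_min r2 divr_gt0.
  - by rewrite ge_min lexx.
  - exact: ltW.
  - move=> x; rewrite le_min => /andP[_ xd]; apply: dP; lra.
have [step st] := choice stepP.
pose z := fix z n := if n is m.+1 then step (m, z m) else (0 : U, 1 : R).
have z0 n : 0 < (z n).2.
  by elim: n => [|n IH] /=; [exact: ltr01|case: (st (n, z n) IH)].
have zS n : [/\ 0 < (z n.+1).2, (z n.+1).2 <= (z n).2 / 2,
    rnorm ((z n.+1).1 - (z n).1) <= (z n).2 / 2 &
    forall x, rnorm (x - (z n.+1).1) <= (z n.+1).2 -> n%:R < rnorm (T x)].
  exact: (st (n, z n) (z0 n)).
have r1 n : (z n.+1).2 <= (z n).2 / 2 by case: (zS n).
have near m n : (m <= n)%N -> rnorm ((z n).1 - (z m).1) <= (z m).2 - (z n).2.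
  move=> /subnK <-; elim: (n - m)%N => [|k IH]; first by rewrite add0n !subrr rnorm0.
  rewrite addSn; have [_ h r _] := zS (k + m)%N.
  have := rnormD ((z (k + m).+1).1 - (z (k + m)%N).1) ((z (k + m)%N).1 - (z m).1).
  by rewrite addrA subrK; lra.
have small n : (z n).2 <= 2 ^- n.
  elim: n => [|n IH]; first by rewrite expr0 invr1.
  by have := r1 n; rewrite exprS invfM; lra.
have [l zl] : exists l, rcvg (fun n => (z n).1) l.
  apply: rcauchy_rcvg => e e0; have [N NP] := invn_small e0.
  have zN : (z N).2 < e.
    apply: le_lt_trans (small N) _; apply: le_lt_trans (NP N (leqnn N)).
    rewrite lef_pV2 ?posrE ?exprn_gt0 ?ltr0n // -natrX ler_nat; exact: ltn_expl.
  have close m n : (N <= m)%N -> (m <= n)%N -> rnorm ((z n).1 - (z m).1) < e.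
    move=> Nm mn; apply: le_lt_trans (near _ _ mn) _.
    by have := near _ _ Nm; have := rnorm_ge0 ((z m).1 - (z N).1); have := z0 n; lra.
  exists N => m n Nm Nn; case: (leqP m n) => [mn|/ltnW nm]; last exact: close.
  by rewrite rnormB close.
have lz m : rnorm (l - (z m).1) <= (z m).2.
  have h : rcvg (fun n => (z n).1 - (z m).1) (l - (z m).1).
    by apply: rcvgB => //; exact: rcvg_cst.
  apply: (cvgr_to_le (rcvg_rnorm h)); exists m => // n /= mn.
  by have := near _ _ mn; have := z0 n; lra.
have Tl n : n%:R < rnorm (T l).
  by have [_ _ _ zT] := zS n; apply: zT; exact: lz n.+1.
have := archi_boundP (rnorm_ge0 (T l)); have := Tl (Num.bound (rnorm (T l))).
by move=> h /(lt_trans h); rewrite ltxx.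
Qed.

End ClosedGraph.

(** * One-step energy balance and completion of the square *)

Section Riccati.
Variables (R : realType) (X U Y : hilbertType R) (Sigma : system X U Y).
Variable H : set (X * X).
Local Notation A := (sysA Sigma).
Local Notation B := (sysB Sigma).
Local Notation C := (sysC Sigma).
Local Notation D := (sysD Sigma).
Local Notation S := (op_sqrt H).
Local Notation sqrtB := (sqrtB Sigma H).
Local Notation delta := (delta Sigma H).
Local Notation cross := (cross Sigma H).
Local Notation N := (delta_sqrt Sigma H).
Hypothesis saS : selfadjoint S.
Hypothesis domA : forall x, dom S x -> dom S (A x).
Hypothesis domB : forall u, dom S (B u).

Let sD := dom_subspace saS.
Let lsB : linear sqrtB := comp_linear saS (linearP B) domB.
(** Boundedness is what turns [adj sqrtB], occurring in [delta] and [cross], into a genuine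
    adjoint. *)
Let bsB : bounded_op sqrtB := comp_bounded saS (linearP B) (sysB_bounded Sigma) domB.
Let lD := linearP D.
Let bD := sysD_bounded Sigma.

Lemma delta_inner u v :
  inner u (delta v) = inner u v - inner (D u) (D v) - inner (sqrtB u) (sqrtB v).
Proof.
by rewrite /Defs.delta !innerBr -(adj_inner lD bD) -(adj_inner lsB bsB).
Qed.

Lemma delta_symmetric : op_symmetric delta.
Proof.
move=> u v; rewrite delta_inner inner_conj delta_inner !rmorphB /=.
by rewrite -!inner_conj.
Qed.

Lemma delta_rdot u : rdot (delta u) u = rnorm u ^+ 2 - rnorm (D u) ^+ 2 - rnorm (sqrtB u) ^+ 2.
Proof. by rewrite rdotC /rdot delta_inner !raddfB /= -!/(rdot _ _) !rdotxx. Qed.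

Lemma cross_rdot u x : rdot u (cross x) = rdot (D u) (C x) + rdot (sqrtB u) (app S (A x)).
Proof. by rewrite rdotDr -(adj_rdot lD bD) -(adj_rdot lsB bsB). Qed.

(** The energy dissipated in one step when [|S x|^2] is the stored energy. The Riccati equality
    expresses that its infimum over [u] is 0. *)
Definition gap x u := rnorm (app S x) ^+ 2 + rnorm u ^+ 2
  - rnorm (app S (A x + B u)) ^+ 2 - rnorm (C x + D u) ^+ 2.

Definition loss x := rnorm (app S x) ^+ 2 - rnorm (app S (A x)) ^+ 2 - rnorm (C x) ^+ 2.

Lemma gapE x u : dom S x -> gap x u = loss x + rdot (delta u) u - 2 * rdot u (cross x).
Proof.
move=> Dx; have e : app S (A x + B u) = app S (A x) + sqrtB u.
  by rewrite (appD saS) //; exact: domA.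
rewrite /gap e !rnormD_sqr delta_rdot cross_rdot /loss.
rewrite (rdotC (D u)) (rdotC (sqrtB u)); ring.
Qed.

Section DeltaSqrt.
Hypothesis delta_ge0 : forall u, 0 <= rdot (delta u) u.

Lemma delta_contraction : positive_contraction delta.
Proof.
split=> [|u]; first exact: delta_symmetric.
rewrite delta_ge0 /= delta_rdot.
have := sqr_ge0 (rnorm (D u)); have := sqr_ge0 (rnorm (sqrtB u)); lra.
Qed.

Lemma delta_sqrtP : is_sqrt (graph delta) N.
Proof.
rewrite /delta_sqrt /op_sqrt; case: xgetP => [S' -> //|nS].
have [P [pP PP _]] := positive_sqrt delta_contraction.
case: (nS (graph P)); split.
- split; first by apply/denseP => x e e0; exists x; [exists (P x)|rewrite subrr rnorm0].
  apply/seteqP; split=> [[u v] /= h|[u v]]; last first.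
    by rewrite /graph /= => -> x y /= ->; rewrite pP.1.
  apply: rdot_eqP => z; rewrite symm_rdot; last exact: pP.1.
  by rewrite rdotC /rdot -(h z (P z)) // -/(rdot _ _) rdotC.
- move=> x _; have -> : app (graph P) x = P x.
    by rewrite /app; case: xgetP => [y _ //|/(_ (P x))[]].
  have /andP[ge _] := pP.2 x.
  by rewrite (symm_inner_real _ pP.1) ler0c.
- apply/seteqP; split=> [[u v] [y]|[u v]].
    by rewrite /graph /= => -> ->; rewrite PP.
  by rewrite /graph /= => ->; exists (P u); rewrite //= PP.
Qed.

Let saN : selfadjoint N. Proof. by case: delta_sqrtP. Qed.

Lemma dom_delta_sqrt u : dom N u.
Proof.
have [_ _ NN] := delta_sqrtP.
have : op_comp N N (u, delta u) by rewrite NN.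
by move=> [y Ny _]; exists y.
Qed.

Lemma app_delta_sqrt u : rnorm (app N u) ^+ 2 = rdot (delta u) u.
Proof.
have [_ _ NN] := delta_sqrtP.
have : op_comp N N (u, delta u) by rewrite NN.
move=> [y /= Nu Ny]; rewrite (sa_appE saN Nu) -rdotxx.
by rewrite (sa_rdot saN Nu Ny) rdotC.
Qed.

(** The closure of the range of [N] is orthogonal to its kernel, so a preimage in that closure is
    unique and the kernel component of [c] vanishes. *)
Lemma pinvE w c : N (w, c) -> closure (ran N) w -> app (Defs.pinv N) c = w.
Proof.
have orth x v : closure (ran N) x -> N (v, 0) -> rdot x v = 0.
  move=> /rcvg_closure[y Ny yx] Nv; apply: (cvg_eq_cst (u := fun n => rdot (y n) v)).
    by move=> n; have [z Nz] := Ny n; rewrite (sa_rdot saN Nz Nv) rdot0r.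
  exact: rcvg_rdotl.
move=> Nw cw; rewrite /app; case: xgetP => [w' _|/(_ w)[]]; last first.
  exists c, 0; split=> //=; [exact: sa0|by rewrite addr0].
move=> [y [k [/= cw' Nw' Nk cyk]]].
have k0 : k = 0.
  apply/rnorm_eq0/eqP; rewrite -sqrf_eq0 -rdotxx {1}(_ : k = c - y); last first.
    by rewrite cyk addrC addKr.
  have Nwy := saB saN Nw Nw'.
  by rewrite (sa_rdot saN Nwy Nk) rdot0r.
have Nww : N (w' - w, 0).
  have := saB saN Nw' Nw; rewrite cyk k0 addr0 subrr; exact.
apply/eqP; rewrite -subr_eq0; apply/eqP/rnorm_eq0/eqP; rewrite -sqrf_eq0 -rdotxx.
by rewrite {1}rdotBl (orth w') // (orth w) // subrr.
Qed.

Lemma ran_delta_sqrt c : ran N c -> exists2 w, N (w, c) & closure (ran N) w.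
Proof.
move=> [v Nv]; have [||w [Nw cw _]] := @sa_range _ _ N saN c (rnorm v ^+ 2).
- exact: sqr_ge0.
- move=> x Dx; rewrite -(sa_rdot saN (sa_app Dx) Nv) mulrC; exact: rdot_sqr_le.
- by exists w.
Qed.

(** Completion of the square in [gapE], using [<delta u, u> = |N u|^2] and
    [<u, cross x> = <N u, w>]. *)
Lemma gap_square x u w : dom S x -> N (w, cross x) ->
  gap x u = loss x - rnorm w ^+ 2 + rnorm (app N u - w) ^+ 2.
Proof.
move=> Dx Nw; rewrite gapE // -app_delta_sqrt rnormB_sqr.
rewrite (sa_rdot saN (sa_app (dom_delta_sqrt u)) Nw); ring.
Qed.

End DeltaSqrt.

Lemma gap_delta_ge0 : (forall u, 0 <= gap 0 u) -> forall u, 0 <= rdot (delta u) u.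
Proof.
move=> g u; have D0 := subspace0 sD; have := g u; rewrite gapE //.
have c0 : rdot u (cross 0) = 0.
  by rewrite cross_rdot !linear0 (sa_appE saS (sa0 saS)) !rdot0r addr0.
rewrite c0 /loss linear0 (sa_appE saS (sa0 saS)) linear0 !rnorm0; lra.
Qed.

(* Minimizing the quadratic function [gap x] over the inputs [u] gives the
   Riccati equality. *)
Lemma riccati_of_gap : selfadjoint H ->
  (forall x, dom H x -> x != 0 -> 0 < inner (app H x) x) ->
  (forall x u, dom S x -> 0 <= gap x u) ->
  (forall x e, dom S x -> 0 < e -> exists u, gap x u <= e) -> RE Sigma H.
Proof.
move=> saH posH g0 ginf; have D0 := subspace0 sD.
have d0 : forall u, 0 <= rdot (delta u) u by apply: gap_delta_ge0 => u; exact: g0.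
have cP := delta_contraction d0; have [saN _ _] := delta_sqrtP d0.
have wP x : dom S x -> exists2 w, N (w, cross x) & closure (ran N) w /\ loss x = rnorm w ^+ 2.
  move=> Dx; have l0 : 0 <= loss x.
    by have := g0 x 0 Dx; rewrite gapE // (lin0 (symm_linear cP.1)) !rdot0l; lra.
  have [//||w [Nw cw wl]] := @sa_range _ _ N saN (cross x) (loss x).
    move=> u _; rewrite app_delta_sqrt // -sqrrN.
    (* Nonnegativity of [gap x (t u)] for all real [t] yields the hypothesis of [sa_range]. *)
    apply: discriminant_le => // t.
    have := g0 x (t%:C%C *: u) Dx.
    by rewrite gapE // (linZ (symm_linear cP.1)) !rdotZl rdotZr; lra.
  exists w => //; split=> //; apply/eqP; rewrite eq_le wl andbT.
  apply/ler_addgt0Pr => e e0; have [u] := ginf x e Dx e0.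
  rewrite (gap_square d0 u Dx Nw); have := sqr_ge0 (rnorm (app N u - w)); lra.
split=> //; split=> //.
- split.
  + apply/bounded_opP; exists 1 => // u; rewrite mul1r.
    exact: positive_contraction_le.
  + by move=> u; rewrite (symm_inner_real _ cP.1) ler0c.
  + by move=> x /wP[w Nw _]; exists w.
- move=> x Dx; have [w Nw [cw lw]] := wP x Dx.
  rewrite (pinvE d0 Nw cw) !rnormE -!rmorphXn -!rmorphB /=; congr (_%:C%C).
  exact: lw.
Qed.

End Riccati.

Section RiccatiSolution.
Variables (R : realType) (X U Y : hilbertType R) (Sigma : system X U Y).
Variable H : set (X * X).
Local Notation S := (op_sqrt H).
Hypothesis reH : RE Sigma H.

(** If [H] had no root, [op_sqrt H] would be the default [set0], whose domain does not contain
    [B 0]. *)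
Lemma RE_sqrt : is_sqrt H S.
Proof.
have [_ [_ [_ domB] _ _]] := reH.
have [y] := domB 0; rewrite /op_sqrt; case: xgetP => [S' _ //|_ []].
Qed.

Lemma RE_gap_ge0 x u : dom S x -> 0 <= gap Sigma H x u.
Proof.
have [saS _ _] := RE_sqrt; have [_ [_ [domA domB] [_ d0 rd] eq4]] := reH.
have {}d0 v : 0 <= rdot (delta Sigma H v) v by have := d0 v; rewrite lecE => /andP[].
move=> Dx; have [saN _ _] := delta_sqrtP saS domB d0.
have [w Nw cw] := ran_delta_sqrt saS domB d0 (rd x Dx).
rewrite (gap_square saS domA domB d0 u Dx Nw).
have := eq4 x Dx; rewrite (pinvE saS domB d0 Nw cw) !rnormE -!rmorphXn -!rmorphB /=.
move=> /complexI; rewrite -/(loss Sigma H x) => ->.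
by rewrite subrr add0r sqr_ge0.
Qed.

Lemma RE_gain_le x u N : dom S x -> gain Sigma x u N <= rnorm (app S x) ^+ 2.
Proof.
have [saS _ _] := RE_sqrt; have [_ [_ [domA domB] _ _]] := reH.
elim: N x u => [|N IH] x u Dx; first by rewrite gain0 sqr_ge0.
have Dxu : dom S (sysA Sigma x + sysB Sigma (u 0)).
  by apply: (subspaceD (dom_subspace saS)); [exact: domA|exact: domB].
rewrite gain_recl; have := IH _ (u \o Datatypes.S) Dxu.
by have := RE_gap_ge0 (u 0) Dx; rewrite /gap; lra.
Qed.

End RiccatiSolution.

(** * The minimal solution *)

Section MinimalSolution.
Variables (R : realType) (X U Y : hilbertType R) (Sigma : system X U Y).
Local Notation A := (sysA Sigma).
Local Notation B := (sysB Sigma).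
Local Notation C := (sysC Sigma).
Local Notation D := (sysD Sigma).
Local Notation output := (output Sigma).
Hypothesis contractive : forall u N,
  \sum_(k < N) rnorm (output 0 u k) ^+ 2 <= \sum_(k < N) rnorm (u k) ^+ 2.
Hypothesis Sigma_minimal : minimal_system Sigma.
Variable H : set (X * X).
Local Notation S := (op_sqrt H).
Hypotheses (saH : selfadjoint H) (sqrtH : is_sqrt H S).
Hypothesis domS : forall x, dom S x <-> storage_dom Sigma x.
Hypothesis normS : forall x, storage_dom Sigma x -> rnorm (app S x) ^+ 2 = storage Sigma x.

Let saS : selfadjoint S. Proof. by case: sqrtH. Qed.
Let fs := finite_storage_subspace contractive.

Lemma dom_finite x : dom S x -> finite_storage Sigma x.
Proof. by move=> /domS[]. Qed.

Lemma reach_dom x : reach Sigma x -> dom S x.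
Proof. by move=> rx; apply/domS; exact: reach_storage_dom. Qed.

Lemma norm_app x : dom S x -> rnorm (app S x) ^+ 2 = storage Sigma x.
Proof. by move=> /domS /normS. Qed.

Lemma sqrt_injective z : S (z, 0) -> z = 0.
Proof.
move=> Sz; have Dz : dom S z by exists 0.
apply: (storage_definite Sigma_minimal.2); first exact: dom_finite.
by rewrite -norm_app // (sa_appE saS Sz) rnorm0 expr0n.
Qed.

Lemma sqrt_core x e : dom S x -> 0 < e -> exists2 w, reach Sigma w &
  rnorm (x - w) ^+ 2 + rnorm (app S (x - w)) ^+ 2 < e.
Proof.
move=> Dx e0; have [_ hx] := (domS x).1 Dx; have [w rw xw] := hx e e0.
exists w => //; rewrite norm_app //.
by apply: subspaceB (dom_subspace saS) Dx (reach_dom rw).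
Qed.

Lemma storage_RE : RE Sigma H.
Proof.
have gapS x u : dom S x -> gap Sigma H x u =
    storage Sigma x + rnorm u ^+ 2 - storage Sigma (A x + B u) - rnorm (C x + D u) ^+ 2.
  move=> Dx; rewrite /gap !norm_app //; apply/domS.
  exact/storage_dom_invariant/domS.
apply: riccati_of_gap => //.
- move=> x /domS Dx; apply/domS; rewrite -[A x]addr0 -(linear0 B).
  exact: storage_dom_invariant.
- by move=> u; apply: reach_dom; exact: reachB.
- move=> x [z Hxz] x0; have [_ _ SS] := sqrtH.
  have : op_comp S S (x, z) by rewrite SS.
  move=> [y /= Sxy Syz]; rewrite (sa_appE saH Hxz) (sa_sym saS Syz Sxy) inner_xx.
  rewrite ltcR exprn_gt0 // lt_def rnorm_ge0 andbT.
  apply: contra_neq x0 => /rnorm_eq0 y0; apply: sqrt_injective.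
  by rewrite -y0.
- move=> x u Dx; rewrite gapS //.
  by have [_ ] := storage_dissipation u (dom_finite Dx); lra.
- move=> x e Dx e0; have [u hu] := storage_bellman (dom_finite Dx) e0.
  by exists u; rewrite gapS //; lra.
Qed.

(** By the core property, a vector orthogonal to this image is orthogonal to the whole range of [S],
    hence lies in its kernel. *)
Lemma dense_sqrt_reach : dense (app S @` reach Sigma).
Proof.
have sr := reach_subspace Sigma; apply: dense_orth.
  split=> [|_ _ [x rx <-] [y ry <-]|c _ [x rx <-]].
  - exists 0; first exact: subspace0.
    exact: (sa_appE saS (sa0 saS)).
  - exists (x + y); first exact: subspaceD.
    by rewrite (appD saS) //; exact: reach_dom.
  - exists (c *: x); first exact: subspaceZ.
    by rewrite (appZ saS) //; exact: reach_dom.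
move=> v vr; apply: sqrt_injective; apply: (sa_mem saS) => x y Sxy.
rewrite rdot0r; have Dx : dom S x by exists y.
rewrite -(sa_appE saS Sxy); apply/eqP; rewrite -normr_eq0 eq_le normr_ge0 andbT.
apply/ler_addgt0Pr => e e0; rewrite add0r.
have v1 : 0 < rnorm v + 1 by rewrite ltr_wpDl ?rnorm_ge0.
have d0 : 0 < e / (rnorm v + 1) by rewrite divr_gt0.
have [w rw xw] := sqrt_core Dx (exprn_gt0 2 d0).
have -> : rdot (app S x) v = rdot (app S (x - w)) v.
  have wv : rdot (app S w) v = 0 by rewrite rdotC vr //; exists w.
  by rewrite (appB saS) ?rdotBl ?wv ?subr0 //; exact: reach_dom.
apply: le_trans (rdot_abs_le _ _) _.
have : rnorm (app S (x - w)) < e / (rnorm v + 1).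
  rewrite -(@ltr_pXn2r _ 2) ?nnegrE ?rnorm_ge0 ?(ltW d0) //.
  by apply: le_lt_trans xw; rewrite lerDr sqr_ge0.
rewrite ltr_pdivlMr // => lt; apply: le_trans (ltW lt).
by rewrite ler_wpM2l ?rnorm_ge0 // lerDl.
Qed.

Lemma core_reach : is_core (reach Sigma) S.
Proof.
split=> [|x Dx _ /gt0_real[e e0 ->]]; first exact: reach_dom.
have [w rw xw] := sqrt_core Dx (exprn_gt0 2 e0).
exists w => //; rewrite -(appB saS) //; last exact: reach_dom.
by rewrite !rnormE -!rmorphXn -rmorphD ltcR.
Qed.

Lemma output_free x k : output x (fun=> 0) k = C (iter k A x).
Proof.
rewrite /output linear0 addr0; congr (C _).
by elim: k => //= k ->; rewrite linear0 addr0.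
Qed.

Lemma free_output_le x k : dom S x -> rnorm (C (iter k A x)) <= rnorm (app S x).
Proof.
move=> Dx; rewrite -(@ler_pXn2r _ 2) ?nnegrE ?rnorm_ge0 // norm_app //.
have := gain_le (fun=> 0) k.+1 (dom_finite Dx).
rewrite gain_recr output_free rnorm0 expr0n subr0.
by have := gain_zero_ge0 Sigma x k; lra.
Qed.

Definition observation k y := iter k (adj A) (adj C y).

Lemma observation_rdot k x y : rdot x (observation k y) = rdot (C (iter k A x)) y.
Proof.
rewrite (adj_rdot (linearP C) (sysC_bounded Sigma)) /observation.
elim: k x => //= k IH x; rewrite -(adj_rdot (linearP A) (sysA_bounded Sigma)) IH.
by rewrite -iterSr.
Qed.

(** Stored energy bounds the free output, which is the estimate that [sa_range] turns into a
    preimage of controlled norm. *)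
Lemma observation_range k y :
  exists2 z, S (z, observation k y) & rnorm z <= rnorm y.
Proof.
have [||z [Sz _ zy]] := @sa_range _ _ S saS (observation k y) (rnorm y ^+ 2).
- exact: sqr_ge0.
- move=> x Dx; rewrite observation_rdot; apply: le_trans (rdot_sqr_le _ _) _.
  by rewrite mulrC ler_wpM2l ?sqr_ge0 // lerXn2r ?nnegrE ?rnorm_ge0 // free_output_le.
- by exists z => //; rewrite -(@ler_pXn2r _ 2) ?nnegrE ?rnorm_ge0.
Qed.

Lemma app_op_inv z c : S (z, c) -> app (op_inv S) c = z.
Proof.
move=> Sz; rewrite /app; case: xgetP => [z' _|/(_ z)[//]].
rewrite /op_inv /= => Sz'; apply/eqP; rewrite -subr_eq0; apply/eqP/sqrt_injective.
by have := saB saS Sz' Sz; rewrite subrr.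
Qed.

(** The parallelogram laws of storage and gain are subtracted, with input [u] at [x1] and zero input
    at [d]. The terms dropped are the nonnegative defect at [x1 - d] and the nonnegative gain at
    [d]. *)
Lemma storage_gap_le x1 d u N : finite_storage Sigma x1 -> finite_storage Sigma d ->
  storage Sigma (x1 + d) - gain Sigma (x1 + d) u N <=
  2 * (storage Sigma x1 - gain Sigma x1 u N) + 2 * storage Sigma d.
Proof.
move=> f1 fd; have := storage_parallelogram contractive f1 fd.
have := gain_parallelogram Sigma x1 d u (fun=> 0) N.
have -> : (fun k => u k + 0) = u by apply/funext => k; rewrite addr0.
have -> : (fun k => u k - 0) = u by apply/funext => k; rewrite subr0.
have := gain_le u N (subspaceB fs f1 fd); have := gain_zero_ge0 Sigma d N; lra.
Qed.

(** The output is the free one plus the one from state 0, whose gain is nonpositive; what remains is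
    the cross term and the free energy. *)
Lemma gain_small x u N eta : (forall k, rnorm (C (iter k A x)) <= eta) ->
  gain Sigma x u N <= 2 * eta * \sum_(k < N) rnorm (output 0 u k) + N%:R * eta ^+ 2.
Proof.
move=> small; have eta0 : 0 <= eta by apply: le_trans (small 0%N); exact: rnorm_ge0.
have g0 := gain_from0 contractive u N.
have -> : N%:R * eta ^+ 2 = \sum_(k < N) eta ^+ 2.
  by rewrite sumr_const card_ord mulr_natl.
rewrite mulr_sumr -big_split /=.
set Bd := \sum_(i < N) _; have le0 : Bd + gain Sigma 0 u N <= Bd by rewrite gerDl.
apply: le_trans le0; rewrite /Bd /gain -big_split /=.
apply: ler_sum => k _.
have -> : output x u k = output x (fun=> 0) k + output 0 u k.
  have := out_linear Sigma 1 x 0 (fun=> 0) u k; rewrite !scale1r addr0 => <-.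
  by congr (output _ _ _); apply/funext => j; rewrite ?scaler0 add0r.
rewrite rnormD_sqr output_free; have := small k; set a := C _; set b := output _ _ _.
have := rdot_le a b; have := rnorm_ge0 a; have := rnorm_ge0 b => b0 a0 ab ae.
have : rnorm a * rnorm b <= eta * rnorm b by rewrite ler_wpM2r.
have : rnorm a ^+ 2 <= eta ^+ 2 by rewrite lerXn2r.
lra.
Qed.

(* A vector orthogonal to [S^-1 coreach] is a limit of states [S x] with vanishing
   free output; their storage is then at most that of the zero state. *)
Lemma dense_inv_sqrt_coreach : dense (app (op_inv S) @` coreach Sigma).
Proof.
have sc : lin_subspace (coreach Sigma) := lin_span_subspace _.
have cr : coreach Sigma `<=` ran S.
  apply: lin_span_min.
    split=> [|x y [a Sa] [b Sb]|c x [a Sa]].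
    - by exists 0; exact: sa0.
    - by exists (a + b); exact: saD.
    - by exists (c *: a); exact: saZ.
  by move=> _ [k _ [y _ <-]]; have [z Sz _] := observation_range k y; exists z.
apply: dense_orth.
  split=> [|_ _ [x rx <-] [y ry <-]|c _ [x rx <-]].
  - exists 0; first exact: subspace0.
    exact: (app_op_inv (sa0 saS)).
  - have [a Sa] := cr x rx; have [b Sb] := cr y ry.
    exists (x + y); first exact: subspaceD.
    by rewrite (app_op_inv Sa) (app_op_inv Sb) (app_op_inv (saD saS Sa Sb)).
  - have [a Sa] := cr x rx; exists (c *: x); first exact: subspaceZ.
    by rewrite (app_op_inv Sa) (app_op_inv (saZ saS c Sa)).
move=> v vr.
have free x k : dom S x -> rnorm (C (iter k A x)) <= rnorm (app S x - v).
  move=> Dx; set y := C _; have [z Sz zy] := observation_range k y.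
  have zv : rdot v z = 0.
    apply: vr; exists (observation k y); last exact: app_op_inv.
    by apply: lin_span_gen; exists k => //; exists y.
  have yy : rnorm y ^+ 2 <= rnorm (app S x - v) * rnorm y.
    rewrite -rdotxx -observation_rdot -(sa_rdot saS (sa_app Dx) Sz).
    apply: le_trans (_ : rdot (app S x - v) z <= _).
      by rewrite rdotBl zv subr0.
    apply: le_trans (rdot_le _ _) _.
    by rewrite ler_wpM2l ?rnorm_ge0.
  have [->|y0] := eqVneq (rnorm y) 0; first exact: rnorm_ge0.
  by move: yy; rewrite expr2 ler_pM2r // lt_def y0 rnorm_ge0.
have dS := (denseP _).1 dense_sqrt_reach v.
apply/rnorm_eq0/eqP; rewrite eq_le rnorm_ge0 andbT; apply/ler_addgt0Pr => e5 e50.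
(* The five parts are one for [|v - S x2|] and four for [|S x2|]. *)
rewrite add0r; have [e e0 e5E] : exists2 e, 0 < e & 5 * e = e5.
  by exists (e5 / 5); [rewrite divr_gt0|field].
have [_ [x1 rx1 <-] x1v] := dS e e0; have D1 := reach_dom rx1.
have [u [N uN]] := storage_adherent (dom_finite D1) (exprn_gt0 2 e0).
set T := \sum_(k < N) rnorm (output 0 u k).
have T0 : 0 <= T by apply: sumr_ge0 => k _; exact: rnorm_ge0.
(* The order of choices matters: [x1] fixes the near-optimal [u] and [N], and only then is [S x2]
   taken so close to [v] that [u] extracts almost nothing from [x2]. *)
have [eta [eta0 etae etaT etaN]] : exists eta, [/\ 0 < eta, eta <= e,
    eta * T <= e ^+ 2 & N%:R * eta ^+ 2 <= e ^+ 2].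
  have T1 : 0 < T + 1 by rewrite ltr_wpDl.
  have N1 : 0 < N%:R + 1 :> R by rewrite ltr_wpDl.
  set m := Num.min (e ^+ 2 / (T + 1)) (e / (N%:R + 1)).
  have mT : m <= e ^+ 2 / (T + 1) by rewrite ge_min lexx.
  have mN : m <= e / (N%:R + 1) by rewrite ge_min lexx orbT.
  have m0 : 0 < m by rewrite lt_min !divr_gt0 // exprn_gt0.
  move: mT mN; rewrite !ler_pdivlMr // => mT mN.
  have n0 : 0 <= N%:R :> R by [].
  have nm : 0 <= N%:R * m := mulr_ge0 n0 (ltW m0).
  have me : m <= e by lra.
  have mNe : N%:R * m <= e by lra.
  exists m; split=> //; first by have := ltW m0; lra.
  by rewrite expr2 mulrA [e ^+ 2]expr2 ler_pM // ltW.
have [_ [x2 rx2 <-] x2v] := dS eta eta0; have D2 := reach_dom rx2.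
have f1 := dom_finite D1; have f2 := dom_finite D2.
have D21 : dom S (x2 - x1) by apply: subspaceB (dom_subspace saS) D2 D1.
have := storage_gap_le u N f1 (subspaceB fs f2 f1).
rewrite (addrC x1) subrK -!norm_app //.
have := gain_small (x := x2) u N (eta := eta).
have sm k : rnorm (C (iter k A x2)) <= eta.
  by apply: le_trans (free _ k D2) _; rewrite rnormB ltW.
move=> /(_ sm); rewrite -/T => g2.
have s21 : rnorm (app S (x2 - x1)) <= 2 * e.
  rewrite (appB saS) //.
  have := rnormD (app S x2 - v) (v - app S x1); rewrite addrA subrK.
  by rewrite (rnormB (app S x2) v); lra.
have : rnorm (app S (x2 - x1)) ^+ 2 <= (2 * e) ^+ 2.
  by rewrite lerXn2r ?nnegrE ?rnorm_ge0 // mulr_ge0 // ltW.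
move: uN; rewrite -norm_app // exprMn => uN q le.
(* From [storage_gap_le] come [2 e^2 + 8 e^2] and from [gain_small] another [3 e^2], in all
   [13 e^2]. *)
have s2 : rnorm (app S x2) ^+ 2 <= (4 * e) ^+ 2.
  by rewrite exprMn; have := sqr_ge0 e; lra.
have {}s2 : rnorm (app S x2) <= 4 * e.
  by move: s2; rewrite ler_pXn2r // nnegrE ?rnorm_ge0 // mulr_ge0 // ltW.
have := rnormD (v - app S x2) (app S x2); rewrite subrK.
lra.
Qed.

Lemma storage_RE_circ : RE_circ Sigma H.
Proof.
split; [exact: storage_RE|exact: dense_sqrt_reach|exact: dense_inv_sqrt_coreach|].
exact: core_reach.
Qed.

Lemma storage_prec H' : RE_circ Sigma H' -> prec H H'.
Proof.
move=> [reH' _ _ [rd core]]; have [saS' _ _] := RE_sqrt reH'.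
have le x : dom (op_sqrt H') x ->
    finite_storage Sigma x /\ storage Sigma x <= rnorm (app (op_sqrt H') x) ^+ 2.
  move=> Dx; have g := RE_gain_le reH' _ _ Dx.
  by split; [eexists; exact: g|exact: storage_le].
have sub x : dom (op_sqrt H') x -> dom S x.
  move=> Dx; apply/domS; split=> [|e e0]; first by case: (le x Dx).
  have q0 : 0 < (Num.sqrt e)%:C%C :> R[i] by rewrite ltcR sqrtr_gt0.
  (* The graph norm of the competing root dominates the storage norm, so its core approximations
     also approximate in storage. The square root of [e] matches the squared bound in [is_core]. *)
  have [w rw] := core x Dx _ q0; rewrite !rnormE -!rmorphXn -rmorphD ltcR.
  rewrite sqr_sqrtr ?(ltW e0) // => xw; exists w => //; apply: le_lt_trans xw.
  rewrite lerD2l -(appB saS') //; last exact: rd.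
  by case: (le (x - w)) => //; apply: subspaceB (dom_subspace saS') Dx (rd _ rw).
split=> // x Dx; rewrite !rnormE lecR -(@ler_pXn2r _ 2) ?nnegrE ?rnorm_ge0 //.
by rewrite norm_app; [case: (le x Dx)|exact: sub].
Qed.

End MinimalSolution.

Theorem theorem1p3 (R : realType) (X U Y : hilbertType R)
    (sepX : separable X) (sepU : separable U) (sepY : separable Y)
    (Sigma : system X U Y)
    (Sigma_minimal : minimal_system Sigma)
    (Sigma_schur : exists2 th : R[i] -> {linear U -> Y},
       schur_class th & transfer_coincides_near0 Sigma th) :
  (exists H : set (X * X), RE_circ Sigma H) /\
  (exists2 Hmin : set (X * X), RE_circ Sigma Hmin &
     forall H : set (X * X), RE_circ Sigma H -> prec Hmin H).
Proof.
have [th schur coinc] := Sigma_schur.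
have contr := toeplitz_contraction schur coinc.
have cf := storage_complete_form contr.
have dd : dense (storage_dom Sigma).
  apply/denseP => x e e0; have [w rw xw] := (denseP _).1 Sigma_minimal.1 x e e0.
  by exists w => //; exact: reach_storage_dom.
have [H [saH [S0 sq0] HS]] := form_operator cf dd.
have sqH : is_sqrt H (op_sqrt H).
  by rewrite /op_sqrt; case: xgetP => [S' -> //|/(_ S0)[]].
have [domS nS] := HS _ sqH.
have normS x : storage_dom Sigma x -> rnorm (app (op_sqrt H) x) ^+ 2 = storage Sigma x.
  by move=> Dx; rewrite nS // (storage_formxx contr Dx.1) addrC addKr.
have HC := storage_RE_circ contr Sigma_minimal saH sqH domS normS.
split; first by exists H.
by exists H => // H' H'C; exact: storage_prec H'C.
Qed.
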